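(* Let $\mathfrak{c}$ be a big chamber for $\Phi$. Denote by $\iota[\mathfrak{c},\Phi]$ the periodic-polynomial function on $\Gamma^*$ given by $$\iota[\mathfrak{c},\Phi](\lambda)=\sum_{p\in RG(\Phi,\mathfrak{c},\Gamma)}e^{-\langle\lambda,p\rangle}\,J\left\langle\mathfrak{c},\mathrm{Tres}\left(\frac{e^{\langle\lambda,z\rangle}}{\prod_{i=1}^N\left(1-e^{\langle\beta_i,p\rangle}e^{-\langle\beta_i,z\rangle}\right)}\right)\right\rangle_{\mathrm{vol}_{\Gamma^*}}.$$ Then, for any $\lambda\in(\mathfrak{c}-\Box(\Phi))\cap\Gamma^*$, $$\iota_\Phi(\lambda)=\iota[\mathfrak{c},\Phi](\lambda).$$
   Context: $V$ is a real vector space of dimension $n$ with a rank-$n$ lattice $\Gamma$, $\Gamma^*\subset V^*$ is the dual lattice, $V_{\mathbb{C}}=V\otimes\mathbb{C}$. $\Phi=[\beta_1,\dots,\beta_N]$ is a sequence of not necessarily distinct elements of $\Gamma^*$, spanning $V^*$ and lying in an open halfspace of $V^*$. $\mathcal{B}(\Phi)$ is the set of linearly independent $n$-tuples of elements of $\Phi$ (bases $\sigma$ of $V^*$), and $C(\nu)$ is the closed cone generated by $\nu$. $\iota_\Phi(\lambda)$, $\lambda\in\Gamma^*$, is the number of solutions of $\sum_{k=1}^Nx_k\beta_k=\lambda$ in nonnegative integers $x_k$. $\Box(\Phi)=\sum_{i=1}^N[0,1]\beta_i$ and $\mathfrak{c}-\Box(\Phi)=\{x-y : x\in\mathfrak{c},\,y\in\Box(\Phi)\}$.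 A function on $\Gamma^*$ is periodic-polynomial if it is a finite linear combination of multiplicative characters of $\Gamma^*$ with values in roots of unity, with polynomial coefficients. Big chambers: the connected components of the complement in $V^*$ of the union of the cones $C(\nu)$, $\nu\subset\Phi$ of cardinality $<n$ (the complement of $C(\Phi)$ is one of them). For a big chamber $\mathfrak{c}$ and $\sigma\in\mathcal{B}(\Phi)$, either $\mathfrak{c}\subset C(\sigma)$ or $\mathfrak{c}\cap C(\sigma)=\emptyset$. $\mathcal{B}(\Phi,\mathfrak{c})=\{\sigma\in\mathcal{B}(\Phi) : \mathfrak{c}\subset C(\sigma)\}$. For $\sigma\in\mathcal{B}(\Phi)$, $G(\sigma,\Gamma)=\{p\in V_{\mathbb{C}} : e^{\langle\beta,p\rangle}=1\text{ for all }\beta\in\sigma\}\supset2\pi i\Gamma$. $G(\Phi,\mathfrak{c},\Gamma)=\bigcup_{\sigma\in\mathcal{B}(\Phi,\mathfrak{c})}G(\sigma,\Gamma)$, and $RG(\Phi,\mathfrak{c},\Gamma)$ is a (finite) set containing exactly one representative of each class of $G(\Phi,\mathfrak{c},\Gamma)$ modulo $2\pi i\Gamma$. Total residue: let $R$ be the ring of rational functions on $V_{\mathbb{C}}$ of the form $P/\prod_i\gamma_i$, $P$ polynomial, $\gamma_i$ elements of $\Phi$. For $\sigma\in\mathcal{B}(\Phi)$ let $f_\sigma=1/\prod_{\beta\in\sigma}\beta$ and let $S\subset R$ be the span of the $f_\sigma$. One has $R=\left(\sum_{v\in V_{\mathbb{C}}}\partial_vR\right)\oplus S$ (with $\partial_v$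 the directional derivative), and $\mathrm{Tres}:R\to S$ is the projection. It is extended to quotients $P/\prod_{i=1}^m\gamma_i$ with $P$ a formal power series at $0$ by replacing $P$ with its homogeneous component of degree $m-n$. Meromorphic functions of $z$ are expanded at $z=0$. Jeffrey–Kirwan functional: $\mathrm{vol}_{\Gamma^*}$ is the measure on $V^*$ for which a minimal parallelepiped spanned by elements of $\Gamma^*$ has volume $1$; $f\mapsto J\langle\mathfrak{c},f\rangle_{\mathrm{vol}_{\Gamma^*}}$ is the (well-defined) linear functional on $S$ with $J\langle\mathfrak{c},f_\sigma\rangle_{\mathrm{vol}_{\Gamma^*}}=\mathrm{vol}_{\Gamma^*}(\sigma)^{-1}$ if $\mathfrak{c}\subset C(\sigma)$ and $0$ if $\mathfrak{c}\cap C(\sigma)=\emptyset$, where $\mathrm{vol}_{\Gamma^*}(\sigma)$ is the volume of $\sum_{\beta\in\sigma}[0,1]\beta$. *)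

(* Defs.v *)
From HB Require Import structures.
From mathcomp Require Import all_boot all_order all_algebra fraction complex finmap.
From mathcomp Require Import all_classical all_reals all_analysis.
From mathcomp Require Import (canonicals, coercions) mpoly.

Set Implicit Arguments.
Unset Strict Implicit.
Unset Printing Implicit Defensive.

Import Order.TTheory GRing.Theory Num.Theory.
Import numFieldNormedType.Exports.
Import VectorInternalTheory.

Local Open Scope classical_set_scope.
Local Open Scope ring_scope.
Local Open Scope complex_scope.

Section RealVectorSpace.
Variables (R : realType) (W : vectType R).
Implicit Types (L A : set W) (s : seq W).

Definition cone s : set W :=
  [set x | exists2 t : 'I_(size s) -> R,
     forall i, 0 <= t i & x = \sum_(i < size s) t i *: s`_i].

(* The parallelepiped spanned by s when s is free, a zonotope in general. *)
Definition box s : set W :=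
  [set x | exists2 t : 'I_(size s) -> R,
     forall i, 0 <= t i <= 1 & x = \sum_(i < size s) t i *: s`_i].

Definition Zbasis L s :=
  basis_of {:W} s /\
  L = [set x | exists z : 'I_(size s) -> int, x = \sum_(i < size s) s`_i *~ z i].

Definition is_lattice L := exists s, Zbasis L s.

(* W with the usual topology of a finite-dimensional real vector space,
   transported from row vectors along the coordinate isomorphism v2r. *)
Definition vtop : Type := initial_topology (@v2r R W).
HB.instance Definition _ := Topological.copy vtop (initial_topology (@v2r R W)).
HB.instance Definition _ := isPointed.Build vtop (0 : W).

Definition borel : Type := g_sigma_algebraType (@open vtop).
HB.instance Definition _ :=
  Measurable.copy borel (g_sigma_algebraType (@open vtop)).

(* The Haar measure normalized by L: the minimal parallelepipeds spanned by
   elements of L are those spanned by the Z-bases of L. *)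
Definition is_lattice_volume L (mu : {measure set borel -> \bar R}) :=
  (forall (A : set borel) (x : W), measurable A ->
     mu [set x + a | a in (A : set W)] = mu A) /\
  (forall s, Zbasis L s -> mu (box s) = 1%E).

End RealVectorSpace.

Section PartitionFunction.
Variables (R : realType) (V : vectType R).

Local Notation C := R[i].
Local Notation n := (\dim {:V}).
Local Notation V' := 'Hom(V, R^o).

Definition dual_lattice (Gamma : set V) : set V' :=
  [set l | forall g, Gamma g -> l g \is a Num.int].

(* (x, y) stands for the element x + i y of the complexification of V. *)
Definition complexified : Type := (V * V)%type.
HB.instance Definition _ := GRing.Zmodule.on complexified.
Local Notation VC := complexified.

Definition pairing (l : V') (p : VC) : C := (l p.1 : R) +i* (l p.2 : R).

Definition cexp (z : C) : C :=
  (expR (complex.Re z))%:C * (cos (complex.Im z) +i* sin (complex.Im z)).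

(* Polynomial functions on the complexification are written in the complex
   coordinates attached to the basis vbasis {:V} of V. *)
Local Notation Poly := (mpoly.mpoly n C).
Local Notation RatFun := {fraction Poly}.
Local Notation "p %:F" := (@FracField.tofrac _ p).

Definition coordC (v : VC) (j : 'I_n) : C :=
  coord (vbasis {:V}) j v.1 +i* coord (vbasis {:V}) j v.2.

Definition linform (l : V') : Poly :=
  \sum_(j < n) (l (tnth (vbasis {:V}) j) : R)%:C
    *: mpoly.mpolyX C (mpoly.mnm1 j).

Definition linforms (s : seq V') : Poly := \prod_(g <- s) linform g.

Definition dirder_poly (v : VC) (P : Poly) : Poly :=
  \sum_(j < n) coordC v j *: mpoly.mderiv j P.

(* The quotient rule, which does not depend on the chosen representative. *)
Definition dirder (v : VC) (f : RatFun) : RatFun :=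
  let P := (frac (repr f)).1 in let Q := (frac (repr f)).2 in
  (dirder_poly v P * Q - P * dirder_poly v Q)%:F / (Q ^+ 2)%:F.

Definition constF (a : C) : RatFun := (mpoly.mpolyC n a)%:F.

Definition Cspan (A : set RatFun) : set RatFun :=
  [set f | exists r (a : 'I_r -> C) (g : 'I_r -> RatFun),
     (forall i, A (g i)) /\ f = \sum_(i < r) constF (a i) * g i].

(* A formal power series at 0 is the sequence of its homogeneous components. *)
Local Notation series := (nat -> Poly).

Definition is_series (P : series) :=
  forall k, P k \is mpoly.ishomog1 k mpoly.mdeg.

Definition series1 : series := fun k => (k == 0%N)%:R.

Definition series_mul (P Q : series) : series :=
  fun k => \sum_(i < k.+1) P i * Q (k - i)%N.

Definition series_linforms (s : seq V') : series :=
  fun k => if k == size s then linforms s else 0.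

(* The expansion of z |-> exp <l, z>. *)
Definition series_exp (l : V') : series :=
  fun k => (k`!%:R : C)^-1 *: linform l ^+ k.

(* The expansion of z |-> 1 - u exp (- <l, z>). *)
Definition series_factor (u : C) (l : V') : series :=
  fun k => series1 k - u *: series_exp (- l) k.

Definition Gsigma (sigma : seq V') : set VC :=
  [set p | forall b, b \in sigma -> cexp (pairing b p) = 1].

Definition lattice_2ipi (Gamma : set V) : set VC :=
  [set ((0, (2 * pi) *: g) : VC) | g in Gamma].

Section Sequence.
Variables (N : nat) (Phi : N.-tuple V').

(* The solutions are finitely many as soon as Phi lies in an open halfspace. *)
Definition iota_count (lambda : V') : nat :=
  #|` fset_set [set x : {ffun 'I_N -> nat} |
        \sum_(k < N) tnth Phi k *+ x k = lambda] |.

Definition bases : set (n.-tuple V') :=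
  [set sigma : n.-tuple V' | {subset sigma <= Phi} /\ free sigma].

Definition big_chamber (c : set V') :=
  let walls := \bigcup_(nu in [set nu : seq V' |
                 {subset nu <= Phi} /\ (size nu < n)%N]) cone nu in
  exists2 x, (~` walls) x &
    c = @connected_component (vtop V') (~` walls) x.

Definition bases_chamber (c : set V') : set (n.-tuple V') :=
  [set sigma : n.-tuple V' | bases sigma /\ c `<=` cone sigma].

Definition Gchamber (c : set V') : set VC :=
  \bigcup_(sigma in bases_chamber c) Gsigma sigma.

Definition is_representatives (Gamma : set V) (c : set V') (RG : {fset VC}) :=
  (forall p, p \in RG -> Gchamber c p) /\
  (forall p, Gchamber c p ->
     exists! q, q \in RG /\ lattice_2ipi Gamma (p - q)).

Definition fsigma (sigma : seq V') : RatFun := (linforms sigma)%:F^-1.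

Definition ringR : set RatFun :=
  [set f | exists P (s : seq V'),
     {subset s <= Phi} /\ f = P%:F / (linforms s)%:F].

Definition spaceS : set RatFun :=
  Cspan [set fsigma sigma | sigma in bases].

Definition derivR : set RatFun :=
  Cspan [set h | exists v f, ringR f /\ h = dirder v f].

(* The component of f on spaceS in the direct sum
   ringR = derivR (+) spaceS. *)
Definition Tres (f : RatFun) : RatFun :=
  xget 0 [set s | spaceS s /\ derivR (f - s)].

(* Total residue of P / prod s: the degree of the retained component of P is
   size s - n, hence the result is 0 when this difference is negative. *)
Definition Tres_series (P : series) (s : seq V') : RatFun :=
  if (n <= size s)%N then Tres ((P (size s - n)%N)%:F / (linforms s)%:F) else 0.

(* Total residue of the quotient of power series A / B, rewritten in the form
   P / prod s with P a power series and s in Phi; the value does not depend on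
   the choice of P and s. *)
Definition Tres_quotient (A B : series) : RatFun :=
  xget 0 [set f | exists P (s : seq V'), [/\ is_series P, {subset s <= Phi},
     series_mul A (series_linforms s) = series_mul P B &
     f = Tres_series P s]].

Local Notation measV := {measure set (borel V') -> \bar R}.

Definition is_JK (mu : measV) (c : set V') (J : RatFun -> C) :=
  (forall a f g, spaceS f -> spaceS g ->
     J (constF a * f + g) = a * J f + J g) /\
  (forall sigma, bases sigma ->
     (c `<=` cone sigma -> J (fsigma sigma) = ((fine (mu (box sigma)))^-1)%:C) /\
     (c `&` cone sigma = set0 -> J (fsigma sigma) = 0)).

(* is_JK determines the values of J on spaceS. *)
Definition JK (mu : measV) (c : set V') : RatFun -> C :=
  xget (fun=> 0) (is_JK mu c).

Definition iota_chamber (mu : measV) (c : set V') (RG : {fset VC})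
    (lambda : V') : C :=
  \sum_(p <- RG) cexp (- pairing lambda p) *
    JK mu c (Tres_quotient (series_exp lambda)
      (\big[series_mul/series1]_(b <- Phi)
         series_factor (cexp (pairing b p)) b)).

End Sequence.

(* Functions on L are functions on the dual space considered only on L. *)
Definition root_of_unity_character (L : set V') (chi : V' -> C) :=
  (forall a b, L a -> L b -> chi (a + b) = chi a * chi b) /\
  (forall a, L a -> exists2 k, (0 < k)%N & chi a ^+ k = 1).

Definition eval_poly (P : Poly) (l : V') : C :=
  mpoly.meval (fun j => (l (tnth (vbasis {:V}) j) : R)%:C) P.

Definition periodic_polynomial (L : set V') (F : V' -> C) :=
  exists r (chi : 'I_r -> V' -> C) (P : 'I_r -> Poly),
    (forall i, root_of_unity_character L (chi i)) /\
    (forall l, L l -> F l = \sum_(i < r) chi i l * eval_poly (P i) l).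

End PartitionFunction.

(* Main.v *)
(** Let [x] be a generic point of the chamber.  The Jeffrey-Kirwan residue of
    [P / prod s] is given by a functional [Lam s P], defined by recursion on
    [size s - n] through Euler's identity; when [size s = n] it is [P(0) / vol s] if
    [x] lies in the cone of [s], and [0] otherwise.  These weights satisfy one linear
    relation for each set of [n + 1] vectors (compare volumes through half-open boxes,
    and count signs), and this makes [Lam] compatible with cancellation of factors and
    with derivations.

    Both the number of solutions and the sum over torsion points of the residues of
    [e^l / prod_(b in s) (1 - u_b e^(-b))] satisfy
    [F (l, b :: s) - F (l - b, b :: s) = F (l, s)] and
    [l(v) F (l, s) = sum_(b in s) b(v) F (l - b, b :: s)].
    Through integral relations between its elements, the first equation reduces the
    equality on [x - box s] to lists [s] whose distinct elements form a basis; the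
    second one then reduces it to a basis [s], where it is the orthogonality of the
    characters of [L / Z s]. *)
From HB Require Import structures.
Require Import Defs.
From mathcomp Require Import all_boot all_order all_algebra fraction complex finmap.
From mathcomp Require Import all_classical all_reals all_analysis.
From mathcomp Require Import (canonicals, coercions) mpoly.
From mathcomp Require Import ring lra zify.

Set Implicit Arguments.
Unset Strict Implicit.
Unset Printing Implicit Defensive.

Import Order.TTheory GRing.Theory Num.Theory.
Import numFieldNormedType.Exports.

Local Open Scope classical_set_scope.
Local Open Scope ring_scope.

(** * Linear forms and polynomials *)

(** The reduction replaces vectors by sums of vectors, and these create walls unrelated to the
    chamber. This is why the chamber is traded for one point [x], off the span of every list of
    fewer than n lattice vectors of positive height. Such spans are countably many, so [x] exists in
    the chamber with [lambda] still in [x - box Phi]. The new vectors remain lattice vectors of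
    positive height, hence [x] is chosen once; for bases drawn from [Phi], membership in a cone is
    the same for [x] as for the chamber. The box is the region where the splitting of 1/((1 - u)(1 -
    v)) can be iterated: at each of its points, one of the two splittings has both terms again
    inside their boxes. The torsion points of the formula depend on the list of vectors, which
    changes along the induction. *)

Section DualSpace.
Variables (R : realType) (V : vectType R).
Local Notation V' := 'Hom(V, R^o).
Implicit Types (s : seq V') (y b : V') (v : V).

Definition cov (j : 'I_(\dim {:V})) : V' :=
  linfun (fun v : V => coord (vbasis {:V}) j v : R^o).

Lemma covE j v : cov j v = coord (vbasis {:V}) j v :> R.
Proof. by rewrite lfunE. Qed.

Lemma dual_coord y : y = \sum_(j < \dim {:V}) (y (vbasis {:V})`_j : R) *: cov j.
Proof.
apply/lfunP => v; rewrite {1}(coord_vbasis (memvf v)) linear_sum sum_lfunE.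
by apply: eq_bigr => j _; rewrite linearZ lfunE /= covE; exact: mulrC.
Qed.

Lemma dual_evalP (phi : {linear V' -> R^o}) : exists v, forall y, y v = phi y.
Proof.
exists (\sum_(j < \dim {:V}) (phi (cov j) : R) *: (vbasis {:V})`_j) => y.
rewrite [in RHS](dual_coord y) !linear_sum; apply: eq_bigr => j _.
by rewrite !linearZ; exact: mulrC.
Qed.

Lemma dim_dual : \dim {:V'} = \dim {:V}.
Proof. by rewrite !dimvf /= /dim /= muln1. Qed.

(** Even when [s] is not free, [coord] gives linear functionals that reproduce every vector of the
    span; [t] is then one choice among many. This is the form in which Euler's identity meets a list
    of poles. *)
Lemma dual_system s : span s = fullv ->
  exists t : V' -> V, forall y, y = \sum_(b <- undup s) (y (t b) : R) *: b.
Proof.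
move=> sT; pose X := in_tuple (undup s).
have XT : <<X>>%VS = fullv.
  by rewrite -sT; apply: eq_span => b; rewrite mem_undup.
have ex i : {v | forall y, y v = coord X i y}.
  by apply: cid; apply: dual_evalP.
exists (fun b => if insub (index b X) is Some i then sval (ex i) else 0) => y.
have yX : y \in <<X>>%VS by rewrite XT memvf.
rewrite [LHS](coord_span yX) (big_nth 0) big_mkord; apply: eq_bigr => i _.
rewrite index_uniq ?undup_uniq //=; case: insubP => [j _ ij|]; last first.
  by rewrite -[X in (_ < X)%N]/(size (undup s)) ltn_ord.
rewrite (svalP (ex j)); congr (coord X _ y *: _); exact/val_inj.
Qed.

Lemma nonspanning_annihilator s : span s <> fullv ->
  exists2 v, v != 0 & forall b, b \in s -> b v = 0.
Proof.
move=> sNT; have [y ysN] : exists y, y \notin span s.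
  apply: contrapT => all_s; apply: sNT; apply/eqP; rewrite eqEsubv subvf /=.
  by apply/subvP => y _; apply: contrapT => /negP ?; apply: all_s; exists y.
(* The component in a complement of [span s] is nonzero, and any nonzero coordinate of it is a
   functional that kills [s]. *)
set W := ((span s)^C)%VS.
pose z := y - projv (span s) y.
have zW : z \in W by exact: memv_projC.
have z0 : z != 0.
  apply: contraNneq ysN => /eqP; rewrite subr_eq0 => /eqP ->.
  exact: memv_proj.
have [i zi] : exists i, coord (vbasis W) i z != 0.
  apply: contrapT => zN; move/eqP: z0; apply; rewrite (coord_vbasis zW).
  apply: big1 => i _; suff -> : coord (vbasis W) i z = 0 by rewrite scale0r.
  by apply: contrapT => /eqP ?; apply: zN; exists i.
have lin_phi : linear (fun u : V' =>
    coord (vbasis W) i (u - projv (span s) u) : R^o).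
  move=> a u w; have -> : a *: u + w - projv (span s) (a *: u + w) =
      a *: (u - projv (span s) u) + (w - projv (span s) w).
    by rewrite linearP scalerBr opprD addrACA.
  by rewrite linearP.
pose phi : {linear V' -> R^o} := HB.pack (fun u : V' =>
    coord (vbasis W) i (u - projv (span s) u) : R^o)
    (GRing.isLinear.Build _ _ _ _ _ lin_phi).
have [v vE] := dual_evalP phi; exists v.
  apply: contraNneq zi => v0; have := vE y; rewrite v0 linear0 => y0.
  by rewrite -[coord _ _ _]/(phi y) -y0.
by move=> b bs; rewrite vE /= projv_id ?memv_span // subrr linear0.
Qed.

Lemma annihilator_nonspanning s v : v != 0 ->
  (forall b, b \in s -> b v = 0) -> span s <> fullv.
Proof.
move=> v0 sv sT; have [t tE] := dual_system sT; move/eqP: v0; apply.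
rewrite (coord_vbasis (memvf v)); apply: big1 => j _.
suff -> : coord (vbasis {:V}) j v = 0 by rewrite scale0r.
rewrite -covE (tE (cov j)) sum_lfunE big_seq big1 // => b.
by rewrite mem_undup => bs; rewrite lfunE /= sv // scaler0.
Qed.

Lemma span_mono s s' : {subset s <= s'} -> span s = fullv -> span s' = fullv.
Proof.
by move=> ss' sT; apply/eqP; rewrite eqEsubv subvf -sT /= sub_span.
Qed.

Lemma spanning_size s : span s = fullv -> (\dim {:V} <= size s)%N.
Proof. by move=> sT; rewrite -dim_dual -sT dim_span. Qed.

Lemma spanning_free s : span s = fullv -> size s = \dim {:V} -> free s.
Proof. by move=> sT sn; rewrite /free sT dim_dual sn. Qed.

Lemma free_spanning s : free s -> size s = \dim {:V} -> span s = fullv.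
Proof.
move=> sf sn; apply/eqP; rewrite eqEdim subvf /= dim_dual -sn.
by move/eqP: sf => ->.
Qed.

End DualSpace.

Section PolynomialCalculus.
Local Open Scope complex_scope.
Variables (R : realType) (V : vectType R).
Local Notation V' := 'Hom(V, R^o).
Local Notation C := R[i].
Local Notation n := (\dim {:V}).
Local Notation Poly := (mpoly.mpoly n C).
Implicit Types (s : seq V') (y b : V') (v t : V) (P Q : Poly).

Lemma linformD y b : linform (y + b) = linform y + linform b.
Proof.
rewrite -big_split /=; apply: eq_bigr => j _.
by rewrite lfunE /= rmorphD scalerDl.
Qed.

Lemma linformZ (a : R) y : linform (a *: y) = a%:C *: linform y.
Proof.
rewrite scaler_sumr; apply: eq_bigr => j _.
by rewrite lfunE /= [a *: _]/(a * _) rmorphM scalerA.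
Qed.

Lemma linform0 : linform (0 : V') = 0.
Proof. by rewrite -(scale0r (0 : V')) linformZ scale0r. Qed.

Lemma linformN y : linform (- y) = - linform y.
Proof. by rewrite -scaleN1r linformZ rmorphN1 scaleN1r. Qed.

Lemma linform_sum (I : Type) (r : seq I) (F : I -> V') :
  linform (\sum_(i <- r) F i) = \sum_(i <- r) linform (F i).
Proof. by apply: (big_morph _ linformD linform0). Qed.

Lemma linform_cov (j : 'I_n) : linform (cov j) = mpoly.mpolyX C (mpoly.mnm1 j).
Proof.
have free_e : free (vbasis {:V}) by exact: (basis_free (vbasisP _)).
rewrite /linform (bigD1 j) //= big1 ?addr0 => [|i ij].
  by rewrite (tnth_nth 0) covE coord_free // eqxx rmorph1 scale1r.
by rewrite (tnth_nth 0) covE coord_free // [_ == _](negbTE _) ?scale0r // eq_sym.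
Qed.

Lemma linform_inj : injective (@linform R V).
Proof.
move=> y b yb; apply/eqP; rewrite -subr_eq0; apply/eqP.
have l0 : linform (y - b) = 0 by rewrite linformD linformN yb subrr.
move: (y - b) l0 => {yb}z z0; rewrite (dual_coord z) big1 // => j _.
rewrite [X in X *: _](_ : _ = 0) ?scale0r //.
have /(congr1 (mpoly.mcoeff (mpoly.mnm1 j))) := z0.
rewrite mpoly.mcoeff0 /linform raddf_sum (bigD1 j) //= big1 => [|i ij].
  rewrite addr0 mpoly.mcoeffZ mpoly.mcoeffXU eqxx mulr1 (tnth_nth 0).
  by move/(congr1 (@complex.Re _)).
by rewrite mpoly.mcoeffZ mpoly.mcoeffXU (negbTE ij) mulr0.
Qed.

Lemma linform_neq0 y : y != 0 -> linform y != 0.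
Proof. by apply: contra_neq; rewrite -linform0 => /linform_inj. Qed.

Definition ddir t P : Poly :=
  \sum_(j < n) (coord (vbasis {:V}) j t)%:C *: mpoly.mderiv j P.

Lemma ddir_linear t : linear (ddir t).
Proof.
move=> a P Q; rewrite /ddir scaler_sumr -big_split /=; apply: eq_bigr => j _.
by rewrite linearP scalerDr !scalerA mulrC.
Qed.

HB.instance Definition _ t :=
  GRing.isLinear.Build C Poly Poly _ (ddir t) (ddir_linear t).

Lemma ddirM t P Q : ddir t (P * Q) = ddir t P * Q + P * ddir t Q.
Proof.
rewrite /ddir mulr_suml mulr_sumr -big_split /=; apply: eq_bigr => j _.
by rewrite mpoly.mderivM scalerDr scalerAl scalerAr.
Qed.

Lemma ddirC t (a : C) : ddir t (mpoly.mpolyC n a) = 0.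
Proof. by rewrite /ddir big1 // => j _; rewrite mpoly.mderivC scaler0. Qed.

Lemma mderiv_linform (j : 'I_n) y :
  mpoly.mderiv j (linform y) = mpoly.mpolyC n (y (vbasis {:V})`_j : R)%:C.
Proof.
rewrite /linform raddf_sum /= (bigD1 j) //= big1 => [|i ij].
  rewrite addr0 mpoly.mderivZ mpoly.mderivX mpoly.mnm1E eqxx scale1r.
  rewrite -[X in mpoly.mpolyX C X](_ : mpoly.mnm0 = _) ?mpoly.mpolyX0.
    by rewrite -mpoly.mul_mpolyC mulr1 (tnth_nth 0).
  by apply/mpoly.mnmP => i; rewrite mpoly.mnmBE subnn mpoly.mnm0E.
by rewrite mpoly.mderivZ mpoly.mderivX mpoly.mnm1E (negbTE ij) scale0r scaler0.
Qed.

Lemma ddir_linform t y : ddir t (linform y) = mpoly.mpolyC n (y t : R)%:C.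
Proof.
have -> : (y t : R) = \sum_(j < n) coord (vbasis {:V}) j t * (y (vbasis {:V})`_j : R).
  rewrite {1}(coord_vbasis (memvf t)) linear_sum.
  by apply: eq_bigr => j _; rewrite linearZ.
rewrite rmorph_sum [RHS]raddf_sum /=; apply: eq_bigr => j _.
by rewrite mderiv_linform -mpoly.mul_mpolyC -!rmorphM.
Qed.

Lemma dirder_polyE (v : complexified V) P :
  dirder_poly v P = ddir v.1 P + 'i *: ddir v.2 P.
Proof.
rewrite /ddir scaler_sumr -big_split /=; apply: eq_bigr => j _.
rewrite scalerA -scalerDl; congr (_ *: _); rewrite /coordC.
by apply/eqP; rewrite eq_complex /= !(mul0r, mul1r, mulr0, addr0, subr0, add0r) !eqxx.
Qed.

Definition euler P : Poly :=
  \sum_(j < n) mpoly.mpolyX C (mpoly.mnm1 j) * mpoly.mderiv j P.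

Lemma eulerE s (t : V' -> V) P :
    (forall y, y = \sum_(b <- undup s) (y (t b) : R) *: b) ->
  euler P = \sum_(b <- undup s) linform b * ddir (t b) P.
Proof.
move=> tE; rewrite /ddir /euler.
under eq_bigr do rewrite -linform_cov [X in linform X]tE linform_sum mulr_suml.
rewrite exchange_big; apply: eq_bigr => b _; rewrite mulr_sumr.
by apply: eq_bigr => j _; rewrite linformZ -scalerAl covE scalerAr.
Qed.

(** A derivative lowers the degree by one; the commutator says so without mentioning a grading. *)
Lemma ddir_euler t P : ddir t (euler P) = euler (ddir t P) + ddir t P.
Proof.
rewrite /euler linear_sum /=.
under eq_bigr do rewrite -linform_cov ddirM ddir_linform covE.
rewrite big_split /= addrC; congr (_ + _).
  apply: eq_bigr => j _; rewrite -linform_cov /ddir [in RHS]linear_sum /=.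
  congr (_ * _); apply: eq_bigr => i _.
  by rewrite linearZ /= mpoly.mderiv_comm.
by apply: eq_bigr => j _; rewrite mpoly.mul_mpolyC.
Qed.

Lemma euler_linear : linear euler.
Proof.
move=> a P Q; rewrite /euler scaler_sumr -big_split /=; apply: eq_bigr => j _.
by rewrite linearP mulrDr scalerAr.
Qed.

HB.instance Definition _ :=
  GRing.isLinear.Build C Poly Poly _ euler euler_linear.

Definition at0 P : C := mpoly.mcoeff mpoly.mnm0 P.

Lemma at0_linform y P : at0 (linform y * P) = 0.
Proof.
rewrite /at0 (mpoly.mcoeff0_is_multiplicative n C).1.
rewrite [X in X * _](_ : _ = 0) ?mul0r // /linform raddf_sum big1 // => j _ /=.
by rewrite mpoly.mcoeffZ mpoly.mcoeffX mpoly.mnm1_eq0 mulr0.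
Qed.

Lemma at0_euler P : at0 (euler P) = 0.
Proof.
rewrite /at0 /euler raddf_sum big1 // => j _ /=.
by rewrite -linform_cov; exact: at0_linform.
Qed.

Lemma euler_homog d P : P \is mpoly.ishomog1 d mpoly.mdeg ->
  euler P = d%:R *: P.
Proof.
move=> Pd; rewrite [P]mpoly.mpolyE linear_sum scaler_sumr /= big_seq [RHS]big_seq.
apply: eq_bigr => m mP; rewrite linearZ /= scalerA mulrC -scalerA; congr (_ *: _).
have <- : mpoly.mdeg m = d := mpoly.dhomog_mf Pd mP.
rewrite mpoly.mdegE natr_sum scaler_suml /euler.
apply: eq_bigr => j _; rewrite mpoly.mderivX -scalerAr -mpoly.mpolyXD.
have [->|mj] := eqVneq (m j) 0%N; first by rewrite !scale0r.
congr (_ *: mpoly.mpolyX _ _); rewrite mpoly.addmC mpoly.submK //.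
by apply/mpoly.mnm_lepP => i; rewrite mpoly.mnm1E; case: eqP => [<-|//]; rewrite lt0n.
Qed.

End PolynomialCalculus.

(** * The residue functional of a weight *)

Lemma rem_rem (T : eqType) (b b' : T) s : rem b (rem b' s) = rem b' (rem b s).
Proof.
elim: s => //= a s IH; have [<-|ab'] := eqVneq a b'; have [<-|ab] := eqVneq a b => //=.
- by rewrite eqxx.
- by rewrite eqxx.
- by rewrite (negbTE ab) (negbTE ab') IH.
Qed.

Lemma regular_scaleE (K : pzRingType) (a b : K) : a *: (b : K^o) = a * b.
Proof. by []. Qed.

Section ResidueFunctional.
Variables (R : realType) (V : vectType R).
Local Notation V' := 'Hom(V, R^o).
Local Notation n := (\dim {:V}).
Variables (K : numFieldType) (iota : {rmorphism R -> K}) (A : comAlgType K).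
Variables (lin : V' -> A) (at0 : {linear A -> K^o}).
Variables (euler : {linear A -> A}) (ddir : V -> {linear A -> A}).
Variables (ok : V' -> Prop) (w : seq V' -> K).

Implicit Types (s : seq V') (y b : V') (v t : V) (P Q : A).

(** The rules of calculus used by the residue functional, [at0] being the value at the origin;
    [concrete_calculus] checks them for polynomials. *)
Definition polynomial_calculus :=
  [/\ forall x y, lin (x + y) = lin x + lin y,
      forall a y, lin (a *: y) = iota a *: lin y
    & (forall y P, at0 (lin y * P) = 0) /\ (forall P, at0 (euler P) = 0)] /\
  [/\ forall t P Q, ddir t (P * Q) = ddir t P * Q + P * ddir t Q,
      forall t y, ddir t (lin y) = (iota (y t))%:A,
      forall t P, ddir t (euler P) = euler (ddir t P) + ddir t P
    & forall s (t : V' -> V) P,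
        (forall y, y = \sum_(b <- undup s) (y (t b) : R) *: b) ->
        euler P = \sum_(b <- undup s) lin b * ddir (t b) P].

(* The last condition says that [f_(s minus b) |-> w (s minus b)] respects the
   relation [sum_b c_b b / prod s = 0], hence defines a functional on the span of
   the [f_sigma]. *)
Definition circuit_weight := [/\
  forall s, span s <> fullv -> w s = 0,
  forall s s', perm_eq s s' -> w s = w s' &
  forall s (c : V' -> R), (forall b, b \in s -> ok b) -> size s = n.+1 ->
    \sum_(b <- undup s) c b *: b = 0 ->
    \sum_(b <- undup s) iota (c b) * w (rem b s) = 0].

Hypotheses (pc : polynomial_calculus) (cw : circuit_weight).

Let linD : {morph lin : x y / x + y}. Proof. by case: pc => -[]. Qed.
Let linZ a y : lin (a *: y) = iota a *: lin y. Proof. by case: pc => -[]. Qed.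
Let at0_lin y P : at0 (lin y * P) = 0. Proof. by case: pc => -[_ _ []]. Qed.
Let at0_euler P : at0 (euler P) = 0. Proof. by case: pc => -[_ _ []]. Qed.
Let ddirM t P Q : ddir t (P * Q) = ddir t P * Q + P * ddir t Q.
Proof. by case: pc => _ []. Qed.
Let ddir_lin t y : ddir t (lin y) = (iota (y t))%:A.
Proof. by case: pc => _ []. Qed.
Let ddir_euler t P : ddir t (euler P) = euler (ddir t P) + ddir t P.
Proof. by case: pc => _ []. Qed.
Let eulerE s (t : V' -> V) P :
  (forall y, y = \sum_(b <- undup s) (y (t b) : R) *: b) ->
  euler P = \sum_(b <- undup s) lin b * ddir (t b) P.
Proof. by case: pc => _ [_ _ _]; exact. Qed.
Let lin0 : lin 0 = 0. Proof. by rewrite -(scale0r 0) linZ rmorph0 scale0r. Qed.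
Let lin_sum (I : Type) (r : seq I) (F : I -> V') :
  lin (\sum_(i <- r) F i) = \sum_(i <- r) lin (F i).
Proof. exact: (big_morph _ linD lin0). Qed.

Definition dsys s : V' -> V :=
  xget (fun=> 0) [set t | forall y, y = \sum_(b <- undup s) (y (t b) : R) *: b].

Lemma dsysE s : span s = fullv ->
  forall y, y = \sum_(b <- undup s) (y (dsys s b) : R) *: b.
Proof.
by move=> /dual_system [t tE]; rewrite /dsys; case: xgetP => [u _ //|/(_ t)].
Qed.

(* Euler's identity [d P = sum_b b * d_(t b) P], for the system [t] dual to [s],
   forces this recursion on the degree [d = size s - n]. *)
Fixpoint lam (d : nat) s P : K :=
  if d is d'.+1 then
    (d%:R)^-1 * \sum_(b <- undup s) lam d' (rem b s) (ddir (dsys s b) P)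
  else w s * at0 P.

Lemma lam_linear d s : linear (lam d s : A -> K^o).
Proof.
elim: d s => [|d IH] s a P Q /=.
  by rewrite linearP !regular_scaleE mulrDr mulrCA.
rewrite regular_scaleE mulrCA -mulrDr; congr (_ * _); rewrite mulr_sumr -big_split /=.
by apply: eq_bigr => b _; rewrite linearP IH.
Qed.

HB.instance Definition _ d s :=
  GRing.isLinear.Build K A K^o _ (lam d s) (lam_linear d s).

Lemma lam0E s P : lam 0 s P = w s * at0 P. Proof. by []. Qed.

Lemma lamSE d s P : lam d.+1 s P =
  (d.+1%:R)^-1 * \sum_(b <- undup s) lam d (rem b s) (ddir (dsys s b) P).
Proof. by []. Qed.

Opaque lam.

Lemma lam_euler d s P : lam d s (euler P) = d%:R * lam d s P.
Proof.
elim: d s P => [|d IH] s P; first by rewrite !lam0E at0_euler mulr0 mul0r.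
have d0 : d.+1%:R != 0 :> K by rewrite pnatr_eq0.
rewrite !lamSE (mulVKf d0).
transitivity (d.+1%:R^-1 * \sum_(b <- undup s)
    d.+1%:R * lam d (rem b s) (ddir (dsys s b) P)); last first.
  by rewrite -mulr_sumr (mulKf d0).
congr (_ * _); apply: eq_bigr => b _.
by rewrite ddir_euler linearD [LHS]/(_ + _) /= IH -natr1 mulrDl mul1r.
Qed.


Lemma sub_rem b s : {subset rem b s <= s}.
Proof. by move=> x; exact: mem_rem. Qed.

Lemma lam_nonspanning d s P : span s <> fullv -> lam d s P = 0.
Proof.
have [w0 _ _] := cw.
elim: d s P => [|d IH] s P sN; first by rewrite lam0E w0 // mul0r.
by rewrite lamSE big1 ?mulr0 // => b _; apply: IH => /(span_mono (@sub_rem b s)).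
Qed.

(** Cancellation of [b] in [lin b * Q / prod s]. With [lam_shifts] one degree lower, [lam_relates d]
    gives [lam_shifts d], which in turn gives [lam_relates d.+1]. *)
Definition lam_shifts d := forall s b Q, (forall a, a \in s -> ok a) ->
  size s = (n + d.+1)%N -> b \in s ->
  lam d.+1 s (lin b * Q) = lam d (rem b s) Q.

(** The circuit relation of [w], extended from degree 0 to numerators of degree [d]. *)
Definition lam_relates d := forall s (c : V' -> R) P,
  (forall a, a \in s -> ok a) -> size s = (n + d.+1)%N ->
  \sum_(b <- undup s) c b *: b = 0 ->
  \sum_(b <- undup s) iota (c b) * lam d (rem b s) P = 0.

(** By the Leibniz rule, d + 1 times the left side splits in two: the terms where [lin a] is
    differentiated give one copy of [lam d (rem a s) Q], those where [Q] is differentiated give [d]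
    copies by Euler's identity. *)
Lemma lam_shifts_of d : lam_relates d ->
  (if d is d'.+1 then lam_shifts d' else True) -> lam_shifts d.
Proof.
move=> rel_d shift_d s a Q sok sn sa.
have [sT|sN] := pselect (span s = fullv); last first.
  rewrite lam_nonspanning // lam_nonspanning //.
  by move=> /(span_mono (@sub_rem a s)).
have usum : a \in undup s by rewrite mem_undup.
rewrite lamSE.
have -> : \sum_(b <- undup s) lam d (rem b s) (ddir (dsys s b) (lin a * Q)) =
    \sum_(b <- undup s) iota (a (dsys s b) : R) * lam d (rem b s) Q +
    \sum_(b <- undup s) lam d (rem b s) (lin a * ddir (dsys s b) Q).
  rewrite -big_split; apply: eq_bigr => b _ /=.
  by rewrite ddirM ddir_lin mulr_algl linearD linearZ.
have -> : \sum_(b <- undup s) iota (a (dsys s b) : R) * lam d (rem b s) Q =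
    lam d (rem a s) Q.
  (* The vector [a] has two expansions on [s]: through the dual system, and as itself. Their
     difference is a relation. *)
  pose c b : R := a (dsys s b) - (b == a)%:R.
  have c0 : \sum_(b <- undup s) c b *: b = 0.
    under eq_bigr do rewrite scalerBl.
    rewrite big_split /= -(dsysE sT) sumrN (bigD1_seq a) ?undup_uniq //= eqxx.
    rewrite scale1r big1 ?addr0 ?subrr // => b /negbTE ->.
    by rewrite scale0r.
  have /eqP := rel_d s c Q sok sn c0.
  under eq_bigr do rewrite rmorphB mulrBl.
  rewrite sumrB subr_eq0 => /eqP ->.
  rewrite (bigD1_seq a) ?undup_uniq //= eqxx rmorph1 mul1r big1 ?addr0 // => b.
  by move=> /negbTE ->; rewrite rmorph0 mul0r.
have -> : \sum_(b <- undup s) lam d (rem b s) (lin a * ddir (dsys s b) Q) =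
    lam d (rem a s) (euler Q).
  rewrite (eulerE Q (dsysE sT)) linear_sum [LHS]big_seq [RHS]big_seq.
  apply: eq_bigr => b; rewrite mem_undup => sb.
  (* Exchange [lin a] with [lin b]: both sides shift to the functional of [s] deprived of [a] and
     [b]. In degree 0 both sides vanish, being values at the origin of multiples of linear forms. *)
  have [->//|ba] := eqVneq b a; rewrite -[RHS]/(lam d _ _).
  case: d sn rel_d shift_d => [|d] sn rel_d shift_d.
    rewrite !lam0E !at0_lin.
    by rewrite !mulr0.
  have sz x : x \in s -> size (rem x s) = (n + d.+1)%N.
    by move=> xs; rewrite size_rem // sn addnS.
  have okr x z : z \in rem x s -> ok z by move/mem_rem; exact: sok.
  have ab : a != b by rewrite eq_sym.
  rewrite (shift_d _ _ _ (okr b) (sz b sb) (rem_mem ab sa)).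
  by rewrite (shift_d _ _ _ (okr a) (sz a sa) (rem_mem ba sb)) rem_rem.
rewrite lam_euler -[X in X + _]mul1r -mulrDl nat1r.
by rewrite mulrA mulVf ?pnatr_eq0 // mul1r.
Qed.

(** [D (euler P)] is d + 1 times [D P], and [euler P] is a sum of multiples of the [lin a]. On such
    a multiple, two shifts bring every term to [rem a s] with [lin b] in place of [lin a], and the
    relation makes the sum zero. *)
Lemma lam_relates_of d : lam_shifts d -> lam_relates d.+1.
Proof.
move=> shift_d s c P sok sn c0.
have [sT|sN] := pselect (span s = fullv); last first.
  rewrite big1 // => b _; rewrite lam_nonspanning ?mulr0 //.
  by move=> /(span_mono (@sub_rem b s)).
pose D P := \sum_(b <- undup s) iota (c b) * lam d.+1 (rem b s) P.
suff D_lin a Q : a \in undup s -> D (lin a * Q) = 0.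
  have : D (euler P) = 0.
    rewrite (eulerE P (dsysE sT)) /D.
    under eq_bigr do rewrite linear_sum mulr_sumr.
    by rewrite exchange_big big_seq big1 // => a sa; exact: D_lin.
  rewrite /D; under eq_bigr do rewrite lam_euler mulrCA.
  by rewrite -mulr_sumr => /eqP; rewrite mulf_eq0 pnatr_eq0 => /eqP.
rewrite mem_undup => sa; rewrite /D.
have sz x : x \in s -> size (rem x s) = (n + d.+1)%N.
  by move=> xs; rewrite size_rem // sn addnS.
have okr x y : y \in rem x s -> ok y by move/mem_rem; exact: sok.
have ua : a \in undup s by rewrite mem_undup.
rewrite (bigD1_seq a) ?undup_uniq //=.
rewrite [X in _ + X](_ : _ = \sum_(b <- undup s | b != a)
    iota (c b) * lam d.+1 (rem a s) (lin b * Q)); last first.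
  rewrite [LHS]big_seq_cond [RHS]big_seq_cond; apply: eq_bigr => b.
  rewrite mem_undup => /andP[sb ba]; congr (_ * _).
  have ab : a != b by rewrite eq_sym.
  rewrite (shift_d _ _ _ (okr b) (sz b sb) (rem_mem ab sa)).
  by rewrite (shift_d _ _ _ (okr a) (sz a sa) (rem_mem ba sb)) rem_rem.
rewrite -(bigD1_seq (op := +%R) a (F := fun b => iota (c b) * lam d.+1 (rem a s) (lin b * Q)) ua)
  ?undup_uniq //=.
have := congr1 (fun z => lin z * Q) c0.
rewrite lin_sum lin0 mul0r mulr_suml => /(congr1 (lam d.+1 (rem a s))).
rewrite linear_sum linear0 => sum0; rewrite -[RHS]sum0; apply: eq_bigr => b _.
by rewrite linZ -scalerAl linearZ.
Qed.

Lemma lam_relates_shifts d : lam_relates d /\ lam_shifts d.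
Proof.
have [_ _ circ] := cw.
elim: d => [|d [rel_d shift_d]].
  have rel0 : lam_relates 0.
    move=> s c P sok; rewrite addn1 => sn c0.
    have z0 : (\sum_(b <- undup s) iota (c b) * w (rem b s)) * at0 P = 0.
      by rewrite (circ s c sok sn c0) mul0r.
    rewrite -[RHS]z0 mulr_suml.
    by apply: eq_bigr => b _; rewrite lam0E mulrA.
  by split => //; exact: lam_shifts_of.
have rel_d1 := lam_relates_of shift_d; split => //.
exact: lam_shifts_of.
Qed.

(** The test guards the truncated subtraction: with fewer than n poles the residue is 0. *)
Definition Lam s P : K := if (n <= size s)%N then lam (size s - n) s P else 0.

Lemma Lam_linear s : linear (Lam s : A -> K^o).
Proof.
move=> a P Q; rewrite /Lam; case: ifP => _; first by rewrite linearP.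
by rewrite scaler0 addr0.
Qed.

HB.instance Definition _ s :=
  GRing.isLinear.Build K A K^o _ (Lam s) (Lam_linear s).

Lemma Lam_nonspanning s P : span s <> fullv -> Lam s P = 0.
Proof. by move=> sN; rewrite /Lam; case: ifP => // _; exact: lam_nonspanning. Qed.

Lemma Lam_euler s P : (n <= size s)%N ->
  Lam s (euler P) = (size s - n)%:R * Lam s P.
Proof. by move=> sn; rewrite /Lam sn lam_euler. Qed.

Lemma Lam_basis s P : size s = n -> Lam s P = w s * at0 P.
Proof. by move=> sn; rewrite /Lam sn leqnn subnn. Qed.

Lemma Lam_rem s b Q : (forall a, a \in s -> ok a) -> b \in s ->
  Lam s (lin b * Q) = Lam (rem b s) Q.
Proof.
move=> sok sb; rewrite /Lam size_rem //.
have s0 : (0 < size s)%N by case: (s) sb.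
case: (ltngtP (size s) n) => [sn|sn|sn].
- by rewrite [in RHS]leqNgt (leq_ltn_trans (leq_pred _) sn).
- have -> : (n <= (size s).-1)%N by rewrite -ltnS prednK.
  have -> : (size s - n = ((size s).-1 - n).+1)%N by lia.
  have [_ shift] := lam_relates_shifts ((size s).-1 - n); apply: shift => //.
  by lia.
- rewrite -sn subnn lam0E at0_lin mulr0 leqNgt prednK // leqnn //.
Qed.

(** The order of [s] enters through the choice [dsys s]. Expanding [euler P] on both sides along the
    same system, that of [s], and shifting, removes this dependence degree by degree. *)
Lemma Lam_perm s s' P : (forall a, a \in s -> ok a) -> perm_eq s s' ->
  Lam s P = Lam s' P.
Proof.
have [_ w_perm _] := cw.
suff lam_perm d : forall s s' P, (forall a, a \in s -> ok a) -> perm_eq s s' ->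
    size s = (n + d)%N -> lam d s P = lam d s' P.
  move=> sok ss'; rewrite /Lam -(perm_size ss'); case: ifP => // sn.
  by apply: lam_perm; rewrite ?subnKC.
elim: d => {P}[|d IH] {}s {}s' P sok ss' sn; first by rewrite !lam0E (w_perm _ _ ss').
have [sT|sN] := pselect (span s = fullv); last first.
  rewrite !lam_nonspanning // => s'T; apply: sN; apply: span_mono s'T => x.
  by rewrite (perm_mem ss').
have sok' a : a \in s' -> ok a by rewrite -(perm_mem ss'); exact: sok.
suff eqE : lam d.+1 s (euler P) = lam d.+1 s' (euler P).
  move: eqE; rewrite !lam_euler => /(mulfI _); apply.
  by rewrite pnatr_eq0.
rewrite (eulerE P (dsysE sT)) !linear_sum [LHS]big_seq [RHS]big_seq.
apply: eq_bigr => b; rewrite mem_undup => sb.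
have s'b : b \in s' by rewrite -(perm_mem ss').
have [_ shift] := lam_relates_shifts d.
rewrite -[LHS]/(lam d.+1 _ _) -[RHS]/(lam d.+1 _ _).
rewrite (shift s) // (shift s') -?(perm_size ss') //.
apply: IH; first by move=> a /mem_rem; exact: sok.
  rewrite -(perm_cons b) -(permPl (perm_to_rem sb)).
  by rewrite -(permPr (perm_to_rem s'b)).
by rewrite size_rem // sn addnS.
Qed.

Lemma Lam_cons b s Q : ok b -> (forall a, a \in s -> ok a) ->
  Lam (b :: s) (lin b * Q) = Lam s Q.
Proof.
move=> bok sok; rewrite Lam_rem ?mem_head //= ?eqxx //.
by move=> a; rewrite inE => /predU1P[->|/sok].
Qed.

Lemma Lam_eq0 s P : (forall s', {subset s' <= s} -> size s' = n -> w s' = 0) ->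
  Lam s P = 0.
Proof.
rewrite /Lam; case: ifP => // sn w0.
have : size s = (n + (size s - n))%N by rewrite subnKC.
move: (size s - n)%N => d; elim: d s w0 {sn} P => [|d IH] s w0 P sd.
  by rewrite lam0E w0 ?mul0r // sd addn0.
rewrite lamSE big_seq big1 ?mulr0 // => b; rewrite mem_undup => sb.
apply: IH => [s' s'r|]; last by rewrite size_rem // sd addnS.
by apply: w0 => x /s'r /mem_rem.
Qed.

(** By the quotient rule, this says that the functional kills the derivative of [P / prod s]. The
    defect [D] vanishes on multiples of each [lin a], by induction on [s], hence on [euler P], where
    it equals a nonzero multiple of [D P]. *)
Lemma Lam_ddir s v P : (forall a, a \in s -> ok a) ->
  Lam s (ddir v P) = \sum_(b <- s) iota (b v : R) * Lam (b :: s) P.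
Proof.
have [m] := ubnP (size s); elim: m s P => // m IH s P; rewrite ltnS => sm sok.
have [sT|sN] := pselect (span s = fullv); last first.
  rewrite Lam_nonspanning // big_seq big1 // => b sb.
  rewrite Lam_nonspanning ?mulr0 // => bsT; apply: sN; apply: span_mono bsT => x.
  by rewrite inE => /predU1P[->|].
have key a Q : a \in s -> Lam s (ddir v (lin a * Q)) =
    \sum_(b <- s) iota (b v : R) * Lam (b :: s) (lin a * Q).
  move=> sa; rewrite ddirM ddir_lin mulr_algl linearD linearZ /=.
  rewrite -[LHS]/(_ * _ + _) Lam_rem // IH; last first.
  - by move=> x /mem_rem; exact: sok.
  - by rewrite size_rem // (leq_trans _ sm) // prednK //; case: (s) sa.
  have rok b x : b \in s -> x \in b :: s -> ok x.
    by move=> sb; rewrite inE => /predU1P[->|]; exact: sok.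
  rewrite (perm_big _ (perm_to_rem sa)) big_cons /=; congr (_ * _ + _).
    by rewrite Lam_cons //; exact: sok.
  rewrite big_seq [RHS]big_seq; apply: eq_bigr => b /mem_rem sb; congr (_ * _).
  have a_bs : a \in b :: s by rewrite inE sa orbT.
  rewrite [RHS](Lam_rem _ (fun x => @rok b x sb) a_bs) /=; case: eqP => [->|//].
  apply: Lam_perm; last by rewrite perm_sym perm_to_rem.
  by move=> x; rewrite inE => /predU1P[->|/mem_rem]; exact: sok.
pose D Q := Lam s (ddir v Q) - \sum_(b <- s) iota (b v : R) * Lam (b :: s) Q.
have ns := spanning_size sT.
have D_euler : D (euler P) = ((size s - n).+1)%:R * D P.
  rewrite /D mulrBr ddir_euler linearD /=; congr (_ - _).
    by rewrite -[LHS]/(_ + _) Lam_euler // -natr1 mulrDl mul1r.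
  rewrite mulr_sumr; apply: eq_bigr => b _.
  by rewrite Lam_euler /= ?leqW // subSn // mulrCA.
have DD : {morph D : P Q / P + Q}.
  move=> P1 P2; rewrite /D !linearD /= -[X in X - _]/(_ + _).
  under eq_bigr do rewrite linearD mulrDr.
  by rewrite big_split /= opprD addrACA.
have D0 : D 0 = 0.
  by rewrite /D !linear0 big1 ?subrr // => b _; rewrite linear0 mulr0.
have : D (euler P) = 0.
  rewrite (eulerE P (dsysE sT)) (big_morph _ DD D0) big_seq big1 // => a.
  by rewrite mem_undup => sa; rewrite /D key // subrr.
rewrite D_euler => /eqP; rewrite mulf_eq0 pnatr_eq0 /= subr_eq0.
by move/eqP.
Qed.

End ResidueFunctional.

(** * Formal power series *)

(** To be read as series in an extra variable T over [A]. For the expansion of a function at 0, the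
    coefficient of T^k is the homogeneous component of degree k. *)
Definition fps (A : comNzRingType) : Type := nat -> A.

Section PowerSeries.
Variable A : comNzRingType.
Implicit Types (P Q S : fps A) (k N : nat).

HB.instance Definition _ := GRing.Zmodule.copy (fps A) (nat -> A).

Definition fps_one : fps A := fun k => (k == 0%N)%:R.
Definition fps_mul P Q : fps A := fun k => \sum_(i < k.+1) P i * Q (k - i)%N.

(** A coefficient of a product only sees truncations, so the ring laws come from those of
    polynomials. *)
Let trunc N P : {poly A} := \poly_(i < N) P i.

Let trunc_mul N P Q k : (k < N)%N ->
  fps_mul P Q k = (trunc N P * trunc N Q)`_k.
Proof.
move=> kN; rewrite coefM; apply: eq_bigr => i _; rewrite !coef_poly.
have ik : (i <= k)%N by rewrite -ltnS.
by rewrite (leq_ltn_trans ik kN) (leq_ltn_trans (leq_subr _ _) kN).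
Qed.

Let fps_mulC : commutative fps_mul.
Proof.
by move=> P Q; apply/funext => k; rewrite !(@trunc_mul k.+1) // mulrC.
Qed.

Let fps_mulA : associative fps_mul.
Proof.
move=> P Q S; apply/funext => k.
transitivity ((trunc k.+1 P * (trunc k.+1 Q * trunc k.+1 S))`_k).
  rewrite coefM; apply: eq_bigr => i _; rewrite coef_poly ltn_ord.
  by rewrite -trunc_mul // ltnS leq_subr.
rewrite mulrA coefM; apply: eq_bigr => i _.
by rewrite coef_poly ltnS leq_subr -trunc_mul.
Qed.

Let fps_mul1 : left_id fps_one fps_mul.
Proof.
move=> P; apply/funext => k; rewrite /fps_mul big_ord_recl big1 => [|i _].
  by rewrite mul1r subn0 addr0.
by rewrite mul0r.
Qed.

Let fps_mulDl : left_distributive fps_mul +%R.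
Proof.
move=> P Q S; apply/funext => k.
transitivity (fps_mul P S k + fps_mul Q S k) => //.
by rewrite {2 3}/fps_mul -big_split; apply: eq_bigr => i _; rewrite /= -mulrDl.
Qed.

Let fps_one_neq0 : fps_one != 0.
Proof. by apply/eqP => /(congr1 (@^~ 0%N)) /eqP; rewrite oner_eq0. Qed.

HB.instance Definition _ := GRing.Zmodule_isComNzRing.Build (fps A)
  fps_mulA fps_mulC fps_mul1 fps_mulDl fps_one_neq0.

Definition fps_unit : pred (fps A) := fun P => `[< exists Q, Q * P = 1 >].
Definition fps_inv P : fps A := if fps_unit P then xget 0 [set Q | Q * P = 1] else P.

Let fps_mulVr : {in fps_unit, left_inverse 1 fps_inv *%R}.
Proof.
move=> P Pu; rewrite /fps_inv ifT //.
by case/asboolP: Pu => Q QP; case: xgetP => [//|/(_ Q)].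
Qed.

Let fps_unitP P Q : Q * P = 1 -> fps_unit P.
Proof. by move=> QP; apply/asboolP; exists Q. Qed.

Let fps_inv_out : {in [predC fps_unit], fps_inv =1 id}.
Proof. by move=> P /negP PNu; rewrite /fps_inv ifF //; apply/negP. Qed.

HB.instance Definition _ := GRing.ComNzRing_hasMulInverse.Build (fps A)
  fps_mulVr fps_unitP fps_inv_out.

Lemma fpsME P Q k : (P * Q) k = \sum_(i < k.+1) P i * Q (k - i)%N.
Proof. by []. Qed.

Lemma fps1E k : (1 : fps A) k = (k == 0%N)%:R. Proof. by []. Qed.
Lemma fpsDE P Q k : (P + Q) k = P k + Q k. Proof. by []. Qed.
Lemma fpsNE P k : (- P) k = - P k. Proof. by []. Qed.
Lemma fps0E k : (0 : fps A) k = 0. Proof. by []. Qed.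

Definition fpsC (a : A) : fps A := fun k => if k == 0%N then a else 0.
Definition fpsX : fps A := fun k => (k == 1%N)%:R.

Lemma fpsCM a P k : (fpsC a * P) k = a * P k.
Proof.
rewrite fpsME big_ord_recl big1 ?addr0 ?subn0 // => i _.
by rewrite mul0r.
Qed.

Lemma fpsXM P k : (fpsX * P) k = if k is k'.+1 then P k' else 0.
Proof.
case: k => [|k]; first by rewrite fpsME big_ord1 mul0r.
rewrite fpsME !big_ord_recl big1 => [|i _]; last by rewrite mul0r.
by rewrite mul0r add0r addr0 mul1r subn1.
Qed.

Lemma fps_unit_const P a : P 0%N * a = 1 -> P \is a GRing.unit.
Proof.
move=> Pa; pose N : fps A := 1 - fpsC a * P.
have N0 : N 0%N = 0.
  by rewrite /N fpsDE fpsNE fpsCM mulrC Pa subrr.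
have NX j k : (k < j)%N -> (N ^+ j) k = 0.
  elim: j k => // j IH k; rewrite ltnS => kj; rewrite exprS fpsME.
  rewrite big1 // => -[[|i] ik] _ /=; first by rewrite N0 mul0r.
  by rewrite IH ?mulr0 //; move: ik; rewrite ltnS => ik; lia.
pose T m : fps A := \sum_(j < m) N ^+ j.
have TE m k : (k < m)%N -> T m k = T k.+1 k.
  elim: m => // m IH; rewrite ltnS leq_eqVlt => /predU1P[->//|km].
  by rewrite /T big_ord_recr -[LHS]/(T m k + (N ^+ m) k) NX // addr0 IH.
apply/unitrPr; exists (fpsC a * (fun k => T k.+1 k)).
rewrite mulrA; have -> : P * fpsC a = 1 - N by rewrite /N opprB addrC subrK mulrC.
apply/funext => k; transitivity (((1 - N) * T k.+1) k).
  rewrite !fpsME; apply: eq_bigr => i _; congr (_ * _).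
  by rewrite [RHS]TE // ltnS leq_subr.
have -> : (1 - N) * T k.+1 = 1 - N ^+ k.+1.
  by rewrite -opprB mulNr -subrX1 opprB.
by rewrite fpsDE fpsNE NX // subr0.
Qed.

End PowerSeries.

(** * Residues of quotients of exponential series *)

Section SeriesFunctional.
Variables (R : realType) (V : vectType R).
Local Notation V' := 'Hom(V, R^o).
Local Notation n := (\dim {:V}).
Variables (K : numFieldType) (iota : {rmorphism R -> K}) (A : comAlgType K).
Variables (lin : V' -> A) (ddir : V -> {linear A -> A}).
Variables (ok : V' -> Prop) (L : seq V' -> {linear A -> K^o}).
Implicit Types (s : seq V') (y b l : V') (v : V) (a : A) (P Q : fps A).

Hypothesis linD : {morph lin : x y / x + y}.
Hypothesis ddirM : forall v a a', ddir v (a * a') = ddir v a * a' + a * ddir v a'.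
Hypothesis ddir_lin : forall v y, ddir v (lin y) = (iota (y v))%:A.

(** All that the series arguments use of [Lam]: too few poles, cancellation, symmetry, and vanishing
    on derivatives. *)
Definition residue_functional := [/\
  forall s a, (size s < n)%N -> L s a = 0,
  forall b s a, ok b -> (forall b', b' \in s -> ok b') ->
    L (b :: s) (lin b * a) = L s a,
  forall s s' a, (forall b, b \in s -> ok b) -> perm_eq s s' -> L s a = L s' a &
  forall s v a, (forall b, b \in s -> ok b) ->
    L s (ddir v a) = \sum_(b <- s) iota (b v) * L (b :: s) a].

Hypothesis rf : residue_functional.

Let lin0 : lin 0 = 0.
Proof. by apply: (addrI (lin 0)); rewrite -linD !addr0. Qed.

Let linN y : lin (- y) = - lin y.
Proof. by apply: (addrI (lin y)); rewrite -linD !subrr lin0. Qed.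

(** T is a constant for this derivation: a component keeps its index while its degree drops by one.
    Hence the factors [fpsX] below, and the use of [Lfps1]. *)
Definition fps_deriv v P : fps A := fun k => ddir v (P k).

Lemma fps_derivM v P Q :
  fps_deriv v (P * Q) = fps_deriv v P * Q + P * fps_deriv v Q.
Proof.
apply/funext => k; rewrite [LHS]linear_sum /= fpsDE !fpsME -big_split /=.
by apply: eq_bigr => i _; rewrite ddirM.
Qed.

Lemma ddir1 v : ddir v 1 = 0.
Proof.
have := ddirM v 1 1; rewrite !mulr1 mul1r => /(congr1 (+%R (- ddir v 1))).
by rewrite addNr addrA addNr add0r.
Qed.

Lemma fps_derivC v c : fps_deriv v (fpsC (c%:A : A)) = 0.
Proof.
apply/funext => k; rewrite /fps_deriv /fpsC fps0E.
by case: ifP => _; rewrite ?linear0 // linearZ /= ddir1 scaler0.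
Qed.

Lemma fps_derivD v P Q : fps_deriv v (P + Q) = fps_deriv v P + fps_deriv v Q.
Proof. by apply/funext => k; rewrite /fps_deriv !fpsDE linearD. Qed.

Lemma fps_derivN v P : fps_deriv v (- P) = - fps_deriv v P.
Proof. by apply/funext => k; rewrite /fps_deriv !fpsNE linearN. Qed.

Lemma fps_deriv1 v : fps_deriv v 1 = 0.
Proof.
by apply/funext => -[|k]; rewrite /fps_deriv fps1E ?ddir1 ?linear0.
Qed.

Lemma fps_derivV v P : P \is a GRing.unit ->
  fps_deriv v P^-1 = - (P^-1 * P^-1 * fps_deriv v P).
Proof.
move=> Pu; apply: (mulrI Pu); apply/eqP; rewrite -subr_eq0; apply/eqP.
have := fps_deriv1 v; rewrite -{1}(mulrV Pu) fps_derivM => d0.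
rewrite mulrN opprK !mulrA mulrV // mul1r -[RHS]d0 addrC [P^-1 * _]mulrC //.
Qed.

Definition tlin b : fps A := fun k => if k == 1%N then lin b else 0.
Definition fps_exp y : fps A := fun k => (k`!%:R : K)^-1 *: lin y ^+ k.
(** The expansion of (e^y - 1)/y. *)
Definition fps_expm1 y : fps A := fun k => (k.+1`!%:R : K)^-1 *: lin y ^+ k.

Lemma tlinE b : tlin b = fpsX A * fpsC (lin b).
Proof. by apply/funext => -[|[|k]]; rewrite fpsXM. Qed.

Lemma tlinM b P k : (tlin b * P) k = if k is k'.+1 then lin b * P k' else 0.
Proof. by rewrite tlinE -mulrA fpsXM; case: k => // k; rewrite fpsCM. Qed.

Lemma fps_expD x y : fps_exp (x + y) = fps_exp x * fps_exp y.
Proof.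
apply/funext => k; rewrite fpsME /fps_exp linD addrC exprDn scaler_sumr.
apply: eq_bigr => i _; have ik : (i <= k)%N by rewrite -ltnS.
rewrite -[_ *+ 'C(_, _)]scaler_nat [LHS]scalerA -[RHS]scalerAl -scalerAr [RHS]scalerA.
rewrite [lin x ^+ i * _]mulrC.
have nz j : (j`!%:R != 0 :> K) by rewrite pnatr_eq0 -lt0n fact_gt0.
congr (_ *: _); apply: (mulIf (nz k)).
rewrite -(bin_fact ik) !natrM; field.
by rewrite !nz pnatr_eq0 -lt0n bin_gt0 ik.
Qed.

Lemma fps_expm1E y : tlin y * fps_expm1 y = fps_exp y - 1.
Proof.
apply/funext => -[|k]; rewrite tlinM fpsDE fpsNE fps1E /fps_exp.
  by rewrite fact0 invr1 scale1r subrr.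
by rewrite subr0 /fps_expm1 -scalerAr -exprS.
Qed.

Lemma fps_deriv_exp v y :
  fps_deriv v (fps_exp y) = fpsX A * fpsC ((iota (y v))%:A : A) * fps_exp y.
Proof.
have dX k : ddir v (lin y ^+ k) = (k%:R * iota (y v)) *: lin y ^+ k.-1.
  elim: k => [|k IH]; first by rewrite expr0 ddir1 mul0r scale0r.
  rewrite exprS ddirM ddir_lin IH mulr_algl.
  case: k {IH} => [|k]; first by rewrite !mul0r scale0r mulr0 addr0 mul1r.
  by rewrite /= -scalerAr -exprS -scalerDl -[k.+2%:R]nat1r mulrDl mul1r.
apply/funext => -[|k]; rewrite /fps_deriv /fps_exp linearZ /= dX -mulrA fpsXM.
  by rewrite mul0r scale0r scaler0.
rewrite fpsCM mulr_algl !scalerA /=; congr (_ *: _).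
by rewrite factS natrM invfM mulrACA mulVf ?pnatr_eq0 // mul1r mulrC.
Qed.

(** What is left of 1 - u e^(-b) once its zero along [b] is divided out: for u = 1 this is (1 -
    e^(-b))/b, with constant term 1; otherwise it is the factor itself, with constant term 1 - u. *)
Definition factor_unit (u : K) b : fps A :=
  if u == 1 then fps_expm1 (- b) else 1 - fpsC (u%:A : A) * fps_exp (- b).

Lemma factor_unitE (u : K) b : 1 - fpsC (u%:A : A) * fps_exp (- b) =
  (if u == 1 then tlin b else 1) * factor_unit u b.
Proof.
rewrite /factor_unit; case: eqP => [->|_]; last by rewrite mul1r.
have -> : tlin b = - tlin (- b).
  apply/funext => k; rewrite fpsNE /tlin linN.
  by case: ifP; rewrite ?opprK ?oppr0.
rewrite mulNr fps_expm1E opprB scale1r; congr (_ - _).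
by apply/funext => k; rewrite fpsCM mul1r.
Qed.

Lemma factor_unit_unit (u : K) b : factor_unit u b \is a GRing.unit.
Proof.
rewrite /factor_unit; case: ifPn => u1.
  apply: (@fps_unit_const _ _ 1).
  by rewrite /fps_expm1 factS fact0 invr1 scale1r mulr1.
apply: (@fps_unit_const _ _ (1 - u)^-1%:A).
rewrite fpsDE fpsNE fps1E fpsCM /fps_exp fact0 invr1 scale1r mulr1.
have -> : true%:R - u%:A = (1 - u)%:A :> A by rewrite scalerBl scale1r.
by rewrite mulr_algl scalerA mulfV ?scale1r // subr_eq0 eq_sym.
Qed.

Lemma fps_deriv_factor v (u : K) b :
  fps_deriv v (1 - fpsC (u%:A : A) * fps_exp (- b)) =
  fpsX A * fpsC ((iota (b v))%:A : A) * (fpsC (u%:A : A) * fps_exp (- b)).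
Proof.
rewrite fps_derivD fps_deriv1 add0r fps_derivN fps_derivM fps_derivC mul0r add0r.
rewrite fps_deriv_exp.
have -> : fpsC ((iota ((- b) v))%:A : A) = - fpsC ((iota (b v))%:A : A).
  apply/funext => k; rewrite fpsNE /fpsC lfunE /= rmorphN scaleNr.
  by case: ifP => //; rewrite oppr0.
by rewrite !(mulrN, mulNr) opprK mulrCA.
Qed.

Lemma fps_deriv_tlin v b :
  fps_deriv v (tlin b) = fpsX A * fpsC ((iota (b v))%:A : A).
Proof.
apply/funext => -[|[|k]]; rewrite /fps_deriv /tlin fpsXM ?linear0 //= ddir_lin.
Qed.

Definition Lfps s P : K := L s (P (size s - n)%N).
(** The index retained for [b :: s] when [s] has at least n elements; the derivative of that
    component has the degree retained for [s]. *)
Definition Lfps1 s P : K := L s (P (size s - n).+1).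

Lemma LfpsD s P Q : Lfps s (P + Q) = Lfps s P + Lfps s Q.
Proof. by rewrite /Lfps fpsDE linearD. Qed.

Lemma Lfps1D s P Q : Lfps1 s (P + Q) = Lfps1 s P + Lfps1 s Q.
Proof. by rewrite /Lfps1 fpsDE linearD. Qed.

Lemma LfpsN s P : Lfps s (- P) = - Lfps s P.
Proof. by rewrite /Lfps fpsNE linearN. Qed.

Lemma Lfps1N s P : Lfps1 s (- P) = - Lfps1 s P.
Proof. by rewrite /Lfps1 fpsNE linearN. Qed.

Lemma LfpsCM s c P : Lfps s (fpsC (c%:A : A) * P) = c * Lfps s P.
Proof. by rewrite /Lfps fpsCM mulr_algl linearZ. Qed.

Lemma Lfps1XM s P : Lfps1 s (fpsX A * P) = Lfps s P.
Proof. by rewrite /Lfps1 fpsXM. Qed.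

Lemma Lfps_cons b s P : ok b -> (forall b', b' \in s -> ok b') ->
  Lfps (b :: s) (tlin b * P) = Lfps s P.
Proof.
have [L_small L_cons _ _] := rf.
move=> bok sok; rewrite /Lfps /=; have [ns|sn] := leqP n (size s).
  by rewrite subSn // tlinM L_cons.
(* By truncated subtraction the left side reads index 0, where the series [tlin b] vanishes. *)
have -> : ((size s).+1 - n = 0)%N by apply/eqP; rewrite subn_eq0.
by rewrite tlinM linear0 L_small.
Qed.

Lemma Lfps1_cons b s P : ok b -> (forall b', b' \in s -> ok b') ->
  Lfps1 (b :: s) (tlin b * P) = Lfps1 s P.
Proof.
have [L_small L_cons _ _] := rf.
move=> bok sok; rewrite /Lfps1 /= tlinM; have [ns|sn] := leqP n (size s).
  by rewrite subSn // L_cons.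
by rewrite L_cons // !L_small.
Qed.

Lemma Lfps_perm s s' P : (forall b, b \in s -> ok b) -> perm_eq s s' ->
  Lfps s P = Lfps s' P.
Proof.
have [_ _ L_perm _] := rf => sok ss'.
by rewrite /Lfps (perm_size ss') (L_perm _ _ _ sok ss').
Qed.

Lemma Lfps_deriv s v P : (forall b, b \in s -> ok b) ->
  Lfps1 s (fps_deriv v P) = \sum_(b <- s) iota (b v) * Lfps (b :: s) P.
Proof.
have [L_small _ _ L_ddir] := rf => sok; rewrite /Lfps1 /Lfps /=.
have [ns|sn] := leqP n (size s).
  by rewrite subSn // -L_ddir.
have -> : ((size s).+1 - n = 0)%N by apply/eqP; rewrite subn_eq0.
by rewrite -L_ddir // !L_small.
Qed.

Variable chi : V' -> K.
Hypotheses (chiD : {morph chi : x y / x + y >-> x * y}) (chi0 : chi 0 = 1).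

Definition poles s := [seq b <- s | chi b == 1].
Definition units s : fps A := \prod_(b <- s) (factor_unit (chi b) b)^-1.
(* [L] applied to [P / prod_(b in s) (1 - chi b e^(-b))]: by [factor_unitE] the
   factors with [chi b = 1] have a pole along [b], the others are units. *)
Definition Lgen s P : K := Lfps (poles s) (P * units s).
Definition xchar b : fps A := fpsC ((chi b)%:A : A) * fps_exp (- b).
(* For [chi b = e^<b, p>], the term of index [p] in the sum defining
   [iota_chamber]. *)
Definition Psi l s : K := (chi l)^-1 * Lgen s (fps_exp l).

Let poles_ok s : (forall b, b \in s -> ok b) -> forall b, b \in poles s -> ok b.
Proof. by move=> sok b; rewrite mem_filter => /andP[_ /sok]. Qed.

Lemma Lgen_perm s s' P : (forall b, b \in s -> ok b) -> perm_eq s s' ->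
  Lgen s P = Lgen s' P.
Proof.
move=> sok ss'; rewrite /Lgen /units (perm_big _ ss').
by apply: Lfps_perm; [exact: poles_ok | exact: perm_filter].
Qed.

Lemma Lgen_cons b s P : ok b -> (forall b', b' \in s -> ok b') ->
  Lgen (b :: s) (P * (1 - xchar b)) = Lgen s P.
Proof.
move=> bok sok; rewrite /Lgen /units big_cons factor_unitE -/(units s).
set F := factor_unit _ _; set c := if _ then _ else _; set U := units s.
have -> : P * (c * F) * (F^-1 * U) = c * (P * U).
  transitivity ((F * F^-1) * (c * (P * U))); first by ring.
  by rewrite mulrV ?mul1r // factor_unit_unit.
rewrite /c /poles /=; case: ifP => _; last by rewrite mul1r.
by rewrite Lfps_cons //; exact: poles_ok.
Qed.

Lemma LgenD s P Q : Lgen s (P + Q) = Lgen s P + Lgen s Q.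
Proof. by rewrite /Lgen mulrDl LfpsD. Qed.

Lemma LgenN s P : Lgen s (- P) = - Lgen s P.
Proof. by rewrite /Lgen mulNr LfpsN. Qed.

Lemma LgenCM s c P : Lgen s (fpsC (c%:A : A) * P) = c * Lgen s P.
Proof. by rewrite /Lgen -mulrA LfpsCM. Qed.

Let chi_unit b : chi b != 0.
Proof.
have : chi b * chi (- b) != 0 by rewrite -chiD subrr chi0 oner_neq0.
by rewrite mulf_eq0 negb_or => /andP[].
Qed.

Let chiN b : chi (- b) = (chi b)^-1.
Proof. by apply: (mulfI (chi_unit b)); rewrite -chiD subrr chi0 divff. Qed.

Lemma Psi_shift l b s : Psi (l - b) s = (chi l)^-1 * Lgen s (fps_exp l * xchar b).
Proof.
rewrite /Psi fps_expD chiD chiN invfM invrK -mulrA; congr (_ * _).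
by rewrite -LgenCM /xchar; congr (Lgen s _); rewrite mulrCA.
Qed.

Lemma Psi_perm l s s' : (forall b, b \in s -> ok b) -> perm_eq s s' ->
  Psi l s = Psi l s'.
Proof. by move=> sok ss'; rewrite /Psi (Lgen_perm _ sok ss'). Qed.

Lemma Psi_cons l b s : ok b -> (forall b', b' \in s -> ok b') ->
  Psi l (b :: s) - Psi (l - b) (b :: s) = Psi l s.
Proof.
move=> bok sok; rewrite Psi_shift /Psi -mulrBr -LgenN -LgenD; congr (_ * _).
by rewrite -(Lgen_cons _ bok sok) mulrBr mulr1.
Qed.

Lemma fps_deriv_units v s : fps_deriv v (units s) = - \sum_(b <- s)
  units s * ((factor_unit (chi b) b)^-1 * fps_deriv v (factor_unit (chi b) b)).
Proof.
rewrite /units; elim: s => [|b s IH]; first by rewrite !big_nil fps_deriv1 oppr0.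
rewrite !big_cons fps_derivM fps_derivV ?factor_unit_unit // IH.
set U := \prod_(_ <- s) _; set F := factor_unit (chi b) b.
rewrite opprD mulrN; congr (_ + - _); first by rewrite mulNr; congr (- _); ring.
by rewrite mulr_sumr; apply: eq_bigr => a _; rewrite mulrA.
Qed.

(** The residue of the derivative along [v] of e^l / prod_(b in s) (1 - chi b e^(-b)) is zero: the
    derivative of e^l gives the left side, the logarithmic derivative of each factor gives the term
    of [b]. *)
Lemma Psi_euler l v s : (forall b, b \in s -> ok b) ->
  iota (l v) * Psi l s = \sum_(b <- s) iota (b v) * Psi (l - b) (b :: s).
Proof.
move=> sok; have s1ok := poles_ok sok.
transitivity ((chi l)^-1 * \sum_(b <- s) iota (b v) *
    Lgen (b :: s) (fps_exp l * xchar b)); last first.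
  by rewrite mulr_sumr; apply: eq_bigr => b _; rewrite Psi_shift mulrCA.
rewrite /Psi mulrCA; congr (_ * _).
set E := fps_exp l; set P := E * units s.
have dP : fps_deriv v P = fpsX A * (fpsC ((iota (l v))%:A : A) * P) -
    \sum_(b <- s) P *
      ((factor_unit (chi b) b)^-1 * fps_deriv v (factor_unit (chi b) b)).
  rewrite fps_derivM fps_deriv_exp fps_deriv_units mulrN /P !mulrA; congr (_ - _).
  by rewrite mulr_sumr; apply: eq_bigr => b _; rewrite !mulrA.
(* [Lfps_deriv] contributes a term for each pole, the derivatives of the units one for each element
   of [s]. For a pole the two add up to the derivative of [tlin b * F]; for the other elements the
   whole factor is the unit [F]. *)
have := Lfps_deriv v P s1ok; rewrite dP Lfps1D Lfps1XM LfpsCM Lfps1N.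
move=> /eqP; rewrite subr_eq => /eqP ->.
have -> : forall F : V' -> fps A, Lfps1 (poles s) (\sum_(b <- s) F b) =
    \sum_(b <- s) Lfps1 (poles s) (F b).
  move=> F; apply: (big_morph _ (Lfps1D _)); exact: linear0.
rewrite /poles big_filter big_mkcond -big_split big_seq [RHS]big_seq -/(poles s).
apply: eq_bigr => b sb /=; have bok := sok b sb.
rewrite /Lgen /units big_cons -/(units s) /poles /= -/(poles s).
have := fps_deriv_factor v (chi b) b; rewrite factor_unitE -/(xchar b).
set F := factor_unit (chi b) b; have Fu : F \is a GRing.unit by exact: factor_unit_unit.
set D := fps_deriv v F; case: ifP => [chib|_].
  rewrite fps_derivM fps_deriv_tlin -/D => dF.
  rewrite -(Lfps1_cons _ bok s1ok) -!LfpsCM -[X in X + _]Lfps1XM -[RHS]Lfps1XM.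
  rewrite -Lfps1D; congr (Lfps1 _ _); set T := fpsC (_ : A) in dF *.
  transitivity (F^-1 * P * (fpsX A * T * F + tlin b * D)).
    rewrite mulrDr; congr (_ + _); last by ring.
    transitivity ((F^-1 * F) * (fpsX A * (T * P))); last by ring.
    by rewrite mulVr ?mul1r.
  by rewrite dF /P; ring.
rewrite !mul1r add0r -/D => ->; rewrite -LfpsCM -Lfps1XM.
by congr (Lfps1 _ _); rewrite /P; ring.
Qed.

End SeriesFunctional.

(** * Reduction to bases *)

Section Box.
Variables (R : realType) (W : vectType R).
Implicit Types (s : seq W) (b y : W).

Lemma box_cons b s y : box (b :: s) y <->
  exists2 r : R, 0 <= r <= 1 & box s (y - r *: b).
Proof.
split=> [[t t01 ->]|[r r01 [t t01 yE]]].
  exists (t ord0); first exact: t01.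
  exists (fun i => t (lift ord0 i)); first by move=> i; exact: t01.
  by rewrite big_ord_recl /= addrC addKr.
exists (fun i : 'I_(size (b :: s)) => if unlift ord0 i is Some j then t j else r).
  by move=> i; case: unliftP.
rewrite big_ord_recl unlift_none /= -[y](subrK (r *: b)) yE addrC.
by congr (_ + _); apply: eq_bigr => i _; rewrite liftK.
Qed.

Lemma box_perm s s' y : perm_eq s s' -> box s y -> box s' y.
Proof.
elim: s s' y => [|b s IH] s' y; first by rewrite perm_sym => /perm_nilP ->.
move=> bss' /box_cons[r r01 ys].
have bs' : b \in s' by rewrite -(perm_mem bss') mem_head.
have : perm_eq s (rem b s').
  by rewrite -(perm_cons b); apply: perm_trans bss' (perm_to_rem bs').
move=> /IH/(_ ys) => ys'.
elim: s' y {bss' IH ys} bs' ys' => //= a s' IH y bas'.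
have [->{bas'} ys'|ab /box_cons[r' r01' ys']] := eqVneq a b.
  by apply/box_cons; exists r.
apply/box_cons; exists r' => //; apply: IH; last by rewrite addrAC.
by move: bas'; rewrite inE eq_sym (negbTE ab).
Qed.

(** The diagonal r1 = r2 cuts the parallelogram of [b1] and [b2] into two triangles. On each one,
    the second point is shifted as in the second term of [D_merge], with [b1] and [b2] in the order
    that suits the triangle. *)
Lemma box_merge b1 b2 s y : box (b1 :: b2 :: s) y ->
  (box (b1 :: (b1 + b2) :: s) y /\ box (b2 :: (b1 + b2) :: s) (y + b2)) \/
  (box (b2 :: (b1 + b2) :: s) y /\ box (b1 :: (b1 + b2) :: s) (y + b1)).
Proof.
have e1 (P X Z : W) : y - (P - X) - (X + Z) = y - P - Z.
  by rewrite opprB opprD addrA [X - P]addrC addrA addrK.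
have e2 (B S X Z : W) : y + B - (B + S - X) - (X + Z) = y - S - Z.
  by rewrite opprB [X - _]addrC addrA opprD !addrA addrK opprD addrA addrK.
move=> /box_cons[r1 /andP[r1_ge0 r1_le1] /box_cons[r2 /andP[r2_ge0 r2_le1] ys]].
have [r21|r12] := lerP r2 r1; [left|right]; split; apply/box_cons.
- exists (r1 - r2); first by apply/andP; split; lra.
  apply/box_cons; exists r2; first exact/andP.
  by rewrite scalerBl scalerDr e1.
- exists (1 + r2 - r1); first by apply/andP; split; lra.
  apply/box_cons; exists r1; first exact/andP.
  by rewrite scalerBl scalerDl scale1r scalerDr [r1 *: b1 + _]addrC e2 addrAC.
- exists (r2 - r1); first by apply/andP; split; lra.
  apply/box_cons; exists r1; first by apply/andP; split; lra.
  by rewrite scalerBl scalerDr [r1 *: b1 + _]addrC e1 addrAC.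
- exists (1 + r1 - r2); first by apply/andP; split; lra.
  apply/box_cons; exists r2; first exact/andP.
  by rewrite scalerBl scalerDl scale1r scalerDr e2.
Qed.

(** The long box has room for each of the k shifts that occur in [D_scale]. *)
Lemma box_scale k j b s y : (j < k)%N -> box (b :: s) y ->
  box (b *+ k :: s) (y + b *+ j).
Proof.
move=> jk /box_cons[r /andP[r_ge0 r_le1] ys]; apply/box_cons.
have k0 : 0 < k%:R :> R by rewrite ltr0n (leq_ltn_trans _ jk).
have jk' : j%:R + 1 <= k%:R :> R by rewrite natr1 ler_nat.
exists ((r + j%:R) / k%:R).
  apply/andP; split; first by rewrite divr_ge0 ?addr_ge0 // ltW.
  by rewrite ler_pdivrMr // mul1r; lra.
rewrite -[b *+ k]scaler_nat scalerA divfK ?gt_eqF // scalerDl scaler_nat.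
by rewrite opprD addrACA subrr addr0.
Qed.

End Box.

Lemma perm_swap12 (T : eqType) (a b : T) s : perm_eq [:: a, b & s] [:: b, a & s].
Proof. by apply/permP => p /=; lia. Qed.

Lemma perm_swap13 (T : eqType) (a b c : T) s :
  perm_eq [:: a, b, c & s] [:: c, b, a & s].
Proof. by apply/permP => p /=; lia. Qed.

Lemma perm_rot3 (T : eqType) (a b c : T) s :
  perm_eq [:: a, b, c & s] [:: c, a, b & s].
Proof. by apply/permP => p /=; lia. Qed.

Section Reduction.
Variables (R : realType) (W : vectType R) (K : zmodType).
Variables (lat ok : W -> Prop) (ht : W -> R) (x : W).
(** To be instantiated with the difference between the number of solutions and the residue sum at
    level [M]. *)
Variable D : nat -> W -> seq W -> K.
Implicit Types (s A B : seq W) (b y l : W).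

Hypotheses (latD : forall y z, lat y -> lat z -> lat (y + z))
  (latN : forall y, lat y -> lat (- y)).
Hypotheses (ok_lat : forall b, ok b -> lat b) 
  (htD : {morph ht : y z / y + z}) (ok_gt0 : forall b, ok b -> 0 < ht b)
  (okD : forall b b', ok b -> ok b' -> ok (b + b')).
Hypothesis D_perm : forall M l s s', (forall b, b \in s -> ok b) ->
  perm_eq s s' -> D M l s = D M l s'.
Hypothesis D_cons : forall M l b s, ok b -> (forall b', b' \in s -> ok b') ->
  D M l (b :: s) - D M (l - b) (b :: s) = D M l s.
Hypothesis integral_relation : forall s, uniq s -> (forall b, b \in s -> ok b) ->
  ~~ free s -> exists2 c : W -> int,
    \sum_(b <- s) b *~ c b = 0 & exists2 b, b \in s & c b != 0.

(* [M] bounds the order of the torsion points that are summed over in [D]. *)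
Definition vanishing s := exists2 M0, (0 < M0)%N & forall M l,
  (M0 %| M)%N -> (0 < M)%N -> lat l -> box s (x - l) -> D M l s = 0.

Lemma vanishing_perm s s' : (forall b, b \in s -> ok b) -> perm_eq s s' ->
  vanishing s -> vanishing s'.
Proof.
move=> sok ss' [M0 M0_gt0 Ds]; exists M0 => // M l M0M Mgt0 lat_l xs'.
rewrite -(D_perm M l sok ss'); apply: Ds => //.
by apply: box_perm xs'; rewrite perm_sym.
Qed.

Let ok_cons b s : ok b -> (forall b', b' \in s -> ok b') ->
  forall b', b' \in b :: s -> ok b'.
Proof. by move=> bok sok b'; rewrite inE => /predU1P[->|/sok]. Qed.

(* 1 - x1 x2 = (1 - x2) + x2 (1 - x1) *)
Lemma D_merge M l b1 b2 s : ok b1 -> ok b2 -> (forall b, b \in s -> ok b) ->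
  D M l (b1 :: b2 :: s) =
  D M l (b1 :: (b1 + b2) :: s) + D M (l - b2) (b2 :: (b1 + b2) :: s).
Proof.
move=> ok1 ok2 sok; have ok3 := okD ok1 ok2.
have P l' := D_perm M l' (ok_cons ok2 (ok_cons ok1 (ok_cons ok3 sok)))
  (perm_swap13 b2 b1 (b1 + b2) s).
have Q l' := D_perm M l' (ok_cons ok1 (ok_cons ok2 (ok_cons ok3 sok)))
  (perm_rot3 b1 b2 (b1 + b2) s).
rewrite -(D_cons M l ok3 (ok_cons ok1 (ok_cons ok2 sok))).
rewrite -(D_cons M l ok2 (ok_cons ok1 (ok_cons ok3 sok))).
rewrite -(D_cons M (l - b2) ok1 (ok_cons ok2 (ok_cons ok3 sok))).
rewrite !P !Q addrA subrK; congr (_ - D M _ _).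
by rewrite opprD addrA addrAC.
Qed.

Lemma vanishing_merge b1 b2 s : ok b1 -> ok b2 -> (forall b, b \in s -> ok b) ->
  vanishing (b1 :: (b1 + b2) :: s) -> vanishing (b2 :: (b1 + b2) :: s) ->
  vanishing (b1 :: b2 :: s).
Proof.
move=> ok1 ok2 sok [M1 M1_gt0 D1] [M2 M2_gt0 D2].
exists (M1 * M2)%N => [|M l MM Mgt0 lat_l xs]; first by rewrite muln_gt0 M1_gt0.
have MM1 := dvdn_trans (dvdn_mulr _ (dvdnn M1)) MM.
have MM2 := dvdn_trans (dvdn_mull _ (dvdnn M2)) MM.
have latB b : ok b -> lat (l - b) by move=> /ok_lat bl; apply: latD => //; exact: latN.
have xB b : x - (l - b) = x - l + b by rewrite opprB addrCA addrC.
have [[x1 x2]|[x2 x1]] := box_merge xs.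
  rewrite (D_merge _ _ ok1 ok2 sok) (D1 _ _ MM1 Mgt0 lat_l x1) add0r.
  by apply: (D2 _ _ MM2 Mgt0 (latB _ ok2)); rewrite xB.
rewrite (D_perm M l (ok_cons ok1 (ok_cons ok2 sok)) (perm_swap12 _ _ _)).
rewrite (D_merge _ _ ok2 ok1 sok) [b2 + b1]addrC (D2 _ _ MM2 Mgt0 lat_l x2) add0r.
by apply: (D1 _ _ MM1 Mgt0 (latB _ ok1)); rewrite xB.
Qed.

Lemma ok_mulrn b k : ok b -> (0 < k)%N -> ok (b *+ k).
Proof.
move=> bok; case: k => // k _; elim: k => // k IH.
by rewrite mulrS; exact: okD.
Qed.

(** 1/(1 - u) = (1 + u + ... + u^(k-1)) / (1 - u^k), where u is the shift by [b]. *)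
Lemma D_scale M l b k s : ok b -> (forall b', b' \in s -> ok b') -> (0 < k)%N ->
  D M l (b :: s) = \sum_(j < k) D M (l - b *+ j) (b *+ k :: s).
Proof.
move=> bok sok k0; have kbok := ok_mulrn bok k0.
have P l' := D_perm M l' (ok_cons kbok (ok_cons bok sok)) (perm_swap12 _ _ _).
rewrite -(D_cons M l kbok (ok_cons bok sok)) !P.
pose F j := D M (l - b *+ j) (b :: b *+ k :: s).
transitivity (\sum_(j < k) (F j - F j.+1)).
  rewrite -(big_mkord xpredT (fun j => F j - F j.+1)).
  under eq_bigr do rewrite -opprB.
  by rewrite sumrN telescope_sumr // opprB /F mulr0n subr0.
apply: eq_bigr => j _; rewrite -(D_cons M _ bok (ok_cons kbok sok)).
by rewrite /F mulrS opprD addrA addrAC.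
Qed.

Lemma vanishing_scale b k s : ok b -> (forall b', b' \in s -> ok b') -> (0 < k)%N ->
  vanishing (b *+ k :: s) -> vanishing (b :: s).
Proof.
move=> bok sok k0 [M0 M0_gt0 Ds]; exists M0 => // M l MM Mgt0 lat_l xs.
rewrite (D_scale _ _ bok sok k0) big1 // => j _; apply: (Ds _ _ MM Mgt0).
  case: (j : nat) => [|i]; first by rewrite mulr0n subr0.
  by apply: latD => //; apply: latN; apply: ok_lat; exact: ok_mulrn.
by rewrite opprB addrCA [b *+ j + _]addrC; exact: box_scale.
Qed.

Definition spanning_ok s := (forall b, b \in s -> ok b) /\ span s = fullv.

Lemma span_eq s s' : {subset s <= span s'} -> span s = fullv -> span s' = fullv.
Proof.
move=> ss' sT; apply/eqP; rewrite eqEsubv subvf -sT /=.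
by apply/span_subvP => b /ss'.
Qed.

Lemma vanishing_scale_map (f : W -> nat) s s' : (forall b, (0 < f b)%N) ->
  (forall b, b \in s ++ s' -> ok b) ->
  vanishing ([seq b *+ f b | b <- s] ++ s') -> vanishing (s ++ s').
Proof.
move=> f0; elim: s s' => [//|b s IH] s' sok van.
have ok' b' : b' \in s ++ s' -> ok b' by move=> h; apply: sok; rewrite inE h orbT.
apply: vanishing_scale (f0 b) _ => //; first by apply: sok; exact: mem_head.
have okb : forall b', b' \in b *+ f b :: s ++ s' -> ok b'.
  by apply: ok_cons => //; apply: ok_mulrn => //; apply: sok; exact: mem_head.
have P t t' : perm_eq (b *+ f b :: t ++ t') (t ++ b *+ f b :: t').
  by rewrite -(perm_catCA t [:: b *+ f b]) .
apply: (@vanishing_perm (s ++ b *+ f b :: s')); last 1 first.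
- apply: IH => [b'|]; first by rewrite -(perm_mem (P s s')); exact: okb.
  apply: (vanishing_perm _ (P _ _)) => [b'|]; last exact: van.
  rewrite inE mem_cat => /or3P[/eqP->|/mapP[a sa ->]|s'b'].
  + exact: okb (mem_head _ _).
  + by apply: ok_mulrn => //; apply: ok'; rewrite mem_cat sa.
  + by apply: ok'; rewrite mem_cat s'b' orbT.
- by move=> b'; rewrite -(perm_mem (P s s')); exact: okb.
- by rewrite perm_sym.
Qed.

(** One merge leaves, in each of the two terms, one copy less of [b1] or of [b2]; it is repeated
    until one of the two vectors has disappeared. *)
Lemma vanishing_merges b1 b2 s : ok b1 -> ok b2 -> (forall b, b \in s -> ok b) ->
  (forall i j, (0 < i)%N -> (0 < j)%N ->
    vanishing (nseq i b1 ++ nseq j (b1 + b2) ++ s)) ->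
  (forall i j, (0 < i)%N -> (0 < j)%N ->
    vanishing (nseq i b2 ++ nseq j (b1 + b2) ++ s)) ->
  forall i j k, (0 < i)%N -> (0 < j)%N ->
    vanishing (nseq i b1 ++ nseq j b2 ++ nseq k (b1 + b2) ++ s).
Proof.
move=> ok1 ok2 sok van1 van2 i j k; have [m] := ubnP (i + j).
elim: m i j k => // m IH [//|i] [//|j] k ijm _ _.
pose t := nseq i b1 ++ nseq j b2 ++ nseq k (b1 + b2) ++ s.
have tok b : b \in t -> ok b.
  rewrite !mem_cat !mem_nseq => /or4P[/andP[_ /eqP->]|/andP[_ /eqP->]|/andP[_ /eqP->]|/sok] //.
  exact: okD.
have tp1 : perm_eq (b1 :: (b1 + b2) :: t)
    (nseq i.+1 b1 ++ nseq j b2 ++ nseq k.+1 (b1 + b2) ++ s).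
  by apply/permP => p; rewrite /t; do 3 rewrite /= ?(count_cat, count_nseq); lia.
have tp2 : perm_eq (b2 :: (b1 + b2) :: t)
    (nseq i b1 ++ nseq j.+1 b2 ++ nseq k.+1 (b1 + b2) ++ s).
  by apply/permP => p; rewrite /t; do 3 rewrite /= ?(count_cat, count_nseq); lia.
have tp0 : perm_eq (b1 :: b2 :: t)
    (nseq i.+1 b1 ++ nseq j.+1 b2 ++ nseq k (b1 + b2) ++ s).
  by apply/permP => p; rewrite /t; do 3 rewrite /= ?(count_cat, count_nseq); lia.
apply: (vanishing_perm (ok_cons ok1 (ok_cons ok2 tok)) tp0).
have ok3 := okD ok1 ok2.
have pok s1 s2 : perm_eq s1 s2 -> (forall b, b \in s1 -> ok b) ->
    (forall b, b \in s2 -> ok b) by move=> p12 h b; rewrite -(perm_mem p12); exact: h.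
have ok13 := pok _ _ tp1 (ok_cons ok1 (ok_cons ok3 tok)).
have ok23 := pok _ _ tp2 (ok_cons ok2 (ok_cons ok3 tok)).
apply: vanishing_merge => //.
  apply: (vanishing_perm ok13); first by rewrite perm_sym; exact: tp1.
  case: j {tp0 tp1 tp2 tok t ok13 ok23} ijm => [|j] ijm; first exact: van1.
  by apply: IH => //; move: ijm; rewrite !ltnS; lia.
apply: (vanishing_perm ok23); first by rewrite perm_sym; exact: tp2.
case: i {tp0 tp1 tp2 tok t ok13 ok23} ijm => [|i] ijm; first exact: van2.
by apply: IH => //; move: ijm; rewrite !ltnS; lia.
Qed.

Lemma undup_nseq2_size (a b : W) s i j : (0 < i)%N -> (0 < j)%N ->
  (size (undup (nseq i a ++ nseq j b ++ s)) <= (b \notin s) + (size (undup s)).+1)%N.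
Proof.
move=> i0 j0; have [bs|bs] := boolP (b \in s); rewrite ?add0n ?add1n /=.
  rewrite -[(size _).+1]/(size (a :: undup s)).
  apply: uniq_leq_size; first exact: undup_uniq.
  move=> z; rewrite mem_undup !mem_cat !mem_nseq inE mem_undup.
  by case/or3P => [/andP[_ ->//]|/andP[_ /eqP->]|->]; rewrite ?bs orbT.
rewrite -[(size _).+2]/(size (a :: b :: undup s)).
apply: uniq_leq_size; first exact: undup_uniq.
move=> z; rewrite mem_undup !mem_cat !mem_nseq !inE mem_undup.
by case/or3P => [/andP[_ ->//]|/andP[_ ->]|->]; rewrite ?orbT.
Qed.

(** A linear relation on [s] whose coefficients are 1 on [A], -1 on [B] and 0 elsewhere. *)
Definition sum_relation s A B := [/\ uniq A, uniq B, {subset A <= s} /\ {subset B <= s},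
  (forall b, b \in A -> b \notin B) & A != [::] /\ \sum_(a <- A) a = \sum_(b <- B) b].

Let ok_sum_gt0 A : (forall b, b \in A -> ok b) -> A != [::] -> 0 < ht (\sum_(a <- A) a).
Proof.
elim: A => // a [|b A] IH Aok _.
  by rewrite big_seq1; apply/ok_gt0/Aok/mem_head.
rewrite big_cons htD addr_gt0 //; first by apply/ok_gt0/Aok/mem_head.
by apply: IH => // z zA; apply: Aok; rewrite inE zA orbT.
Qed.

Let ht0 : ht 0 = 0.
Proof. by apply: (addrI (ht 0)); rewrite -htD !addr0. Qed.

(** Merging two elements of [A] trades one of them for their sum, so the number of distinct vectors
    does not grow. If the sum was already in the rest of the list, this number drops and the
    hypothesis on [d] applies; otherwise the sum replaces both elements in [A] and the relation gets
    shorter. *)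
Lemma vanishing_sum_relation d :
    (forall s, spanning_ok s -> (size (undup s) < d)%N -> vanishing s) ->
  forall s A B, spanning_ok s -> (size (undup s) <= d)%N -> sum_relation s A B ->
  vanishing s.
Proof.
move=> IHd s A B; have [k] := ubnP (size A + size B).
elim: k s A B => // k IH s A B ABk s_ok sd [uA uB [As Bs] AB [A0 eAB]].
have [sok sT] := s_ok.
(* [A] and [B] play symmetric roles once positivity of heights makes [B] nonempty, and two
   singletons with equal sums would not be disjoint. *)
wlog A2 : A B ABk uA uB As Bs AB A0 eAB / (1 < size A)%N.
  move=> wl; have [A1|A1] := ltnP 1 (size A); first exact: (wl A B).
  have B0 : B != [::].
    apply: contraTneq (ok_sum_gt0 (fun b bA => sok b (As b bA)) A0) => B0.
    by rewrite eAB B0 big_nil ht0 ltxx.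
  have [B1|B1] := ltnP 1 (size B).
    apply: (wl B A) => //; first by rewrite addnC.
    by move=> b bB; apply/negP => /AB; rewrite bB.
  case: A A0 A1 eAB {ABk uA wl} As AB => [//|a [|//]] _ _ eAB _ AB.
  case: B B0 B1 eAB {uB Bs} AB => [//|b [|//]] _ _ eAB AB.
  have := AB a (mem_head _ _); move: eAB; rewrite !big_seq1 => ->.
  by rewrite mem_head.
case: A A0 A2 uA ABk As AB eAB => [//|b1 [//|b2 A]] _ _.
rewrite /= inE negb_or => /and3P[/andP[b12 b1A] b2A uA] ABk As AB eAB.
pose s0 := [seq b <- s | (b != b1) && (b != b2)].
have s0P b : b \in s0 = [&& b != b1, b != b2 & b \in s] by rewrite mem_filter andbA.
have b1s : b1 \in s by apply: As; rewrite mem_head.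
have b2s : b2 \in s by apply: As; rewrite inE mem_head orbT.
have ok1 := sok _ b1s; have ok2 := sok _ b2s.
have ps : perm_eq (nseq (count_mem b1 s) b1 ++ nseq (count_mem b2 s) b2 ++
    nseq 0 (b1 + b2) ++ s0) s.
  apply/permP => p; rewrite !count_cat !count_nseq muln0 /s0.
  elim: (s) => [|b t IHt]; rewrite /= ?muln0 // -IHt !mulnDr.
  move: (p b1 * count_mem b1 t)%N (p b2 * count_mem b2 t)%N => i1 i2.
  case: (eqVneq b b1) => [->|_] /=.
    by rewrite (negbTE b12) muln1 muln0 add0n -!addnA.
  case: (eqVneq b b2) => [->|_] /=; last first.
    by rewrite !muln0; move: (nat_of_bool (p b)) (count p _) => u1 u2; clear; lia.
  by rewrite muln0 muln1 add0n -addnA addnCA.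
have s0s b : b \in s0 -> b \in s by rewrite s0P => /and3P[].
have s0ok b : b \in s0 -> ok b by move=> /s0s /sok.
have size_s : ((size (undup s0)).+2 <= size (undup s))%N.
  rewrite -[(size _).+2]/(size (b1 :: b2 :: undup s0)); apply: uniq_leq_size.
    by rewrite /= inE !mem_undup !s0P !eqxx /= andbF (negbTE b12) undup_uniq.
  by move=> b; rewrite !inE !mem_undup => /or3P[/eqP->|/eqP->|/s0s].
(* The lists from which [b'] has disappeared; they still span, because b' = (b1 + b2) - b. *)
have new b b' : b \in [:: b1; b2] -> b' \in [:: b1; b2] -> b + b' = b1 + b2 ->
    forall i j, (0 < i)%N -> (0 < j)%N ->
    vanishing (nseq i b ++ nseq j (b1 + b2) ++ s0).
  move=> bb bb' eb i j i0 j0; set s1 := nseq i b ++ _.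
  have okb : ok b by move: bb; rewrite !inE => /orP[/eqP->|/eqP->].
  have s1_ok : spanning_ok s1.
    split=> [z|].
      rewrite !mem_cat !mem_nseq => /or3P[/andP[_ /eqP->]|/andP[_ /eqP->]|/s0ok] //.
      exact: okD.
    have b_s1 : b \in span s1.
      by apply: memv_span; rewrite !mem_cat mem_nseq i0 eqxx.
    have b3_s1 : b1 + b2 \in span s1.
      by apply: memv_span; rewrite !mem_cat !mem_nseq j0 eqxx orbT.
    have b'_s1 : b' \in span s1 by rewrite -[b'](addKr b) addrC eb memvB.
    apply: span_eq sT => z zs; have [z0|] := boolP (z \in s0).
      by apply: memv_span; rewrite !mem_cat z0 !orbT.
    rewrite s0P zs andbT negb_and !negbK => z12.
    have : z \in [:: b; b'].
      have bb'E : (b == b1) && (b' == b2) || (b == b2) && (b' == b1).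
        move: bb bb' eb; rewrite !inE => /orP[]/eqP-> /orP[]/eqP->; rewrite ?eqxx ?orbT //.
          by move/addrI ->; rewrite eqxx.
        by move/addIr ->; rewrite eqxx.
      case/orP: bb'E => /andP[/eqP-> /eqP->]; rewrite !inE; first by [].
      by rewrite orbC.
    by rewrite !inE => /orP[]/eqP->.
  have size_s1 := leq_trans (undup_nseq2_size b (b1 + b2) s0 i0 j0).
  have [b3s0|b3s0] := boolP (b1 + b2 \in s0).
    apply: IHd => //; apply: leq_trans sd; apply: leq_trans size_s.
    by apply: size_s1; rewrite b3s0.
  apply: (IH s1 (b1 + b2 :: A) B) => //.
    by apply: leq_trans sd; apply: leq_trans size_s; apply: size_s1; rewrite b3s0.
  have A_s0 z : z \in A -> z \in s0.
    move=> zA; rewrite s0P As ?inE ?zA ?orbT // andbT.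
    by apply/andP; split; [move: b1A|move: b2A]; apply: contraNneq => <-.
  have B_s0 z : z \in B -> z \in s0.
    move=> zB; rewrite s0P Bs // andbT.
    by apply/andP; split; apply: contraTneq zB => ->; apply: AB; rewrite !inE eqxx ?orbT.
  split => //.
  - by rewrite /= uA andbT; apply: contra b3s0; exact: A_s0.
  - split=> z; last by move=> /B_s0 z0; rewrite !mem_cat z0 !orbT.
    rewrite inE => /predU1P[->|/A_s0 z0]; rewrite !mem_cat !mem_nseq ?z0 ?orbT //.
    by rewrite j0 eqxx orbT.
  - move=> z; rewrite inE => /predU1P[->|zA]; first by apply: contra b3s0; exact: B_s0.
    by apply: AB; rewrite !inE zA !orbT.
  - by split=> //; rewrite -eAB !big_cons addrA.
apply: (vanishing_perm _ ps); first by move=> b; rewrite (perm_mem ps); exact: sok.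
have cnt0 b : b \in s -> (0 < count_mem b s)%N by rewrite -has_count has_pred1.
apply: vanishing_merges; rewrite ?cnt0 //.
  by apply: (new b1 b2); rewrite ?inE ?eqxx ?orbT.
by apply: (new b2 b1); rewrite ?inE ?eqxx ?orbT // addrC.
Qed.

Theorem vanishing_reduction :
    (forall s, spanning_ok s -> free (undup s) -> vanishing s) ->
  forall s, spanning_ok s -> vanishing s.
Proof.
move=> van_free s; have [d] := ubnP (size (undup s)).
elim: d s => // d IHd s; rewrite ltnS => sd s_ok; have [sok sT] := s_ok.
have [|s_dep] := boolP (free (undup s)); first exact: van_free.
have uok b : b \in undup s -> ok b by rewrite mem_undup; exact: sok.
have [c c0 [b0 b0s cb0]] := integral_relation (undup_uniq s) uok s_dep.
(* Scaling each vector by the absolute value of its coefficient turns the coefficients into 1, -1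
   and 0; the maximum with 1 leaves alone the vectors whose coefficient is 0. *)
pose f b := maxn `|c b| 1; have f0 b : (0 < f b)%N by rewrite leq_max orbT.
pose g b := b *+ f b; pose s' := map g s.
suff : vanishing (map g s ++ [::]).
  by move/(vanishing_scale_map f0); rewrite !cats0; apply; exact: sok.
rewrite cats0 -/s'.
have s'_ok : spanning_ok s'.
  split=> [_ /mapP[b /sok bok ->]|]; first exact: ok_mulrn.
  apply: span_eq sT => b bs.
  rewrite -[b](scalerK (_ : (f b)%:R != 0 :> R)) ?pnatr_eq0 -?lt0n //.
  by rewrite memvZ // scaler_nat memv_span // (map_f g).
have us' : {subset undup s' <= map g (undup s)}.
  move=> z; rewrite mem_undup => /mapP[b bs ->].
  by apply: map_f; rewrite mem_undup.
have s'd : (size (undup s') <= size (undup s))%N.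
  by rewrite -(size_map g (undup s)); apply: uniq_leq_size us'; exact: undup_uniq.
(* If scaling identifies two vectors, fewer distinct ones remain; otherwise it is injective and
   preserves the disjointness of the two sides of the relation. *)
have [s'lt|s'ge] := ltnP (size (undup s')) d; first exact: IHd.
have s'E : size (undup s') = size (undup s).
  by apply/eqP; rewrite eqn_leq s'd (leq_trans sd).
have ug : uniq (map g (undup s)).
  by apply: leq_size_uniq us' _; rewrite ?undup_uniq // size_map s'E.
have g_inj b b' : b \in undup s -> b' \in undup s -> g b = g b' -> b = b'.
  elim: (undup s) ug => //= a t IHt /andP[gat ut]; rewrite !inE.
  move=> /predU1P[->|bt] /predU1P[->|b't] // gE; last exact: IHt.
    by case/negP: gat; rewrite gE map_f.
  by case/negP: gat; rewrite -gE map_f.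
pose A := [seq g b | b <- undup s & 0 < c b].
pose B := [seq g b | b <- undup s & c b < 0].
have sumA : \sum_(a <- A) a = \sum_(b <- undup s | 0 < c b) b *~ c b.
  rewrite big_map big_filter; apply: eq_bigr => b cb; rewrite /g /f.
  have /maxn_idPl -> : (0 < `|c b|)%N by rewrite absz_gt0 gt_eqF.
  by rewrite -{2}(gtz0_abs cb).
have sumB : \sum_(a <- B) a = - \sum_(b <- undup s | c b < 0) b *~ c b.
  rewrite big_map big_filter -sumrN; apply: eq_bigr => b cb; rewrite /g /f.
  have /maxn_idPl -> : (0 < `|c b|)%N by rewrite absz_gt0 lt_eqF.
  by rewrite -mulrNz -(ltz0_abs cb).
have eAB : \sum_(a <- A) a = \sum_(b <- B) b.
  have := c0; rewrite (bigID (fun b => 0 < c b)) /= => c0'.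
  rewrite sumA sumB; apply/eqP; rewrite -subr_eq0 opprK -[X in _ == X]c0'.
  apply/eqP; congr (_ + _); rewrite big_mkcond [RHS]big_mkcond /=.
  apply: eq_bigr => b _; rewrite -leNgt le_eqVlt; case: ltgtP => // cb.
  by rewrite cb mulr0z.
have AB_s' (P : pred W) : {subset [seq g b | b <- undup s & P b] <= s'}.
  move=> _ /mapP[b + ->]; rewrite mem_filter mem_undup => /andP[_ bs].
  exact: map_f.
have uAB (P : pred W) : uniq [seq g b | b <- undup s & P b].
  by apply: subseq_uniq ug; apply: map_subseq; exact: filter_subseq.
have [_ s'T] := s'_ok.
apply: (vanishing_sum_relation (A := A) (B := B)
  (fun t tok td => IHd t td tok) s'_ok); first by rewrite s'E.
split; [exact: uAB|exact: uAB|split; exact: AB_s'| |split=> //].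
  move=> z /mapP[b]; rewrite mem_filter => /andP[cb bs ->]; apply/negP => /mapP[b'].
  rewrite mem_filter => /andP[cb' b's] /(g_inj _ _ bs b's) bb'.
  by move: cb'; rewrite -bb' ltNge ltW.
apply/negP => /eqP A0.
have : 0 < ht (\sum_(b <- B) b).
  apply: ok_sum_gt0 => [z /AB_s'|]; first exact: (proj1 s'_ok).
  apply/negP => /eqP B0; have : g b0 \in A ++ B; last by rewrite A0 B0.
  rewrite mem_cat; case: (ltgtP (c b0) 0) cb0 => // cb _.
    by apply/orP; right; apply: map_f; rewrite mem_filter cb.
  by apply/orP; left; apply: map_f; rewrite mem_filter cb.
by rewrite -eAB A0 big_nil ht0 ltxx.
Qed.

End Reduction.

(** * Counting solutions *)

Section Counting.
Variables (R : realType) (W : zmodType) (ht : {additive W -> R}).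
Implicit Types (s : seq W) (b l : W).

Definition solutions s l : set {ffun 'I_(size s) -> nat} :=
  [set x | \sum_(k < size s) s`_k *+ x k = l].

Arguments solutions : clear implicits.

Definition count_solutions s l : nat := #|` fset_set (solutions s l)|.

Let cons0 b s (x : {ffun 'I_(size s) -> nat}) : {ffun 'I_(size (b :: s)) -> nat} :=
  [ffun k => if unlift ord0 k is Some j then x j else 0%N].

Let incr b s (x : {ffun 'I_(size (b :: s)) -> nat}) : {ffun 'I_(size (b :: s)) -> nat} :=
  [ffun k => ((k == ord0) + x k)%N].

Let solutions_cons b s l : solutions (b :: s) l =
  [set cons0 b x | x in solutions s l] `|`
  [set incr x | x in solutions (b :: s) (l - b)].
Proof.
apply/seteqP; split => x; last first.
  case=> [[y ys <-]|[y ys <-]]; rewrite /solutions /= big_ord_recl /= !ffunE.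
    rewrite unlift_none mulr0n add0r -[RHS]ys.
    by apply: eq_bigr => k _; rewrite ffunE liftK.
  move: ys; rewrite /solutions /= big_ord_recl /= => /(congr1 (+%R b)).
  rewrite [b + (l - b)]addrC subrK => <-; rewrite mulrS addrA; congr (_ + _ + _).
  by apply: eq_bigr => k _; rewrite ffunE.
move=> xs; case x0 : (x ord0) => [|m].
  left; exists [ffun k => x (lift ord0 k)].
    move: xs; rewrite /solutions /= big_ord_recl x0 mulr0n add0r => <-.
    by apply: eq_bigr => k _; rewrite ffunE.
  apply/ffunP => k; rewrite ffunE; case: unliftP => [j ->|->]; last by rewrite x0.
  by rewrite ffunE.
right; exists [ffun k => (x k - (k == ord0))%N].
  move: xs; rewrite /solutions /= big_ord_recl x0 /= mulrS -addrA => <-.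
  rewrite [X in _ = X]addrC addKr big_ord_recl !ffunE x0 /= subn1 /=.
  by congr (_ + _); apply: eq_bigr => k _; rewrite ffunE subn0.
apply/ffunP => k; rewrite !ffunE; have [->|_] := eqVneq k ord0; last by rewrite subn0.
by rewrite x0 subn1.
Qed.

Let cons0_inj b s : injective (@cons0 b s).
Proof.
move=> x y /ffunP xy; apply/ffunP => k.
by have := xy (lift ord0 k); rewrite !ffunE liftK.
Qed.

Let incr_inj b s : injective (@incr b s).
Proof.
move=> x y /ffunP xy; apply/ffunP => k.
by have := xy k; rewrite !ffunE => /addnI.
Qed.

Definition positive s := forall b, b \in s -> 0 < ht b.

Lemma positive_cons b s : positive (b :: s) -> 0 < ht b /\ positive s.
Proof.
move=> bs; split; first by apply: bs; exact: mem_head.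
by move=> a sa; apply: bs; rewrite inE sa orbT.
Qed.

Let solutions_neg s l : positive s -> ht l < 0 -> solutions s l = set0.
Proof.
move=> s_gt0 l0; apply/seteqP; split=> // x; rewrite /solutions /= => xl.
move: l0; rewrite -xl raddf_sum ltNge sumr_ge0 // => k _.
by rewrite raddfMn mulrn_wge0 // ltW // s_gt0 // mem_nth.
Qed.

(** Descent by steps of [b]: finitely many of them lead to negative height, where equations have no
    solution. *)
Lemma height_ind b (P : W -> Prop) : 0 < ht b -> (forall l, ht l < 0 -> P l) ->
  (forall l, P (l - b) -> P l) -> forall l, P l.
Proof.
move=> b0 Pneg Pstep l.
have [m] : exists m : nat, ht l < m%:R * ht b.
  exists (Num.bound `|ht l / ht b|); rewrite -ltr_pdivrMr //.
  by apply: le_lt_trans (ler_norm _) _; apply: archi_boundP; exact: normr_ge0.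
elim: m l => [|m IH] l lm; first by apply: Pneg; rewrite mul0r in lm.
apply: Pstep; apply: IH; rewrite raddfB /= ltrBlDr.
by rewrite -[X in _ + X]mul1r -mulrDl natr1.
Qed.

Let finite_solutions s l : positive s -> finite_set (solutions s l).
Proof.
elim: s l => [|b s IH] l s0.
  apply: (@sub_finite_set _ _ [set [ffun=> 0%N]]); last exact: finite_set1.
  by move=> x _; apply/ffunP => -[].
have [b0 s_gt0] := positive_cons s0.
move: l; apply: (height_ind b0) => l; first by move=> l0; rewrite solutions_neg.
move=> IHl; rewrite solutions_cons finite_setU; split; apply: finite_image => //.
exact: IH.
Qed.

Lemma count_solutions_nil l : count_solutions [::] l = (l == 0).
Proof.
rewrite /count_solutions; have [->|l0] := eqVneq l 0.
  rewrite (_ : solutions _ _ = [set [ffun=> 0%N]]) ?fset_set1 ?cardfs1 //.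
  apply/seteqP; split=> [x _|x _]; first by apply/ffunP => -[].
  by rewrite /solutions /= big_ord0.
rewrite (_ : solutions _ _ = set0) ?fset_set0 ?cardfs0 //.
apply/seteqP; split=> // x; rewrite /solutions /= big_ord0 => /eqP.
by rewrite eq_sym (negbTE l0).
Qed.

Lemma count_solutions_neg s l : positive s -> ht l < 0 -> count_solutions s l = 0%N.
Proof.
by move=> s0 l0; rewrite /count_solutions solutions_neg // fset_set0 cardfs0.
Qed.

Lemma count_solutions_cons b s l : positive (b :: s) ->
  count_solutions (b :: s) l = (count_solutions (b :: s) (l - b) + count_solutions s l)%N.
Proof.
move=> s0; have [b0 s_gt0] := positive_cons s0.
rewrite /count_solutions {1}solutions_cons.
have fin1 := finite_solutions l s_gt0; have fin2 := finite_solutions (l - b) s0.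
rewrite fset_setU ?cardfsU; [|exact: finite_image..].
rewrite (_ : (_ `&` _)%fset = fset0) ?cardfs0 ?subn0.
  rewrite !fset_set_image // !card_imfset //=; first exact: addnC.
    exact: incr_inj.
  exact: cons0_inj.
apply/fsetP => x; rewrite in_fsetI in_fset0.
rewrite !in_fset_set; [|exact: finite_image..].
apply/negP => /andP[/set_mem[y _ <-] /set_mem[z _ /ffunP/(_ ord0)]].
by rewrite !ffunE unlift_none.
Qed.

Section DifferenceEquations.
Variable K : comNzRingType.
Local Notation cnt l s := ((count_solutions s l)%:R : K).

Lemma count_cons b s l : positive (b :: s) ->
  cnt l (b :: s) - cnt (l - b) (b :: s) = cnt l s.
Proof. by move=> s0; rewrite (count_solutions_cons l s0) natrD addrC addKr. Qed.

Lemma eq_count_cons b s s' : positive (b :: s) -> positive (b :: s') ->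
  (forall l, cnt l s = cnt l s') -> forall l, cnt l (b :: s) = cnt l (b :: s').
Proof.
move=> bs bs' ss'; have [b0 _] := positive_cons bs.
apply: (height_ind b0) => l; first by move=> l0; rewrite !count_solutions_neg.
move=> IH; have := count_cons l bs; rewrite ss' -(count_cons l bs') IH.
by move/addIr.
Qed.

Lemma count_swap a b s : positive [:: a, b & s] ->
  forall l, cnt l [:: a, b & s] = cnt l [:: b, a & s].
Proof.
move=> abs; have [a0 bs] := positive_cons abs; have [b0 s0] := positive_cons bs.
have as_ : positive (a :: s) by move=> z; rewrite inE => /predU1P[->|/s0].
have bas : positive [:: b, a & s] by move=> z; rewrite inE => /predU1P[->|/as_].
apply: (height_ind b0) => l; first by move=> l0; rewrite !count_solutions_neg.
move=> IHb; apply/eqP; rewrite -(inj_eq (addIr (- cnt (l - b) [:: b, a & s]))).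
rewrite count_cons // -IHb; apply/eqP.
apply: (@height_ind a (fun l => cnt l [:: a, b & s] - cnt (l - b) [:: a, b & s] =
  cnt l (a :: s))) => // {IHb}l.
  move=> l0; rewrite !count_solutions_neg ?subrr //.
  by rewrite raddfB /= subr_lt0 (lt_trans l0).
move=> IHa; have eX := count_cons l abs; have eY := count_cons (l - b) abs.
have es := count_cons l as_; rewrite -(count_cons l bs) -eX -eY in es.
rewrite addrAC in IHa; rewrite addrAC -IHa in es.
by rewrite -[RHS](subrK (cnt (l - a) [:: a, b & s] - cnt (l - b - a) [:: a, b & s]))
  es; ring.
Qed.

(** Symmetry follows from the difference equations, since a function that vanishes at negative
    heights is determined by its differences in the direction of one vector. *)
Lemma count_perm s s' l : positive s -> perm_eq s s' -> cnt l s = cnt l s'.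
Proof.
move=> s0 ss'; have s'0 : positive s' by move=> b; rewrite -(perm_mem ss'); exact: s0.
elim: s s' ss' s0 s'0 l => [|b s IH] s' ss' bs0 s'0 l.
  by move: ss'; rewrite perm_sym => /perm_nilP ->.
have [b0 s0] := positive_cons bs0.
have bs' : b \in s' by rewrite -(perm_mem ss') mem_head.
have front t : b \in t -> positive t -> forall l, cnt l t = cnt l (b :: rem b t).
  elim: t => //= a t IHt; rewrite inE => + at0; have [<-//|ab /=] := eqVneq a b.
  move=> bt {}l.
  have [a0 t0] := positive_cons at0.
  have r0 : positive (rem b t) by move=> z /mem_rem; exact: t0.
  have br0 : positive (b :: rem b t) by move=> z; rewrite inE => /predU1P[->|/r0].
  have abr0 : positive [:: a, b & rem b t] by move=> z; rewrite inE => /predU1P[->|/br0].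
  by rewrite (eq_count_cons at0 abr0 (IHt bt t0)) count_swap.
have r0 : positive (rem b s') by move=> z /mem_rem; exact: s'0.
have br0 : positive (b :: rem b s') by move=> z; rewrite inE => /predU1P[->|/r0].
rewrite (front s') //; apply: (eq_count_cons bs0 br0) => l'; apply: IH => //.
by rewrite -(perm_cons b); apply: perm_trans ss' (perm_to_rem bs').
Qed.

(* Both sides satisfy the same difference equation in the direction of each
   element of s and vanish below height 0. *)
Lemma count_euler (f : W -> K) s l : {morph f : x y / x + y} -> positive s ->
  f l * cnt l s = \sum_(b <- s) f b * cnt (l - b) (b :: s).
Proof.
move=> fD; elim: s l => [|a s IH] l s0.
  rewrite big_nil count_solutions_nil; have [->|_] := eqVneq l 0; last by rewrite mulr0.
  by apply: (addrI (f 0 * 1)); rewrite addr0 -mulrDl -fD addr0.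
have [a0 s_gt0] := positive_cons s0.
have pos_cons b : b \in a :: s -> positive [:: b, a & s].
  by move=> bas z; rewrite inE => /predU1P[->|/s0 //]; exact: s0.
move: l; apply: (height_ind a0) => l.
  move=> l0; rewrite count_solutions_neg // mulr0 big_seq big1 // => b bas.
  rewrite count_solutions_neg ?mulr0 //; first exact: pos_cons.
  by rewrite raddfB /= subr_lt0 (lt_trans l0) // s0.
move=> IHa.
suff : f l * cnt l (a :: s) - f (l - a) * cnt (l - a) (a :: s) =
    \sum_(b <- a :: s) f b * cnt (l - b) [:: b, a & s] -
    \sum_(b <- a :: s) f b * cnt (l - a - b) [:: b, a & s].
  by rewrite IHa => /addIr.
have -> : f (l - a) = f l - f a by apply: (addIr (f a)); rewrite -fD !subrK.
rewrite mulrBl opprB addrCA -mulrBr count_cons // -sumrB.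
rewrite (eq_big_seq (fun b => f b * cnt (l - b) (b :: s))); last first.
  move=> b bas; rewrite -mulrBr; congr (_ * _).
  have b0 := s0 b bas.
  have bs : positive (b :: s) by move=> z; rewrite inE => /predU1P[->|/s_gt0].
  have abs_ : positive [:: a, b & s] by move=> z; rewrite inE => /predU1P[->|/bs].
  have cnt_swap := @count_perm [:: b, a & s] [:: a, b & s] _ (pos_cons b bas).
  rewrite !cnt_swap; last 2 first.
  - by apply/permP => p /=; rewrite addnCA.
  - by apply/permP => p /=; rewrite addnCA.
  by rewrite [l - a - b]addrAC count_cons.
by rewrite big_cons IH.
Qed.

End DifferenceEquations.
End Counting.

(** * Lattices and volumes *)

Section VectorTopology.
Import VectorInternalTheory.
Variables (R : realType) (W : vectType R).
Implicit Types (phi : {linear W -> R^o}) (a x y : W).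

Lemma linear_functional_continuous phi : continuous (phi : vtop W -> R).
Proof.
pose g (u : 'rV[R]_(dim W)) : R := \sum_j u 0 j * (phi (r2v (delta_mx 0 j)) : R).
have gE x : phi x = g (v2r x).
  rewrite -{1}[x]v2rK {1}[v2r x]row_sum_delta !linear_sum; apply: eq_bigr => j _.
  by rewrite linearZ [LHS]linearZ.
have -> : (phi : vtop W -> R) = g \o (@v2r R W : vtop W -> _).
  by apply/funext => x; exact: gE.
move=> x; apply: continuous_comp; first exact: initial_continuous.
move: (v2r x); apply: continuous_big => [|j _ u].
  exact: (@pseudometric_normed_Zmodule.add_continuous R R^o).
apply: (@cvgM R _ (nbhs u) _ (fun u : 'rV[R]_(dim W) => u 0 j)); last exact: cvg_cst.
exact: (@coord_continuous R 1 (dim W) 0 j u).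
Qed.

Lemma open_translate a (A : set (vtop W)) : open A -> open ([set x | A (x + a)] : set (vtop W)).
Proof.
case=> B oB <-; exists [set u | B (u + v2r a)] => /=.
  have : continuous (fun u : 'rV[R]_(dim W) => u + v2r a).
    move=> u A' /nbhs_ballP[e e0 eA']; apply/nbhs_ballP; exists e => //= u' [_ uu'].
    apply: eA'; split=> // i j; have := uu' i j.
    by rewrite /ball /= !mxE opprD addrACA subrr addr0.
  by move=> /continuousP/(_ _ oB).
by apply/seteqP; split => x; rewrite /= linearD.
Qed.

Lemma measurable_linear_lt phi (r : R) : measurable ([set x | phi x < r] : set (borel W)).
Proof.
apply: sub_sigma_algebra; have /continuousP phi_cont := @linear_functional_continuous phi.
by apply: (phi_cont [set y | y < r]); exact: open_lt.
Qed.

Lemma measurable_linear_ge phi (r : R) : measurable ([set x | r <= phi x] : set (borel W)).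
Proof.
have -> : [set x | r <= phi x] = ~` [set x | phi x < r].
  by apply/seteqP; split => x /=; rewrite leNgt => /negP.
by apply: measurableC; exact: measurable_linear_lt.
Qed.

Lemma measurable_translate a (A : set (borel W)) : measurable A ->
  measurable ([set x | A (x + a)] : set (borel W)).
Proof.
have : measurable_fun setT ((fun x => x + a) : borel W -> borel W).
  apply: (@measurability _ _ (borel W) (borel W) setT (fun x => x + a : W) (@open (vtop W))) => //.
  move=> _ [B oB <-]; rewrite setTI; apply: sub_sigma_algebra.
  exact: open_translate.
by move=> mf mA; have := mf measurableT A mA; rewrite setTI.
Qed.

End VectorTopology.

(** * Measures of sets that are tiled by translates of each other *)

Section Tiling.
Variables (R : realType) (W : vectType R) (mu : {measure set (borel W) -> \bar R}).
Hypothesis mu_translate : forall (A : set (borel W)) (x : W), measurable A ->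
  mu [set x + a | a in (A : set W)] = mu A.
Implicit Types (A B : set (borel W)) (a x y : W).

Lemma mu_shift A x : measurable A -> mu [set y | A (y + x)] = mu A.
Proof.
move=> mA; rewrite -(mu_translate (- x) mA); congr (mu _).
apply/seteqP; split => [y Ay|_ [y Ay <-]] /=; last by rewrite addrAC addNr add0r.
by exists (y + x) => //; rewrite addrC addrK.
Qed.

(** Each set is cut according to the translation that sends its points into the other one;
    corresponding pieces are translates, and there are countably many. *)
Lemma mu_tile (T : countType) (z : T -> W) A B : measurable A -> measurable B ->
    (forall y, A y -> exists! i, B (y - z i)) ->
    (forall y, B y -> exists! i, A (y + z i)) ->
  mu A = mu B.
Proof.
move=> mA mB AB BA.
(* The pieces are numbered by [pickle], with the empty set at the numbers that code nothing. *)
pose F (n : nat) : set (borel W) :=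
  if @pickle_inv T n is Some i then [set y | A y /\ B (y - z i)] else set0.
pose G (n : nat) : set (borel W) :=
  if @pickle_inv T n is Some i then [set y | B y /\ A (y + z i)] else set0.
have pK (i : T) : @pickle_inv T (choice.pickle i) = Some i by rewrite pickleK_inv.
have pinj m n (i : T) : @pickle_inv T m = Some i -> @pickle_inv T n = Some i -> m = n.
  by move=> mi ni; have := @pickle_invK T m; have := @pickle_invK T n; rewrite /oapp mi ni /= => <- <-.
have mF n : measurable (F n).
  rewrite /F; case: pickle_inv => [i|]; last exact: measurable0.
  by apply: measurableI => //; exact: (measurable_translate (- z i) mB).
have mG n : measurable (G n).
  rewrite /G; case: pickle_inv => [i|]; last exact: measurable0.
  by apply: measurableI => //; exact: (measurable_translate (z i) mA).
have FG n : mu (F n) = mu (G n).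
  rewrite -(mu_shift (if @pickle_inv T n is Some i then z i else 0) (mF n)).
  congr (mu _); rewrite /F /G; case: pickle_inv => [i|//].
  by apply/seteqP; split => y [] /=; rewrite addrK.
have AE : A = \bigcup_n F n.
  apply/seteqP; split => [y Ay|y [n _]]; last first.
    by rewrite /F; case: pickle_inv => [i []|].
  by have [i [Bi _]] := AB y Ay; exists (choice.pickle i) => //; rewrite /F pK.
have BE : B = \bigcup_n G n.
  apply/seteqP; split => [y By|y [n _]]; last first.
    by rewrite /G; case: pickle_inv => [i []|].
  by have [i [Ai _]] := BA y By; exists (choice.pickle i) => //; rewrite /G pK.
rewrite AE BE !measure_bigcup //.
- by apply: eq_eseriesr => n _; exact: FG.
- apply/trivIsetP => m n _ _ mn; apply/seteqP; split => // y [].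
  rewrite /G; case mi: pickle_inv => [i|//] [By Ai]; case nj: pickle_inv => [j|//] [_ Aj].
  have [k [_ uk]] := BA y By; move/eqP: mn; apply.
  by apply: (pinj _ _ i) => //; rewrite nj -(uk i Ai) -(uk j Aj).
- apply/trivIsetP => m n _ _ mn; apply/seteqP; split => // y [].
  rewrite /F; case mi: pickle_inv => [i|//] [Ay Bi]; case nj: pickle_inv => [j|//] [_ Bj].
  have [k [_ uk]] := AB y Ay; move/eqP: mn; apply.
  by apply: (pinj _ _ i) => //; rewrite nj -(uk i Bi) -(uk j Bj).
Qed.

(** [A] is the disjoint union of N pieces, one for each [r i], and each piece is tiled against the
    whole of [B]. *)
Lemma mu_tiles N (r : 'I_N -> W) (T : countType) (z : T -> W) A B :
    measurable A -> measurable B ->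
    (forall y, A y -> exists! p : 'I_N * T, B (y - (r p.1 + z p.2))) ->
    (forall y, B y -> forall i, exists! t, A (y + (r i + z t))) ->
  mu A = (N%:R%:E * mu B)%E.
Proof.
move=> mA mB AB BA.
pose F i : set (borel W) := [set y | A y /\ exists t, B (y - (r i + z t))].
have mF i : measurable (F i).
  have -> : F i = A `&` \bigcup_n (if @pickle_inv T n is Some t
      then [set y | B (y - (r i + z t))] else set0).
    apply/seteqP; split => [y [Ay [t Bt]]|y [Ay [n _]]].
      by split=> //; exists (choice.pickle t) => //; rewrite pickleK_inv.
    by case: pickle_inv => [t Bt|//]; split=> //; exists t.
  apply: measurableI => //; apply: bigcupT_measurable => n.
  by case: pickle_inv => [t|//]; exact: measurable_translate.
have AE : A = \big[setU/set0]_(i < N) F i.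
  rewrite -bigcup_seq; apply/seteqP; split => [y Ay|y [i _] []//].
  have [[i t] [Bt _]] := AB y Ay; exists i; first by rewrite /= mem_index_enum.
  by split=> //; exists t.
rewrite {1}AE measure_bigsetU_ord //; last first.
  apply/trivIsetP => i j _ _ ij; apply/seteqP; split => // y [[Ay [t Bt]] [_ [u Bu]]].
  have [p [_ up]] := AB y Ay; move/eqP: ij; apply.
  by have := up (i, t) Bt; rewrite (up (j, u) Bu) => -[].
rewrite (eq_bigr (fun=> mu B)) => [|i _].
  by rewrite sumr_const card_ord mule_natl.
apply: (mu_tile (z := fun t => r i + z t)) => // y.
  move=> [Ay [t Bt]]; exists t; split=> // u Bu.
  have [p [_ up]] := AB y Ay.
  by have := up (i, t) Bt; rewrite (up (i, u) Bu) => -[].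
move=> By; have [t [At ut]] := BA y By i; exists t; split.
  by split=> //; exists t; rewrite addrK.
by move=> u [Au _]; exact: ut.
Qed.

End Tiling.

(** * Integral spans and integral relations *)

Section Lattices.
Variables (R : realType) (W : vectType R).
Implicit Types (s e : seq W) (a b x y u : W).

Definition Zspan s : set W :=
  [set x | exists z : 'I_(size s) -> int, x = \sum_(i < size s) s`_i *~ z i].

Lemma Zspan_cons a s x : Zspan (a :: s) x <-> exists k : int, Zspan s (x - a *~ k).
Proof.
split=> [[z ->]|[k [z xE]]].
  exists (z ord0), (fun i => z (lift ord0 i)).
  by rewrite big_ord_recl /= addrC addKr.
exists (fun i : 'I_(size (a :: s)) => if unlift ord0 i is Some j then z j else k).
rewrite big_ord_recl unlift_none /= -[x](subrK (a *~ k)) xE addrC.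
by congr (_ + _); apply: eq_bigr => i _; rewrite liftK.
Qed.

Lemma Zspan0 s : Zspan s 0.
Proof. by exists (fun=> 0); rewrite big1 // => i _; rewrite mulr0z. Qed.

Lemma ZspanD s x y : Zspan s x -> Zspan s y -> Zspan s (x + y).
Proof.
move=> [z ->] [z' ->]; exists (fun i => z i + z' i).
by rewrite -big_split; apply: eq_bigr => i _; rewrite mulrzDr.
Qed.

Lemma ZspanN s x : Zspan s x -> Zspan s (- x).
Proof.
move=> [z ->]; exists (fun i => - z i).
by rewrite -sumrN; apply: eq_bigr => i _; rewrite mulrNz.
Qed.

Lemma ZspanB s x y : Zspan s x -> Zspan s y -> Zspan s (x - y).
Proof. by move=> sx sy; apply: ZspanD => //; exact: ZspanN. Qed.

Lemma ZspanMz s x (k : int) : Zspan s x -> Zspan s (x *~ k).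
Proof.
move=> [z ->]; exists (fun i => z i * k).
by rewrite -scaler_int scaler_sumr; apply: eq_bigr => i _; rewrite scaler_int mulrzA.
Qed.

Lemma Zspan_mem s x : x \in s -> Zspan s x.
Proof.
elim: s => // a s IH; rewrite inE => /predU1P[->|/IH sx]; apply/Zspan_cons.
  by exists 1; rewrite mulr1z subrr; exact: Zspan0.
by exists 0; rewrite mulr0z subr0.
Qed.

Lemma Zspan_sum (I : Type) (r : seq I) (P : pred I) (F : I -> W) s :
  (forall i, P i -> Zspan s (F i)) -> Zspan s (\sum_(i <- r | P i) F i).
Proof. by apply: big_ind; [exact: Zspan0 | exact: ZspanD]. Qed.

Lemma Zspan_sub s s' : (forall x, x \in s -> Zspan s' x) -> Zspan s `<=` Zspan s'.
Proof.
move=> ss' x [z ->]; apply: Zspan_sum => i _; apply: ZspanMz; apply: ss'.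
exact: mem_nth.
Qed.

Lemma Zspan_span s x : Zspan s x -> x \in span s.
Proof.
move=> [z ->]; apply: memv_suml => i _; rewrite -scaler_int memvZ //.
exact/memv_span/mem_nth.
Qed.

(** The coordinates on [e] form an integer matrix, whose rows are free over the rationals if and
    only if they are free over the reals. A real dependence thus gives a rational one, whose
    denominators are cleared. *)
Lemma integral_relation_ord e s : free e -> (forall x, x \in s -> Zspan e x) -> ~~ free s ->
  exists2 c : 'I_(size s) -> int, \sum_(i < size s) s`_i *~ c i = 0 &
    exists i, c i != 0.
Proof.
move=> e_free se s_dep; set m := size s.
have zE (i : 'I_m) : {z : 'I_(size e) -> int | s`_i = \sum_(j < size e) e`_j *~ z j}.
  by apply: cid; apply: se; exact: mem_nth.
pose A : 'M[int]_(m, size e) := \matrix_(i, j) sval (zE i) j.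
pose AQ : 'M[rat]_(m, size e) := map_mx intr A.
have sumA (K : pzRingType) (U : lmodType K) (c : 'I_m -> K) (f : 'I_(size e) -> U) :
    \sum_i c i *: (\sum_j f j *~ A i j) = \sum_j (\sum_i c i * (A i j)%:~R) *: f j.
  under eq_bigr do rewrite scaler_sumr.
  rewrite exchange_big; apply: eq_bigr => j _; rewrite scaler_suml.
  by apply: eq_bigr => i _; rewrite -scalerA scaler_int.
have sE (i : 'I_m) : s`_i = \sum_(j < size e) e`_j *~ A i j.
  by rewrite {1}(svalP (zE i)); apply: eq_bigr => j _; rewrite mxE.
have : ~~ row_free AQ.
  rewrite -(row_free_map (ratr : rat -> R)); apply: contra s_dep => Afree.
  apply/(freeP (X := in_tuple s)) => t t0 i.
  have : (\row_i t i) *m map_mx ratr AQ == 0 :> 'rV[R]__.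
    have AE k j : map_mx ratr AQ k j = (A k j)%:~R :> R by rewrite 2!mxE ratr_int.
    apply/eqP/rowP => j; rewrite 2!mxE.
    under eq_bigr do rewrite mxE AE.
    apply: (freeP (X := in_tuple e) e_free (fun j => \sum_i t i * (A i j)%:~R)).
    by rewrite -sumA -[RHS]t0; apply: eq_bigr => k _; rewrite -sE.
  by rewrite mulmx_free_eq0 // => /eqP/rowP/(_ i); rewrite !mxE.
rewrite -kermx_eq0 => /matrix0Pn[i0 [j0 vj0]].
pose v j := kermx AQ i0 j.
have v0 j : \sum_i v i * (A i j)%:~R = 0.
  have /matrixP/(_ i0 j) := mulmx_ker AQ; rewrite 2!mxE => v0; rewrite -[RHS]v0.
  by apply: eq_bigr => i _; rewrite [AQ i j]mxE.
pose c k := numq (v k) * \prod_(l | l != k) denq (v l).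
have cE k : (c k)%:~R = (\prod_l denq (v l))%:~R * v k :> rat.
  by rewrite /c [X in _ = X%:~R * _](bigD1 k) //= !intrM numqE; ring.
exists c; last first.
  exists j0; rewrite -(intr_eq0 rat) cE mulf_neq0 // intr_eq0.
  by apply/prodf_neq0 => l _; exact: denq_neq0.
transitivity (\sum_i ((c i)%:~R : R) *: (\sum_(j < size e) e`_j *~ A i j)).
  by apply: eq_bigr => i _; rewrite -sE scaler_int.
rewrite sumA big1 // => j _; suff -> : \sum_i (c i)%:~R * (A i j)%:~R = 0 :> R.
  by rewrite scale0r.
under eq_bigr do rewrite -intrM.
rewrite -rmorph_sum /=; apply/eqP; rewrite intr_eq0 -(intr_eq0 rat) rmorph_sum /=.
under eq_bigr do rewrite intrM cE -mulrA.
by rewrite -mulr_sumr v0 mulr0.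
Qed.

Lemma integral_relation e s : free e -> uniq s -> (forall x, x \in s -> Zspan e x) ->
  ~~ free s -> exists2 c : W -> int,
    \sum_(b <- s) b *~ c b = 0 & exists2 b, b \in s & c b != 0.
Proof.
move=> e_free us se /(integral_relation_ord e_free se)[c c0 [i ci]].
pose f b := if insub (index b s) is Some j then c j else 0.
have fE (j : 'I_(size s)) : f s`_j = c j.
  by rewrite /f index_uniq // valK.
exists f; last by exists s`_i; rewrite ?mem_nth ?fE.
rewrite (big_nth 0) big_mkord -[RHS]c0; apply: eq_bigr => j _.
by rewrite fE.
Qed.

End Lattices.

Section HalfOpenBoxes.
Variables (R : realType) (W : vectType R).
Implicit Types (s e : seq W) (a b x y u : W).

Definition crd s (i : 'I_(size s)) x : R := coord (in_tuple s) i x.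

Definition hbox s : set W := [set x | forall i, 0 <= crd (s := s) i x < 1].

Section Basis.
Variables (s : seq W) (s_basis : basis_of {:W} s).

Let s_free : free s := basis_free s_basis.

Lemma crdE x : x = \sum_(i < size s) crd i x *: s`_i.
Proof.
rewrite [LHS](@coord_span _ _ _ (in_tuple s)) //.
by rewrite (span_basis s_basis) memvf.
Qed.

Lemma crd_sum (t : 'I_(size s) -> R) i : crd i (\sum_(j < size s) t j *: s`_j) = t i.
Proof. exact: (coord_sum_free (X := in_tuple s)). Qed.

Lemma crdD i x y : crd (s := s) i (x + y) = crd i x + crd i y.
Proof. exact: linearD. Qed.

Lemma crdN i x : crd (s := s) i (- x) = - crd i x.
Proof. exact: linearN. Qed.

Lemma crdZ i (c : R) x : crd (s := s) i (c *: x) = c * crd i x.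
Proof. exact: linearZ. Qed.

Lemma Zspan_crd x : Zspan s x <-> forall i, crd (s := s) i x \is a Num.int.
Proof.
split=> [[z ->] i|xi].
  under eq_bigr do rewrite -scaler_int.
  by rewrite crd_sum intr_int.
exists (fun i => Num.floor (crd i x)); rewrite [LHS]crdE.
by apply: eq_bigr => i _; rewrite -scaler_int (floorK (xi i)).
Qed.

(** Half-open boxes are exact fundamental domains, whereas closed boxes overlap along their faces;
    this is why volumes are first compared on [hbox]. *)
Lemma hbox_floor y : exists! u, Zspan s u /\ hbox s (y - u).
Proof.
exists (\sum_(i < size s) s`_i *~ Num.floor (crd i y)); split.
  split; first by exists (fun i => Num.floor (crd i y)).
  move=> i; rewrite crdD crdN.
  under eq_bigr do rewrite -scaler_int.
  by rewrite crd_sum subr_ge0 ltrBlDl; have := floor_itv (crd i y); rewrite intrD.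
move=> u [u_s yu]; rewrite [RHS]crdE; apply: eq_bigr => i _.
have ui := (Zspan_crd u).1 u_s i; rewrite -scaler_int -[in RHS](floorK ui).
congr (_%:~R *: _); apply: floor_def; rewrite intrD (floorK ui).
by have := yu i; rewrite crdD crdN subr_ge0 ltrBlDl.
Qed.

Lemma measurable_hbox : measurable (hbox s : set (borel W)).
Proof.
have -> : hbox s = \bigcap_(i in [set: 'I_(size s)])
    ([set x | 0 <= crd i x] `&` [set x | crd i x < 1]).
  apply/seteqP; split => [x sx i _|x sx i]; first by have /andP[] := sx i.
  by have [? ?] := sx i I; apply/andP.
apply: fin_bigcap_measurable => // i _; apply: measurableI.
  exact: (measurable_linear_ge (coord (in_tuple s) i)).
exact: (measurable_linear_lt (coord (in_tuple s) i)).
Qed.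

Lemma box_crd x : box s x <-> forall i, 0 <= crd (s := s) i x <= 1.
Proof.
split=> [[t t01 ->] i|x01]; first by rewrite crd_sum.
by exists (fun i => crd i x) => //; exact: crdE.
Qed.

End Basis.

End HalfOpenBoxes.

(** * Indices of lattices as ratios of volumes *)

Section Volumes.
Variables (R : realType) (W : vectType R) (mu : {measure set (borel W) -> \bar R}).
Hypothesis mu_translate : forall (A : set (borel W)) (x : W), measurable A ->
  mu [set x + a | a in (A : set W)] = mu A.
Implicit Types (s e : seq W) (a b x y u : W).

(** [r] lists representatives of the cosets of the lattice of [s] in that of [s'], so N is the
    index; translations by [r i + z t] tile one fundamental domain with N copies of the other. *)
Lemma hbox_index s s' N (r : 'I_N -> W) : basis_of {:W} s -> basis_of {:W} s' ->
    Zspan s `<=` Zspan s' -> (forall i, Zspan s' (r i)) ->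
    (forall y, Zspan s' y -> exists! i, Zspan s (y - r i)) ->
  mu (hbox s) = (N%:R%:E * mu (hbox s'))%E.
Proof.
move=> s_basis s'_basis ss' rs' rE.
pose z (t : {ffun 'I_(size s) -> int}) := \sum_(i < size s) s`_i *~ t i.
have z_s t : Zspan s (z t) by exists t.
have zP u : Zspan s u -> exists t, u = z t.
  by move=> [t ->]; exists [ffun i => t i]; apply: eq_bigr => i _; rewrite ffunE.
have z_inj : injective z.
  move=> t t' tt'; apply/ffunP => i; apply: (@intr_inj R).
  have zE v : z v = \sum_(i < size s) (v i)%:~R *: s`_i.
    by apply: eq_bigr => k _; rewrite scaler_int.
  have crd_z v : crd i (z v) = (v i)%:~R by rewrite zE crd_sum.
  by rewrite -!crd_z tt'.
apply: (mu_tiles mu_translate (r := r) (z := z)).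
- exact: measurable_hbox.
- exact: measurable_hbox.
- move=> y _; have [u [[u_s' yu] uu]] := hbox_floor s'_basis y.
  have [i [ui iu]] := rE u u_s'; have [t ut] := zP _ ui.
  exists (i, t); split=> /=; first by rewrite -ut [r i + _]addrC subrK.
  move=> [j t'] /= yjt; have u' : u = r j + z t'.
    by apply: uu; split=> //; apply: ZspanD => //; apply: ss'.
  have ij : i = j by apply: iu; rewrite u' [r j + _]addrC addrK.
  by congr (_, _) => //; apply: z_inj; rewrite -ut u' -ij [r i + _]addrC addrK.
- move=> y _ i; have [u [[u_s yu] uu]] := hbox_floor s_basis (y + r i).
  have [t ut] := zP _ (ZspanN u_s); exists t; split; first by rewrite -ut addrA.
  move=> t' yt'; apply: z_inj; rewrite -ut; apply/eqP; rewrite eqr_oppLR; apply/eqP.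
  by apply: uu; split; [exact: ZspanN | rewrite opprK -addrA].
Qed.

Lemma basis_cons a s : basis_of {:W} (a :: s) <->
  [/\ a \notin span s, free s & (size s).+1 = \dim {:W}].
Proof.
rewrite /basis_of; split => [/andP[/eqP sT asf]|[as_ sf sn]].
  move: (asf); rewrite free_cons => /andP[-> ->]; split=> //.
  by rewrite -sT; move/eqP: asf => ->.
have asf : free (a :: s) by rewrite free_cons as_ sf.
rewrite asf andbT eqEdim subvf /= -sn.
by move/eqP: asf => ->.
Qed.

Lemma basis_scale a (c : int) s : c != 0 -> basis_of {:W} (a :: s) ->
  basis_of {:W} (a *~ c :: s).
Proof.
move=> c0 /basis_cons[as_ sf sn]; apply/basis_cons; split=> //.
apply: contra as_ => acs; have c0' : c%:~R != 0 :> R by rewrite intr_eq0.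
by rewrite -[a](scalerK c0') memvZ // scaler_int.
Qed.

Lemma hbox_scale a (c : int) s : c != 0 -> basis_of {:W} (a :: s) ->
  mu (hbox (a *~ c :: s)) = (`|c|%N%:R%:E * mu (hbox (a :: s)))%E.
Proof.
move=> c0 as_basis; have cas_basis := basis_scale c0 as_basis.
have [a_s sf _] := (basis_cons a s).1 as_basis.
apply: (hbox_index (r := fun m : 'I_`|c|%N => a *+ m)) => // [|m|y].
- apply: Zspan_sub => x; rewrite inE => /predU1P[->|xs].
    by apply/ZspanMz/Zspan_mem/mem_head.
  by apply: Zspan_mem; rewrite inE xs orbT.
- by apply/(ZspanMz m)/Zspan_mem/mem_head.
move=> /Zspan_cons[k yk].
have kc : (`|(k %% c)%Z| < `|c|)%N.
  by rewrite -ltz_nat gez0_abs ?modz_ge0 // abszE ltz_mod.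
have mE : a *+ `|(k %% c)%Z| = a *~ (k %% c)%Z.
  by rewrite -[in RHS](gez0_abs (modz_ge0 k c0)).
exists (Ordinal kc); split=> /= [|m /Zspan_cons[q ymq]].
  apply/Zspan_cons; exists (k %/ c)%Z; congr (Zspan s _): yk.
  rewrite mE {1}(divz_eq k c) mulrzDr -mulrzA [(c * _)%R]mulrC opprD.
  by rewrite addrA addrAC.
apply: val_inj => /=.
have : Zspan s (a *~ (k - (m%:Z + c * q))).
  congr (Zspan s _): (ZspanB ymq yk).
  rewrite opprB addrCA [X in _ + X]addrAC [_ - y]addrAC subrr add0r.
  by rewrite mulrzBr mulrzDr mulrzA opprD.
move/Zspan_span; have [/eqP|kmq as_ma] := eqVneq (k - (m%:Z + c * q)) 0.
  rewrite subr_eq0 => /eqP -> _; rewrite addrC mulrC modzMDl -modz_abs modz_small //.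
  by rewrite lez_nat leq0n ltz_nat /=; exact: ltn_ord.
have kmq' : (k - (m%:Z + c * q))%:~R != 0 :> R by rewrite intr_eq0.
case/negP: a_s; rewrite -[a](scalerK kmq') memvZ // scaler_int.
exact: as_ma.
Qed.

(** Cramer's rule without determinants: modulo [s] the vectors c a and d b are opposite, so together
    with [s] they span the same lattice. *)
Lemma hbox_exchange a b (c d : int) s : c != 0 -> d != 0 ->
    basis_of {:W} (a :: s) -> basis_of {:W} (b :: s) ->
    Zspan s (a *~ c + b *~ d) ->
  (`|c|%N%:R%:E * mu (hbox (a :: s)) = `|d|%N%:R%:E * mu (hbox (b :: s)))%E.
Proof.
move=> c0 d0 as_basis bs_basis cd; rewrite -!hbox_scale //.
have sub x y : Zspan s (x + y) -> Zspan (x :: s) `<=` Zspan (y :: s).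
  move=> xy; apply: Zspan_sub => u; rewrite inE => /predU1P[->|us].
    by apply/Zspan_cons; exists (-1); rewrite mulrNz mulr1z opprK.
  by apply: Zspan_mem; rewrite inE us orbT.
rewrite (@hbox_index _ (b *~ d :: s) 1 (fun=> 0)) ?mul1e //.
- exact: basis_scale.
- exact: basis_scale.
- exact: sub.
- by move=> _; exact: Zspan0.
- move=> y; rewrite addrC in cd => y_s; exists ord0; split=> [|i _].
    by rewrite subr0; exact: (sub _ _ cd).
  by apply: val_inj; case: i => -[].
Qed.

(** As [M] sends the lattice of [e] into that of [s], each coset has exactly one representative with
    coordinates [j i / M] in [0, 1[. This expression of the index is the one produced by sums of
    characters. *)
Lemma hbox_count e s (M : nat) : (0 < M)%N ->
    basis_of {:W} e -> basis_of {:W} s -> (forall x, x \in s -> Zspan e x) ->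
    (forall x, Zspan e x -> Zspan s (x *+ M)) ->
  mu (hbox s) = (#|[pred j : {ffun 'I_(size s) -> 'I_M} |
    `[< Zspan e (\sum_(i < size s) ((j i)%:R / M%:R : R) *: s`_i) >]]|%:R%:E *
    mu (hbox e))%E.
Proof.
move=> M0 e_basis s_basis se Me; set J := (X in #|X|).
pose p (j : {ffun 'I_(size s) -> 'I_M}) := \sum_(i < size s) ((j i)%:R / M%:R : R) *: s`_i.
have M0' : M%:R != 0 :> R by rewrite pnatr_eq0 -lt0n.
have MZ : M%:Z != 0 by rewrite -[M%:Z != 0]/(M != 0%N) -lt0n.
apply: (hbox_index (r := fun i => p (enum_val i))) => //.
- exact: Zspan_sub.
- by move=> i; apply/asboolP; exact: (enum_valP i).
move=> y y_e; have := Me y y_e => /(Zspan_crd s_basis) yM.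
have cM (i : 'I_(size s)) : crd i (y *+ M) = crd i y * M%:R :> R.
  by rewrite mulr_natr /crd raddfMn.
pose f (i : 'I_(size s)) := Num.floor (crd i (y *+ M)).
have fE i : (f i)%:~R = crd i y * M%:R :> R by rewrite /f (floorK (yM i)) cM.
have fM i : (`|(f i %% M)%Z| < M)%N.
  by rewrite -ltz_nat gez0_abs ?modz_ge0 ?ltz_pmod // -lt0n.
pose j : {ffun 'I_(size s) -> 'I_M} := [ffun i => Ordinal (fM i)].
have crdp (k : {ffun 'I_(size s) -> 'I_M}) i : crd i (p k) = (k i)%:R / M%:R :> R.
  by rewrite /p crd_sum.
have yp k : Zspan s (y - p k) <-> k = j.
  split=> [/(Zspan_crd s_basis) yk|->].
    apply/ffunP => i; apply: val_inj; rewrite ffunE /=.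
    have /intrP[q qE] := yk i; move: qE; rewrite crdD crdN crdp => qE.
    have -> : f i = (k i)%:Z + q * M%:Z.
      apply: (@intr_inj R); rewrite fE intrD intrM -qE /=; field; exact: M0'.
    by rewrite addrC modzMDl modz_small // lez_nat leq0n ltz_nat ltn_ord.
  apply/(Zspan_crd s_basis) => i; rewrite crdD crdN crdp ffunE /=.
  suff -> : crd i y - `|(f i %% M)%Z|%:R / M%:R = (f i %/ M)%Z%:~R by exact: intr_int.
  have -> : crd i y = (f i)%:~R / M%:R by rewrite fE mulfK.
  rewrite -mulrBl -[X in _ - X]/(`|(f i %% M)%Z|%:Z%:~R) gez0_abs ?modz_ge0 //.
  by rewrite {1}(divz_eq (f i) M) intrD addrK intrM mulfK.
have jJ : j \in J.
  suff pj : Zspan e (p j) by apply/asboolP.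
  rewrite -[p j](subKr y); apply: ZspanB => //; apply: (Zspan_sub se).
  exact/yp.
exists (enum_rank_in jJ j); split; first by apply/yp; rewrite enum_rankK_in.
by move=> k /yp kj; apply: enum_val_inj; rewrite enum_rankK_in.
Qed.

Lemma measurable_box s : basis_of {:W} s -> measurable (box s : set (borel W)).
Proof.
move=> s_basis; have -> : box s = \bigcap_(i in [set: 'I_(size s)])
    ([set x | 0 <= crd i x] `&` ~` [set x | - crd i x < - 1]).
  apply/seteqP; split => [x /(box_crd s_basis) sx i _|x sx].
    have /andP[i0 i1] := sx i; split => //=.
    by apply/negP; rewrite ltrN2 -leNgt.
  apply/(box_crd s_basis) => i; have [/= i0 /negP] := sx i I.
  by rewrite ltrN2 -leNgt => i1; apply/andP.
apply: fin_bigcap_measurable => // i _; apply: measurableI.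
  exact: (measurable_linear_ge (coord (in_tuple s) i)).
apply: measurableC.
have -> : [set x | - crd i x < - 1] = [set x | (\- coord (in_tuple s) i) x < -1].
  by [].
exact: measurable_linear_lt.
Qed.

(** The translates of the face by -k/K times the i-th vector, for k < K, are disjoint and lie in the
    box, so K times the measure of the face is bounded independently of K. *)
Lemma face_null s (i : 'I_(size s)) : basis_of {:W} s -> (mu (box s) < +oo)%E ->
  mu (box s `&` [set x | 1 <= crd i x]) = 0%E.
Proof.
move=> s_basis box_fin; set F := _ `&` _.
have mbox := measurable_box s_basis.
have mF : measurable (F : set (borel W)).
  by apply: measurableI => //; exact: (measurable_linear_ge (coord (in_tuple s) i)).
have crd_s k : crd k s`_i = (k == i)%:R :> R.
  by rewrite /crd (@coord_free _ _ _ (in_tuple s) i k (basis_free s_basis)) eq_sym.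
have key K : (K%:R%:E * mu F <= mu (box s))%E.
  pose G (k : 'I_K) : set (borel W) := [set y | F (y + (k%:R / K%:R : R) *: s`_i)].
  have mG k : measurable (G k) by exact: measurable_translate.
  have -> : (K%:R%:E * mu F)%E = (\sum_(k < K) mu (G k))%E.
    rewrite (eq_bigr (fun=> mu F)) => [|k _]; last exact: mu_shift.
    by rewrite sumr_const card_ord mule_natl.
  rewrite -(measure_bigsetU_ord mu xpredT) // ; last first.
    apply/trivIsetP => k l _ _ kl; apply/seteqP; split=> // y [[ky k1] [ly l1]].
    move/eqP: kl; apply; apply: val_inj => /=.
    have K0 : K%:R != 0 :> R by rewrite pnatr_eq0 -lt0n (leq_ltn_trans _ (ltn_ord k)).
    have e1 (m : 'I_K) : F (y + (m%:R / K%:R : R) *: s`_i) -> crd i y = 1 - m%:R / K%:R.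
      move=> [/(box_crd s_basis)/(_ i) /andP[_ m1] /= m2].
      have : crd i (y + (m%:R / K%:R : R) *: s`_i) = 1 by apply/eqP; rewrite eq_le m1.
      by rewrite crdD crdZ crd_s eqxx mulr1 => /(canRL (addrK _)).
    have := e1 k (conj ky k1); rewrite (e1 l (conj ly l1)) => /addrI/oppr_inj.
    move/(congr1 ( *%R^~ K%:R)); rewrite !divfK // => /eqP.
    by rewrite eqr_nat => /eqP ->.
  apply: le_measure; rewrite ?inE //; first exact: bigsetU_measurable.
  rewrite -bigcup_seq => y [k _ [/(box_crd s_basis) ky /= k1]].
  apply/(box_crd s_basis) => j; have := ky j; have := k1.
  rewrite !crdD !crdZ !crd_s eqxx mulr1.
  have /andP[K1 K2] : 0 <= (k%:R / K%:R : R) <= 1.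
    have K0 : 0 < K%:R :> R by rewrite ltr0n (leq_ltn_trans _ (ltn_ord k)).
    by rewrite divr_ge0 ?ler_pdivrMr ?mul1r ?ler_nat ?ler0n //= ltnW.
  have [->|_] := eqVneq j i; rewrite ?mulr1 ?mulr0 => h1 h2; lra.
have F_fin : mu F \is a fin_num.
  rewrite ge0_fin_numE //; apply: le_lt_trans box_fin.
  by have := key 1%N; rewrite mul1e.
apply/eqP; rewrite eq_le measure_ge0 andbT leNgt; apply/negP => F_gt0.
have b_fin : mu (box s) \is a fin_num by rewrite ge0_fin_numE.
have fF0 : 0 < fine (mu F) by rewrite fine_gt0 // F_gt0 ltey_eq F_fin.
have := key (Num.bound (fine (mu (box s)) / fine (mu F))).
rewrite -(fineK F_fin) -(fineK b_fin) -EFinM lee_fin leNgt -ltr_pdivrMr //.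
by rewrite archi_boundP // divr_ge0 // ?ltW // fine_ge0.
Qed.

Lemma box_hbox s : basis_of {:W} s -> (mu (box s) < +oo)%E ->
  mu (box s) = mu (hbox s).
Proof.
move=> s_basis box_fin; pose F i := box s `&` [set x | 1 <= crd (s := s) i x].
have mF i : measurable (F i : set (borel W)).
  apply: measurableI; first exact: measurable_box.
  exact: (measurable_linear_ge (coord (in_tuple s) i)).
have [mU U0] : measurable (\big[setU/set0]_(i < size s) F i : set (borel W)) /\
    mu (\big[setU/set0]_(i < size s) F i) = 0%E.
  apply: (big_ind (fun A : set W => measurable (A : set (borel W)) /\ mu A = 0%E)).
  - by rewrite measure0.
  - move=> A B [mA A0] [mB B0]; split; first exact: measurableU.
    by rewrite measureU0.
  - by move=> i _; split=> //; exact: face_null.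
have -> : box s = hbox s `|` \big[setU/set0]_(i < size s) F i.
  rewrite -bigcup_seq; apply/seteqP; split => x.
    move=> sx; have [x1|x1] := pselect (forall i, crd (s := s) i x < 1).
      left=> i; rewrite x1 andbT; have := (box_crd s_basis x).1 sx i.
      by case/andP.
    have [i xi] : exists i, 1 <= crd (s := s) i x.
      apply: contrapT => xN; apply: x1 => i; rewrite ltNge; apply/negP => xi.
      by apply: xN; exists i.
    by right; exists i => //; rewrite /= mem_index_enum.
  case=> [sx|[i _ []//]]; apply/(box_crd s_basis) => i.
  by have /andP[-> /ltW ->] := sx i.
rewrite measureU0 //; exact: measurable_hbox.
Qed.

End Volumes.

(** * Circuits of cones *)

Section Cones.
Variables (R : realType) (W : vectType R).
Implicit Types (s : seq W) (a b x : W).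

Lemma cone_sum s (f : W -> R) : (forall b, b \in s -> 0 <= f b) ->
  cone s (\sum_(b <- s) f b *: b).
Proof.
move=> f0; exists (fun i => f s`_i) => [i|]; first exact/f0/mem_nth.
by rewrite (big_nth 0) big_mkord.
Qed.

Lemma cone_uniq s x : uniq s -> cone s x ->
  exists2 f : W -> R, forall b, b \in s -> 0 <= f b & x = \sum_(b <- s) f b *: b.
Proof.
move=> us [t t0 xE].
pose f b := if insub (index b s) is Some j then t j else 0.
exists f => [b _|]; first by rewrite /f; case: insub.
rewrite xE [RHS](big_nth 0) big_mkord; apply: eq_bigr => i _.
by rewrite /f index_uniq // valK.
Qed.

Lemma cone_perm s s' x : uniq s -> perm_eq s s' -> cone s x -> cone s' x.
Proof.
move=> us ss' /(cone_uniq us)[f f0 ->]; rewrite (perm_big _ ss').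
by apply: cone_sum => b; rewrite -(perm_mem ss'); exact: f0.
Qed.

Lemma free_sum_inj s (f g : W -> R) : free s ->
  \sum_(b <- s) f b *: b = \sum_(b <- s) g b *: b -> {in s, f =1 g}.
Proof.
move=> s_free; rewrite [LHS](big_nth 0) [RHS](big_nth 0) !big_mkord => fg b bs.
have ib : (index b s < size s)%N by rewrite index_mem.
have := congr1 (coord (in_tuple s) (Ordinal ib)) fg.
by rewrite !(coord_sum_free (X := in_tuple s)) //= nth_index.
Qed.

Lemma cone_free s (f : W -> R) : free s ->
  cone s (\sum_(b <- s) f b *: b) <-> forall b, b \in s -> 0 <= f b.
Proof.
move=> s_free; split=> [|/cone_sum//].
move=> /(cone_uniq (free_uniq s_free))[g g0 fg] b bs.
by rewrite (free_sum_inj s_free fg) // g0.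
Qed.

End Cones.

Lemma seq_argmax (R : realType) (T : eqType) (r : T -> R) (l : seq T) : l != [::] ->
  exists2 a, a \in l & forall b, b \in l -> r b <= r a.
Proof.
elim: l => // a l IH _; have [->|/IH[a' a'l a'max]] := eqVneq l [::].
  by exists a; rewrite ?mem_head // => b; rewrite inE => /eqP ->.
have [aa'|/ltW aa'] := lerP (r a) (r a').
  by exists a' => [|b]; rewrite inE ?a'l ?orbT // => /predU1P[->|/a'max].
exists a => [|b]; rewrite ?mem_head // inE => /predU1P[->//|/a'max bl].
exact: le_trans aa'.
Qed.

(** * Signs along a circuit *)

Section Signs.
Variables (R : realType) (T : eqType) (s : seq T) (us : uniq s) (t : T -> R).
Implicit Type c : T -> R.

(* If [x = sum_b t_b b] and [sum_b c_b b = 0], this says that the coordinates of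
   [x] in the basis obtained by removing [a] are nonnegative. *)
Definition circuit_pos c a := all (fun b => 0 <= t b - t a / c a * c b) s.

Definition generic_ratios c := forall a b, a \in s -> b \in s -> c a != 0 -> c b != 0 ->
  t a / c a = t b / c b -> a = b.

(** The r for which all [t b - r * c b] are nonnegative form an interval. An index [a] with c a > 0
    that satisfies [circuit_pos] gives its upper bound; the lower bound is the largest ratio among
    the indices with c b < 0. *)
Lemma circuit_pos_opp c a : c a > 0 -> a \in s -> circuit_pos c a ->
  (exists2 b, b \in s & c b < 0) ->
  exists2 b, b \in s & (c b < 0) && circuit_pos c b.
Proof.
move=> ca as_ /allP posa [d ds cd].
have [|b] := @seq_argmax R T (fun b => t b / c b) [seq b <- s | c b < 0].
  by apply/eqP => s0; have := in_nil d; rewrite -s0 mem_filter cd ds.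
rewrite mem_filter => /andP[cb bs] bmax; exists b => //; rewrite cb /=.
have ab : t b / c b <= t a / c a.
  by rewrite ler_ndivrMr // -subr_ge0; exact: posa.
apply/allP => e es; rewrite subr_ge0; have := posa e es; rewrite subr_ge0 => e0.
have [ce|ce|ce] := ltrgtP (c e) 0.
- by rewrite -ler_ndivrMr //; apply: bmax; rewrite mem_filter ce.
- by apply: le_trans e0; rewrite ler_wpM2r // ltW.
- by move: e0; rewrite ce !mulr0.
Qed.

(** Two indices of the same sign give the same bound of the interval, hence have equal ratios. *)
Lemma circuit_pos_inj c a b : generic_ratios c -> a \in s -> b \in s ->
  0 < c a * c b -> circuit_pos c a -> circuit_pos c b -> a = b.
Proof.
move=> gen as_ bs cab /allP/(_ b bs) + /allP/(_ a as_).
rewrite !subr_ge0 => h1 h2.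
have ca0 : c a != 0 by apply: contraTneq cab => ->; rewrite mul0r ltxx.
have cb0 : c b != 0 by apply: contraTneq cab => ->; rewrite mulr0 ltxx.
apply: gen => //; apply/eqP; rewrite eq_le.
have [ca|ca|ca] := ltrgtP (c a) 0; last by rewrite ca eqxx in ca0.
  have cb : c b < 0 by rewrite -(nmulr_rgt0 _ ca).
  by apply/andP; split; rewrite ler_ndivrMr.
have cb : 0 < c b by rewrite -(pmulr_rgt0 _ ca).
by apply/andP; split; rewrite ler_pdivlMr.
Qed.


(** Either no index contributes, or exactly two do, one for each bound of the interval, with
    opposite signs. *)
Lemma circuit_sign_sum c : generic_ratios c ->
    (exists2 b, b \in s & 0 < c b) -> (exists2 b, b \in s & c b < 0) ->
  \sum_(b <- s) Num.sg (c b) * (circuit_pos c b)%:R = 0.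
Proof.
move=> gen pos neg.
have cN a b : - c a / - c b = c a / c b by rewrite invrN mulrNN.
have circuit_posN a : circuit_pos (fun b => - c b) a = circuit_pos c a.
  by apply: eq_all => b /=; rewrite invrN !(mulrN, mulNr) opprK.
have [/hasP[a as_ /andP[ca posa]]|/hasPn none] :=
    boolP (has (fun b => (0 < c b) && circuit_pos c b) s); last first.
  rewrite big_seq big1 // => b bs.
  have [posb|] := boolP (circuit_pos c b); last by rewrite mulr0.
  have := none b bs; rewrite posb andbT -leNgt le_eqVlt => /predU1P[->|cb'].
    by rewrite sgr0 mul0r.
  have [] := @circuit_pos_opp (fun b => - c b) b _ bs.
  - by rewrite oppr_gt0.
  - by rewrite circuit_posN.
  - by case: pos => d ds cd; exists d; rewrite // oppr_lt0.
  move=> d ds; rewrite oppr_lt0 circuit_posN => posd.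
  by have := none d ds; rewrite posd.
have [d ds /andP[cd posd]] := circuit_pos_opp ca as_ posa neg.
have ad : a != d by apply: contraTneq ca => ->; rewrite -leNgt ltW.
have sum1 e : e \in s -> \sum_(b <- s) (b == e)%:R = 1 :> R.
  by move=> es; rewrite (bigD1_seq e) //= eqxx big1 ?addr0 // => b /negbTE ->.
rewrite (eq_big_seq (fun b => (b == a)%:R - (b == d)%:R)) => [|b bs].
  by rewrite sumrB !sum1 // subrr.
have [->|ba] := eqVneq b a; first by rewrite (negbTE ad) gtr0_sg // posa mul1r subr0.
have [->|bd] := eqVneq b d; first by rewrite ltr0_sg // posd mulr1 add0r.
rewrite subrr; have [posb|] := boolP (circuit_pos c b); last by rewrite mulr0.
have [cb|cb|->] := ltrgtP (c b) 0; last by rewrite sgr0 mul0r.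
  by case/eqP: bd; apply: circuit_pos_inj gen _ _ _ _ _; rewrite // nmulr_rgt0.
by case/eqP: ba; apply: circuit_pos_inj gen _ _ _ _ _; rewrite // pmulr_rgt0.
Qed.

End Signs.

Lemma mem_rem_neq (T : eqType) (a b : T) s : b != a -> (b \in rem a s) = (b \in s).
Proof.
move=> ba; elim: s => //= d s IH; have [->|da] := eqVneq d a.
  by rewrite inE (negbTE ba).
by rewrite !inE IH.
Qed.

(** * Normalized volumes and the weight of a generic point *)

Section LatticeVolume.
Variables (R : realType) (W : vectType R) (L : set W) (e : seq W).
Variable mu : {measure set (borel W) -> \bar R}.
Hypotheses (eL : Zbasis L e) (mu_vol : is_lattice_volume L mu).
Implicit Types (s : seq W) (a b x y u : W).

Let e_basis : basis_of {:W} e. Proof. by case: eL. Qed.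

Let LE : L = Zspan e. Proof. by case: eL. Qed.

Let mu_translate (A : set (borel W)) (x : W) : measurable A ->
  mu [set x + a | a in (A : set W)] = mu A.
Proof. by case: mu_vol => h _; exact: h. Qed.

Let mu_hbox_e : mu (hbox e) = 1%E.
Proof.
have mu_e : mu (box e) = 1%E by case: mu_vol => _ h; exact: h.
by rewrite -(box_hbox mu_translate) // mu_e ltry.
Qed.

(** Each generator of [L] satisfies an integral relation with [s], where its own coefficient is
    nonzero because [s] is free; the product of these coefficients, up to sign, works for all
    generators. *)
Lemma lattice_multiple s : basis_of {:W} s -> (forall b, b \in s -> L b) ->
  exists2 M, (0 < M)%N & forall x, L x -> Zspan s (x *+ M).
Proof.
move=> s_basis sL.
have mult1 a : L a -> exists2 M, (0 < M)%N & Zspan s (a *+ M).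
  move=> La; have [||c c0 [i ci]] := @integral_relation_ord _ _ e (a :: s) (basis_free e_basis).
  - by move=> b; rewrite -LE inE => /predU1P[->|/sL].
  - by rewrite free_cons negb_and negbK (span_basis s_basis) memvf.
  rewrite big_ord_recl /= in c0.
  have c00 : c ord0 != 0.
    apply: contra_neq ci => c00; case: (unliftP ord0 i) => [j ->|->//].
    rewrite c00 mulr0z add0r in c0.
    have /(freeP (X := in_tuple s)) s_free := basis_free s_basis.
    apply: (@intr_inj R); apply: (s_free (fun j => (c (lift ord0 j))%:~R)).
    by rewrite -[RHS]c0; apply: eq_bigr => k _; rewrite scaler_int.
  exists `|c ord0|%N; first by rewrite absz_gt0.
  have : Zspan s (a *~ c ord0).
    move/eqP: c0; rewrite addr_eq0 => /eqP ->; apply: ZspanN.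
    by exists (fun j => c (lift ord0 j)).
  case: (intP (c ord0)) => [|k|k] //; rewrite ?mulr0z // => /ZspanN.
  by rewrite mulrNz opprK abszN.
have [M M0 MP] : exists2 M : 'I_(size e) -> nat, forall i, (0 < M i)%N &
    forall i : 'I_(size e), Zspan s (e`_i *+ M i).
  have /choice[M MP] : forall i : 'I_(size e), exists M, (0 < M)%N /\ Zspan s (e`_i *+ M).
    move=> i; have [|M M0 Ms] := mult1 e`_i; last by exists M.
    by rewrite LE; apply/Zspan_mem/mem_nth.
  by exists M => i; case: (MP i).
exists (\prod_i M i)%N; first exact: prodn_gt0.
move=> x; rewrite LE => -[z ->]; rewrite -sumrMnl; apply: Zspan_sum => i _.
have -> : e`_i *~ z i *+ (\prod_j M j) = (e`_i *+ M i) *~ (z i * (\prod_(j | j != i) M j)%N%:Z).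
  rewrite (bigD1 i) //= -[LHS]scaler_nat -[_ *~ z i]scaler_int -[RHS]scaler_int.
  rewrite -[e`_i *+ M i]scaler_nat !scalerA; congr (_ *: _).
  by rewrite natrM intrM /=; ring.
exact: ZspanMz.
Qed.

Definition vol s : R := fine (mu (box s)).

Lemma vol_perm s s' : perm_eq s s' -> vol s = vol s'.
Proof.
move=> ss'; congr (fine (mu _)); apply/seteqP; split=> y; apply: box_perm => //.
by rewrite perm_sym.
Qed.

(** Finitely many translates of the half-open box cover the closed one. Finiteness matters because
    [fine] in [vol] would send an infinite measure to 0. *)
Lemma mu_box_fin s : basis_of {:W} s -> (mu (hbox s) < +oo)%E -> (mu (box s) < +oo)%E.
Proof.
move=> s_basis hs; pose z (f : {ffun 'I_(size s) -> bool}) := \sum_i ((f i)%:R : R) *: s`_i.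
pose A f : set (borel W) := [set y | hbox s (y + - z f)].
have mA f : measurable (A f) by apply: measurable_translate; exact: measurable_hbox.
apply: (@le_lt_trans _ _ (\sum_(f \in [set: {ffun 'I_(size s) -> bool}]) mu (A f))%E).
  have mB := measurable_box s_basis.
  apply: content_sub_fsum => //; first exact: finite_finset.
  move=> y ys; exists [ffun i => crd i y == 1] => // i; rewrite crdD crdN crd_sum //.
  rewrite ffunE; have /(box_crd s_basis)/(_ i) /andP[i0 i1] := ys.
  have [->|i1'] := eqVneq; first by rewrite subrr lexx ltr01.
  by rewrite subr0 i0 lt_neqAle i1' i1.
rewrite fsbig_finite //=; apply: lte_sum_pinfty => f _.
by rewrite (mu_shift mu_translate) //; exact: measurable_hbox.
Qed.

Lemma vol_index s M : (0 < M)%N -> basis_of {:W} s -> (forall b, b \in s -> L b) ->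
    (forall x, L x -> Zspan s (x *+ M)) ->
  vol s = #|[pred j : {ffun 'I_(size s) -> 'I_M} |
    `[< L (\sum_(i < size s) ((j i)%:R / M%:R : R) *: s`_i) >]]|%:R.
Proof.
rewrite LE => M0 s_basis sL Ms.
have hs := hbox_count mu_translate M0 e_basis s_basis sL Ms.
rewrite mu_hbox_e mule1 in hs.
by rewrite /vol (box_hbox mu_translate) ?hs //; apply: mu_box_fin; rewrite // hs ltry.
Qed.

Lemma mu_hbox s : basis_of {:W} s -> (forall b, b \in s -> L b) ->
  mu (hbox s) = (vol s)%:E.
Proof.
move=> s_basis sL; have [M M0 Ms] := lattice_multiple s_basis sL.
rewrite LE in sL Ms.
have := hbox_count mu_translate M0 e_basis s_basis sL Ms.
rewrite mu_hbox_e mule1 => hs.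
have b_fin : (mu (box s) < +oo)%E by apply: mu_box_fin; rewrite // hs ltry.
by rewrite /vol (box_hbox mu_translate) // hs.
Qed.

Lemma vol_gt0 s : basis_of {:W} s -> (forall b, b \in s -> L b) -> 0 < vol s.
Proof.
move=> s_basis sL; have [M M0 Ms] := lattice_multiple s_basis sL.
rewrite (vol_index M0 s_basis sL Ms) ltr0n; apply/card_gt0P.
exists [ffun=> Ordinal M0]; apply/asboolP; rewrite LE.
rewrite big1 => [|i _]; first exact: Zspan0.
by rewrite ffunE mul0r scale0r.
Qed.

Lemma vol_exchange a b (c d : int) s : c != 0 -> d != 0 ->
    basis_of {:W} (a :: s) -> basis_of {:W} (b :: s) ->
    (forall u, u \in [:: a, b & s] -> L u) -> Zspan s (a *~ c + b *~ d) ->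
  `|c|%:~R * vol (a :: s) = `|d|%:~R * vol (b :: s).
Proof.
move=> c0 d0 as_basis bs_basis sL cd.
have := hbox_exchange mu_translate c0 d0 as_basis bs_basis cd.
rewrite !mu_hbox //.
- by rewrite -!EFinM => -[]; rewrite !natr_absz.
- by move=> u us; apply: sL; rewrite inE us orbT.
- move=> u; rewrite inE => /predU1P[->|us]; apply: sL; rewrite !inE ?eqxx //.
  by rewrite us !orbT.
Qed.

Section Weight.
Variables (ok : W -> Prop) (ht : {additive W -> R}) (x : W).
Hypotheses (ok_L : forall b, ok b -> L b) (ok_gt0 : forall b, ok b -> 0 < ht b).
Hypothesis x_generic : forall s, (forall b, b \in s -> ok b) ->
  (size s < \dim {:W})%N -> x \notin span s.

(** For bases drawn from [Phi] and [x] in the chamber, the value of the Jeffrey-Kirwan functional on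
    f_s. *)
Definition weight s : R :=
  if basis_of {:W} s && `[< cone s x >] then (vol s)^-1 else 0.

Lemma weight_nonspanning s : span s <> fullv -> weight s = 0.
Proof.
by rewrite /weight; case: ifP => // /andP[/span_basis].
Qed.

Lemma weight_perm s s' : perm_eq s s' -> weight s = weight s'.
Proof.
move=> ss'; rewrite /weight -(perm_basis _ ss') (vol_perm ss').
have [sb|//] := boolP (basis_of _ _); congr (if _ then _ else _).
have us := free_uniq (basis_free sb).
apply/asboolP/asboolP; apply: cone_perm => //; first by rewrite -(perm_uniq ss').
by rewrite perm_sym.
Qed.

Lemma basis_span_size s : basis_of {:W} s <-> span s = fullv /\ size s = \dim {:W}.
Proof.
split=> [sb|[sT sn]]; first by split; [exact: span_basis | exact/esym/(size_basis (X := in_tuple s))].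
by rewrite /basis_of /free sT sn !eqxx.
Qed.

Lemma rem_basis s (c : W -> R) a : span s = fullv -> size s = (\dim {:W}).+1 ->
    \sum_(b <- s) c b *: b = 0 -> a \in s -> c a != 0 ->
  basis_of {:W} (rem a s).
Proof.
move=> sT sn c0 as_ ca; apply/basis_span_size; rewrite size_rem // sn; split=> //.
apply/eqP; rewrite eqEsubv subvf -sT; apply/span_subvP => b bs.
have [->|ba] := eqVneq b a; last by apply: memv_span; rewrite mem_rem_neq.
move: c0; rewrite (big_rem a) //= => /eqP; rewrite addr_eq0 => /eqP ca_a.
set y := rem a s; have -> : a = (c a)^-1 *: - \sum_(d <- y) c d *: d by rewrite -ca_a scalerK.
rewrite memvZ // memvN big_seq memv_suml // => d ds.
by rewrite memvZ // memv_span.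
Qed.

Lemma basis_sum s y : basis_of {:W} s -> exists f : W -> R, y = \sum_(b <- s) f b *: b.
Proof.
move=> sb; exists (fun b => if insub (index b s) is Some i then crd (s := s) i y else 0).
rewrite {1}(crdE sb y) [RHS](big_nth 0) big_mkord; apply: eq_bigr => i _.
by rewrite index_uniq ?(free_uniq (basis_free sb)) // valK.
Qed.

(** By [vol_exchange], |c b| / vol (rem b s) is the same number [kappa] for all b with c b nonzero;
    up to this factor the sum is the one of [circuit_sign_sum]. *)
Lemma weight_integral_circuit s (c : W -> int) :
    (forall b, b \in s -> ok b) -> size s = (\dim {:W}).+1 -> uniq s ->
    span s = fullv -> \sum_(b <- s) b *~ c b = 0 -> (exists2 b, b \in s & c b != 0) ->
  \sum_(b <- s) (c b)%:~R * weight (rem b s) = 0.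
Proof.
move=> s_ok sn us sT c0 [a as_ ca].
pose cR b : R := (c b)%:~R.
have cR0 b : (cR b == 0) = (c b == 0) by rewrite intr_eq0.
have c0R : \sum_(b <- s) cR b *: b = 0.
  by rewrite -[RHS]c0; apply: eq_bigr => b _; rewrite scaler_int.
have rem_bas b : b \in s -> c b != 0 -> basis_of {:W} (rem b s).
  by move=> bs cb; apply: rem_basis c0R bs _; rewrite ?cR0.
have rem_sub b d : d \in rem b s -> d \in s by exact: mem_rem.
have sL b : b \in s -> L b by move=> bs; exact/ok_L/s_ok.
pose kappa := `|cR a| / vol (rem a s).
have kappaE b : b \in s -> c b != 0 -> `|cR b| / vol (rem b s) = kappa.
  move=> bs cb; have [->//|ba] := eqVneq b a.
  have [vb va] : vol (rem b s) != 0 /\ vol (rem a s) != 0.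
    by split; rewrite gt_eqF // vol_gt0 ?rem_bas // => d /mem_rem/sL.
  have bs' : b \in rem a s by rewrite mem_rem_neq.
  have as' : a \in rem b s by rewrite mem_rem_neq // eq_sym.
  have pa := perm_to_rem as'; have pb := perm_to_rem bs'.
  rewrite rem_rem in pa.
  have := @vol_exchange b a (c b) (c a) (rem b (rem a s)) cb ca.
  rewrite -(perm_basis _ pb) -(perm_basis _ pa) !rem_bas //.
  rewrite -(vol_perm pb) -(vol_perm pa) => E.
  rewrite /kappa; apply/eqP; rewrite eqr_div //; apply/eqP; rewrite /cR -!intr_norm.
  apply: E => // [d|].
    rewrite !inE => /or3P[/eqP ->|/eqP ->|/mem_rem/mem_rem]; exact: sL.
  move: c0; rewrite (big_rem a) //= (big_rem b) //= addrA => /eqP.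
  rewrite addr_eq0 [a *~ _ + _]addrC => /eqP ->; apply: ZspanN.
  rewrite rem_rem big_seq; apply: Zspan_sum => d ds.
  exact/ZspanMz/Zspan_mem.
have [t xE] : exists t : W -> R, x = \sum_(b <- s) t b *: b.
  have [f xf] := basis_sum x (rem_bas a as_ ca).
  exists (fun b => if b == a then 0 else f b).
  rewrite (big_rem a) //= eqxx scale0r add0r xf; apply: eq_big_seq => b.
  by rewrite mem_rem_uniq // inE => /andP[/negbTE ->].
have remE r : x = \sum_(d <- s) (t d - r * cR d) *: d.
  rewrite xE; under [RHS]eq_bigr do rewrite scalerBl -scalerA.
  by rewrite sumrB -scaler_sumr c0R scaler0 subr0.
have tK b : c b != 0 -> t b - t b / cR b * cR b = 0.
  by move=> cb; rewrite divfK ?cR0 // subrr.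
(* Equal ratios at two indices would cancel two coordinates of [x] at once and put it in the span of
   n - 1 vectors. *)
have gen : generic_ratios s t cR.
  move=> b d bs ds cb cd tbd; apply: contrapT => /eqP bd.
  have ds' : d \in rem b s by rewrite mem_rem_neq // eq_sym.
  have /negP[] : x \notin span (rem d (rem b s)).
    apply: x_generic => [u /mem_rem/mem_rem/s_ok//|].
    have := size_rem ds'; rewrite (size_rem bs) sn /= => ->.
    by rewrite ltn_predL -[\dim _]/((\dim {:W}).+1.-1) -sn -(size_rem bs); case: (rem b s) ds'.
  rewrite (remE (t b / cR b)) (big_rem b) //= (big_rem d) //=.
  rewrite tK -?cR0 // scale0r add0r tbd tK -?cR0 // scale0r add0r.
  rewrite big_seq memv_suml // => u us'.
  by rewrite memvZ // memv_span.
(* Since heights are positive, a nontrivial relation has coefficients of both signs. *)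
have sgn (f : W -> int) : \sum_(b <- s) b *~ f b = 0 ->
    (exists2 b, b \in s & f b != 0) -> exists2 b, b \in s & 0 < f b.
  move=> f0 [b bs fb]; apply: contrapT => fN.
  have f_le d : d \in s -> f d <= 0.
    by move=> ds; rewrite leNgt; apply/negP => fd; apply: fN; exists d.
  have : \sum_(d <- s | d \in s) ht d * (- f d)%:~R = 0.
    rewrite -big_seq; transitivity (- ht (\sum_(b <- s) b *~ f b)).
      rewrite raddf_sum -sumrN; apply: eq_bigr => d _.
      by rewrite raddfMz intrN mulrN mulrzr.
    by rewrite f0 raddf0 oppr0.
  move/eqP; rewrite psumr_eq0 => [/allP/(_ b bs)/=|d ds].
    rewrite bs mulf_eq0 intr_eq0 oppr_eq0 (negbTE fb) orbF.
    by rewrite gt_eqF //; exact/ok_gt0/s_ok.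
  by rewrite mulr_ge0 ?ler0z ?oppr_ge0 ?f_le //; exact/ltW/ok_gt0/s_ok.
have sum0 : \sum_(b <- s) Num.sg (cR b) * (circuit_pos s t cR b)%:R = 0.
  apply: circuit_sign_sum => //.
    by have [|b bs cb] := sgn c c0; [exists a | exists b; rewrite // ltr0z].
  have [||b bs cb] := sgn (fun b => - c b).
  - by rewrite -[RHS]oppr0 -[X in _ = - X]c0 -sumrN; apply: eq_bigr => b _; rewrite mulrNz.
  - by exists a; rewrite // oppr_eq0.
  by exists b; rewrite // ltrz0 -oppr_gt0.
rewrite -[RHS](mulr0 kappa) -[in RHS]sum0 mulr_sumr; apply: eq_big_seq => b bs.
have [cb|cb] := eqVneq (c b) 0; first by rewrite /cR cb sgr0 !(mul0r, mulr0).
rewrite /weight rem_bas //=.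
have -> : `[< cone (rem b s) x >] = circuit_pos s t cR b.
  have xb := remE (t b / cR b).
  rewrite (big_rem b) //= tK // scale0r add0r in xb.
  rewrite xb; apply/asboolP/allP => [/cone_free h d ds|h].
    have [->|db] := eqVneq d b; first by rewrite tK.
    by apply: h; [exact: basis_free (rem_bas _ _ _) | rewrite mem_rem_neq].
  by apply: cone_sum => d /mem_rem/h.
case: ifP => _; last by rewrite !mulr0.
by rewrite mulr1 -(kappaE b) // mulrAC -/(cR b) -(mulrC (Num.sg _)) -numEsg.
Qed.

(** The relations of a spanning list of n + 1 distinct vectors form a line, generated by an integral
    one. If a vector is repeated, the distinct ones are free and [c] vanishes on them. *)
Lemma weight_circuit s (c : W -> R) :
    (forall b, b \in s -> ok b) -> size s = (\dim {:W}).+1 ->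
    \sum_(b <- undup s) c b *: b = 0 ->
  \sum_(b <- undup s) c b * weight (rem b s) = 0.
Proof.
move=> s_ok sn c0; have [sT|sNT] := pselect (span s = fullv); last first.
  apply: big1 => b _; rewrite weight_nonspanning ?mulr0 // => rT; apply: sNT.
  by apply/eqP; rewrite eqEsubv subvf -rT; apply/sub_span => d /mem_rem.
have uT : span (undup s) = fullv.
  by rewrite -sT; apply: eq_span => b; rewrite mem_undup.
have [us|us] := boolP (uniq s); last first.
  have u_free : free (undup s).
    rewrite /free eqn_leq dim_span uT -ltnS -sn andTb.
    by rewrite ltnNge -ltnS -ltnNge ltnS ltn_size_undup.
  rewrite big_seq big1 // => b bs.
  by rewrite (@free_sum_inj _ _ _ c (fun=> 0) u_free) ?mul0r // c0 big1 // => d _; rewrite scale0r.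
rewrite undup_id // in c0 *.
have [b bs||f f0 [a as_ fa]] := @integral_relation _ _ e s (basis_free e_basis) us.
- by rewrite -LE; exact/ok_L/s_ok.
- by rewrite /free sT sn ltn_eqF.
have faR : (f a)%:~R != 0 :> R by rewrite intr_eq0.
have fR0 : \sum_(b <- s) ((f b)%:~R : R) *: b = 0.
  by rewrite -[RHS]f0; apply: eq_bigr => b _; rewrite scaler_int.
pose r := c a / (f a)%:~R.
have cE b : b \in s -> c b = r * (f b)%:~R.
  move=> bs; have [->|ba] := eqVneq b a; first by rewrite /r divfK.
  have a_free := basis_free (rem_basis sT sn fR0 as_ faR).
  apply/eqP; rewrite -subr_eq0; apply/eqP.
  apply: (@free_sum_inj _ _ _ (fun b => c b - r * (f b)%:~R) (fun=> 0) a_free); last first.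
    by rewrite mem_rem_neq.
  rewrite [RHS]big1 => [|d _]; last exact: scale0r.
  have : \sum_(b <- s) (c b - r * (f b)%:~R) *: b = 0.
    under eq_bigr do rewrite scalerBl -scalerA.
    by rewrite sumrB -scaler_sumr fR0 c0 scaler0 subrr.
  by rewrite (big_rem a) //= /r divfK // subrr scale0r add0r.
rewrite -[RHS](mulr0 r) -[in RHS](weight_integral_circuit s_ok sn us sT f0); last by exists a.
by rewrite mulr_sumr; apply: eq_big_seq => b bs; rewrite cE // mulrA.
Qed.

End Weight.
End LatticeVolume.

(** * Torsion points *)

Section Exponential.
Local Open Scope complex_scope.
Variable R : realType.
Local Notation C := R[i].
Implicit Types z w : C.

Lemma cexp0 : cexp (0 : C) = 1.
Proof. by rewrite /cexp /= expR0 cos0 sin0 mul1r. Qed.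

Lemma cexpD z w : cexp (z + w) = cexp z * cexp w.
Proof.
case: z w => [a b] [c d]; rewrite /cexp /= expRD cosD sinD.
by apply/eqP; rewrite eq_complex /=; apply/andP; split; apply/eqP; ring.
Qed.

Lemma cexp_neq0 z : cexp z != 0.
Proof.
apply/eqP => z0; have := cexpD z (- z).
by rewrite z0 mul0r subrr cexp0 => /eqP; rewrite oner_eq0.
Qed.

Lemma cexpN z : cexp (- z) = (cexp z)^-1.
Proof.
apply: (mulfI (cexp_neq0 z)); rewrite -cexpD subrr cexp0 divff //.
exact: cexp_neq0.
Qed.

Definition zeta (r : R) : C := cexp (0 +i* (2 * pi * r)).

Lemma zetaD r t : zeta (r + t) = zeta r * zeta t.
Proof.
rewrite -cexpD; congr cexp; apply/eqP; rewrite eq_complex /= addr0 eqxx.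
by rewrite mulrDr eqxx.
Qed.

Lemma zeta0 : zeta 0 = 1.
Proof. by rewrite /zeta mulr0 cexp0. Qed.

Lemma zetaN r : zeta (- r) = (zeta r)^-1.
Proof.
apply: (@mulfI _ (zeta r)); first exact: cexp_neq0.
by rewrite -zetaD subrr zeta0 divff // cexp_neq0.
Qed.

Lemma zeta_sum (I : Type) (s : seq I) (f : I -> R) :
  zeta (\sum_(i <- s) f i) = \prod_(i <- s) zeta (f i).
Proof. exact: (big_morph _ zetaD zeta0). Qed.

Lemma zetaMn r k : zeta (r *+ k) = zeta r ^+ k.
Proof. by elim: k => [|k IH]; rewrite ?zeta0 // mulrS exprS zetaD IH. Qed.

Lemma zeta1 : zeta 1 = 1.
Proof.
rewrite /zeta /cexp /= expR0 mulr1 mulr_natl cos2pi sin2pi mul1r.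
by apply/eqP; rewrite eq_complex /= !eqxx.
Qed.

Lemma zeta_eq1 r : zeta r = 1 <-> r \is a Num.int.
Proof.
have zeta_int (k : int) : zeta k%:~R = 1.
  case: (intP k) => [|j|j]; first by rewrite zeta0.
    by rewrite -[_%:~R]/(1 *+ j.+1) zetaMn zeta1 expr1n.
  by rewrite intrN zetaN -[_%:~R]/(1 *+ j.+1) zetaMn zeta1 expr1n invr1.
split=> [|/intrP[k ->]]; last exact: zeta_int.
have r_fl : zeta r = zeta (r - (Num.floor r)%:~R) by rewrite zetaD zetaN zeta_int invr1 mulr1.
have := floor_itv r; rewrite r_fl intrD => /andP[r0 r1].
have {r0} r0 : 0 <= r - (Num.floor r)%:~R by rewrite subr_ge0.
have {r1} r1 : r - (Num.floor r)%:~R < 1 by rewrite ltrBlDl.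
move=> /(congr1 (@complex.Re _)); set f := _ - _ in r0 r1 *.
have [f0 _|f0] := eqVneq f 0.
  by move/eqP: f0; rewrite subr_eq0 => /eqP ->; exact: intr_int.
(* For the fractional part f, cos (2 pi f) = 1 forces sin (pi f) = 0, which is impossible when 0 < f
   < 1. *)
rewrite /zeta /cexp /= expR0 mul0r subr0 mul1r.
rewrite (_ : 2 * pi * f = (pi * f) *+ 2) ?cos_mulr2n; last by rewrite -[RHS]mulr_natl mulrA.
rewrite cos2sin2 => h; have s0 : sin (pi * f) ^+ 2 = 0 by lra.
have : 0 < sin (pi * f).
  apply: sin_gt0_pi; rewrite mulr_gt0 ?pi_gt0 //=; last by rewrite lt0r f0.
  by rewrite gtr_pMr ?pi_gt0.
by move/eqP: s0; rewrite expf_eq0 /= => /eqP ->; rewrite ltxx.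
Qed.

Lemma cexp_eq1 z : cexp z = 1 ->
  complex.Re z = 0 /\ complex.Im z / (2 * pi) \is a Num.int.
Proof.
case: z => a b /= z1; have a0 : a = 0.
  (* The squared modulus of the exponential is e^(2a). *)
  have := congr1 (fun w : C => complex.Re w ^+ 2 + complex.Im w ^+ 2) z1.
  rewrite /cexp /= !(mul0r, subr0, addr0, expr0n, expr1n) /=.
  rewrite !exprMn -mulrDr cos2Dsin2 mulr1 -expRM_natl => e1.
  have : expR (2%:R * a) = expR 0 :> R by rewrite e1 expR0.
  move/expR_inj/eqP; rewrite mulf_eq0 pnatr_eq0 /= => /eqP //.
split=> //; apply/zeta_eq1; rewrite /zeta mulrC divfK; last first.
  by rewrite mulf_neq0 // ?pnatr_eq0 // gt_eqF // pi_gt0.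
by rewrite -z1 a0.
Qed.

Lemma root_geometric (M : nat) z : z ^+ M = 1 ->
  \sum_(k < M) z ^+ k = (if z == 1 then M%:R else 0).
Proof.
move=> zM; case: eqP => [->|zN].
  by under eq_bigr do rewrite expr1n; rewrite sumr_const card_ord.
have /eqP := subrX1 z M; rewrite zM subrr eq_sym mulf_eq0 subr_eq0.
by move=> /orP[/eqP/zN|/eqP].
Qed.

End Exponential.

Section PointCharacters.
Variables (R : realType) (V : vectType R).
Local Notation V' := 'Hom(V, R^o).
Local Notation C := R[i].
Implicit Types (a b l : V') (p q : complexified V) (s : seq V').

Definition pchar p b : C := cexp (pairing b p).

Lemma pcharD p a b : pchar p (a + b) = pchar p a * pchar p b.
Proof.
rewrite /pchar -cexpD; congr cexp.
by apply/eqP; rewrite eq_complex /= !lfunE /= !eqxx.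
Qed.

Lemma pchar0 p : pchar p 0 = 1.
Proof.
rewrite /pchar -cexp0; congr cexp.
by apply/eqP; rewrite eq_complex /= !lfunE /= !eqxx.
Qed.

Lemma pcharMn p a k : pchar p (a *+ k) = pchar p a ^+ k.
Proof. by elim: k => [|k IH]; rewrite ?pchar0 // mulrS exprS pcharD IH. Qed.

Lemma pchar_sum p (I : Type) (r : seq I) (F : I -> V') :
  pchar p (\sum_(i <- r) F i) = \prod_(i <- r) pchar p (F i).
Proof. exact: (big_morph _ (pcharD p) (pchar0 p)). Qed.

Lemma pcharN p a : pchar p (- a) = (pchar p a)^-1.
Proof.
by apply: (mulfI (cexp_neq0 (pairing a p))); rewrite -pcharD subrr pchar0 divff // cexp_neq0.
Qed.

Lemma pchar_Zspan p s a : (forall b, b \in s -> pchar p b = 1) -> Zspan s a -> pchar p a = 1.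
Proof.
move=> s1 [z ->].
apply: (big_ind (fun y => pchar p y = 1)) => [|y y' y1 y'1|i _]; first exact: pchar0.
  by rewrite pcharD y1 y'1 mulr1.
have si : pchar p s`_i = 1 by apply: s1; exact: mem_nth.
case: (intP (z i)) => [|k|k]; first exact: pchar0.
  by rewrite -[_ *~ _]/(s`_i *+ k.+1) pcharMn si expr1n.
by rewrite mulrNz pcharN -[_ *~ _]/(s`_i *+ k.+1) pcharMn si expr1n invr1.
Qed.

End PointCharacters.

Section Torsion.
Local Open Scope complex_scope.
Variables (R : realType) (V : vectType R) (Gamma : set V) (g : seq V).
Hypothesis gG : Zbasis Gamma g.
Local Notation V' := 'Hom(V, R^o).
Local Notation C := R[i].
Local Notation L := (dual_lattice Gamma).
Implicit Types (l b y : V') (s : seq V').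

Let g_basis : basis_of {:V} g. Proof. by case: gG. Qed.

Lemma dual_latticeP l : L l <-> forall i : 'I_(size g), (l g`_i : R) \is a Num.int.
Proof.
have [_ GE] := gG; split=> [lL i|li _ /[1!GE] -[z ->]].
  by apply: lL; rewrite GE; apply/(@Zspan_mem _ _ g)/mem_nth.
rewrite linear_sum rpred_sum // => i _; rewrite raddfMz -[_ *~ _]mulrzr.
by apply: rpredM; [exact: li | exact: intr_int].
Qed.

Lemma dual_latticeD l y : L l -> L y -> L (l + y).
Proof. by move=> lL yL a aG; rewrite lfunE /=; apply: rpredD; [exact: lL|exact: yL]. Qed.

Lemma dual_latticeN l : L l -> L (- l).
Proof. by move=> lL a aG; rewrite lfunE /= rpredN; exact: lL. Qed.

Lemma dual_lattice0 : L 0.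
Proof. by move=> a aG; rewrite lfunE /=; exact: rpred0. Qed.

Lemma dual_lattice_sum (I : Type) (r : seq I) (F : I -> V') :
  (forall i, L (F i)) -> L (\sum_(i <- r) F i).
Proof. by move=> FL; apply: big_ind => //; [exact: dual_lattice0 | exact: dual_latticeD]. Qed.

Lemma dual_latticeMn l k : L l -> L (l *+ k).
Proof.
move=> lL; elim: k => [|k IH]; rewrite ?mulr0n ?mulrS; first exact: dual_lattice0.
exact: dual_latticeD.
Qed.

Lemma dual_Zbasis : exists e, Zbasis L e.
Proof.
pose c (j : 'I_(size g)) : V' := linfun (fun v : V => coord (in_tuple g) j v : R^o).
have cE j v : c j v = coord (in_tuple g) j v :> R by rewrite lfunE.
pose e := [seq c j | j <- enum 'I_(size g)].
have se : size e = size g by rewrite size_map size_enum_ord.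
have eE (i : 'I_(size e)) : e`_i = c (cast_ord se i).
  have ig : (i < size g)%N by rewrite -se.
  rewrite (nth_map (Ordinal ig)) ?size_enum_ord //; congr c.
  by apply: val_inj; rewrite /= nth_enum_ord.
have cg (i j : 'I_(size g)) : c j g`_i = (j == i)%:R :> R.
  by rewrite cE (coord_free i j (basis_free g_basis : free (in_tuple g))) eq_sym.
have lE l : l = \sum_(i < size e) (l g`_i : R) *: e`_i.
  apply/lfunP => v; rewrite {1}(coord_basis (X := in_tuple g) g_basis (memvf v)).
  rewrite linear_sum sum_lfunE (reindex (cast_ord se)) /=; last first.
    by exists (cast_ord (esym se)) => i _; [rewrite cast_ordK | rewrite cast_ordKV].
  by apply: eq_bigr => i _; rewrite linearZ lfunE /= eE cE; exact: mulrC.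
have eg (i j : 'I_(size e)) : e`_j g`_(cast_ord se i) = (j == i)%:R :> R.
  by rewrite eE cg.
have e_free : free e.
  apply/(freeP (X := in_tuple e)) => t t0 i.
  have tE j : (t j *: e`_j) g`_(cast_ord se i) = t j * (j == i)%:R :> R.
    by rewrite -eg lfunE.
  have /lfunP/(_ g`_(cast_ord se i)) := t0.
  rewrite sum_lfunE lfunE (bigD1 i) // tE eqxx mulr1 big1 => [|j /andP[_ ji]].
    by move=> h; apply: etrans h; rewrite /= addr0.
  by rewrite tE (negbTE ji) mulr0.
exists e; split.
  rewrite /basis_of e_free andbT eqEsubv subvf /=; apply/subvP => l _.
  by rewrite (lE l) memv_suml // => i _; rewrite memvZ // memv_span // mem_nth.
apply/seteqP; split=> [l lL|l [z ->]].
  exists (fun i => Num.floor (l g`_i : R)); rewrite [LHS]lE; apply: eq_bigr => i _.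
  have ig : (i < size g)%N by rewrite -se.
  by rewrite -scaler_int (floorK ((dual_latticeP l).1 lL (Ordinal ig))).
apply/dual_latticeP => i; rewrite sum_lfunE rpred_sum // => j _.
by rewrite -scaler_int lfunE /= eE cg; apply: rpredM; [exact: intr_int | exact: rpred_nat].
Qed.

Section Level.
Variable M : nat.
Implicit Type k : {ffun 'I_(size g) -> 'I_M}.

(* The [tpoint k] represent the points [p] with [M p] in [2 i pi Gamma], modulo
   [2 i pi Gamma]. *)
Definition tpoint k : complexified V :=
  (0, (2 * pi) *: \sum_(i < size g) ((k i)%:R / M%:R : R) *: g`_i).

Definition tchar k : V' -> C := pchar (tpoint k).

Lemma tcharE k l : tchar k l = \prod_(i < size g) zeta ((l g`_i : R) / M%:R) ^+ k i.
Proof.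
under eq_bigr do rewrite -zetaMn.
rewrite -zeta_sum; congr cexp; apply/eqP; rewrite eq_complex /= linear0 eqxx /=.
rewrite linearZ linear_sum; apply/eqP; congr (_ * _); apply: eq_bigr => i _.
transitivity ((k i)%:R / M%:R * (l g`_i : R)); first by rewrite linearZ.
by rewrite -[RHS]mulr_natl mulrAC mulrA.
Qed.

Lemma tcharD k : {morph tchar k : l y / l + y >-> l * y}.
Proof. exact: pcharD. Qed.

Lemma tchar0 k : tchar k 0 = 1. Proof. exact: pchar0. Qed.

Hypothesis M0 : (0 < M)%N.

Let MR0 : M%:R != 0 :> R. Proof. by rewrite pnatr_eq0 -lt0n. Qed.

Lemma tchar_root k l : L l -> tchar k l ^+ M = 1.
Proof.
move=> /dual_latticeP lL; rewrite tcharE -prodrXl big1 // => i _.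
rewrite exprAC -zetaMn -[_ *+ M]mulr_natr divfK //.
by rewrite (zeta_eq1 _).2 // expr1n.
Qed.

(** Orthogonality of characters, as a product of geometric sums of roots of unity, one for each
    vector of [g]. *)
Lemma sum_tchar l : L l ->
  \sum_k tchar k l = (M%:R) ^+ size g * `[< L (M%:R^-1 *: l) >]%:R.
Proof.
move=> lL; under eq_bigr do rewrite tcharE.
rewrite -(bigA_distr_bigA (fun (i : 'I_(size g)) (a : 'I_M) => zeta ((l g`_i : R) / M%:R) ^+ a)) /=.
have zM (i : 'I_(size g)) : zeta ((l g`_i : R) / M%:R) ^+ M = 1.
  rewrite -zetaMn -[_ *+ M]mulr_natr divfK //; apply/zeta_eq1.
  exact: (dual_latticeP l).1.
under eq_bigr do rewrite root_geometric //.
case: asboolP => [/dual_latticeP lM|lM].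
  rewrite mulr1 (eq_bigr (fun=> M%:R)) ?prodr_const ?card_ord // => i _.
  rewrite (zeta_eq1 _).2 ?eqxx //; have := lM i.
  by rewrite lfunE /= [_ *: _]/(_ * _) mulrC.
rewrite mulr0; have [i iN] : exists i : 'I_(size g), ~ ((l g`_i : R) / M%:R \is a Num.int).
  apply: contrapT => iN; apply: lM; apply/dual_latticeP => i.
  apply: contrapT => li; apply: iN; exists i.
  by apply: contra_not li; rewrite lfunE /= [_ *: _]/(_ * _) mulrC.
rewrite (bigD1 i) //=; case: eqP => [/zeta_eq1//|_].
by rewrite mul0r.
Qed.

Lemma tchar_average k s : (forall b, b \in s -> L b) ->
  \sum_(j : {ffun 'I_(size s) -> 'I_M}) tchar k (\sum_(i < size s) s`_i *+ j i) =
  M%:R ^+ size s * (all (fun b => tchar k b == 1) s)%:R.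
Proof.
move=> sL.
under eq_bigr => j _.
  rewrite /tchar pchar_sum; under eq_bigr => i _ do rewrite pcharMn.
  over.
rewrite -(bigA_distr_bigA (fun (i : 'I_(size s)) (a : 'I_M) => tchar k s`_i ^+ a)) /=.
under eq_bigr => i _.
  rewrite root_geometric; last by apply/tchar_root/sL/mem_nth.
  over.
case: allP => [s1|sN].
  rewrite mulr1 (eq_bigr (fun=> M%:R)) ?prodr_const ?card_ord // => i _.
  by rewrite s1 // mem_nth.
rewrite mulr0; have [i iN] : exists i : 'I_(size s), tchar k s`_i != 1.
  apply: contrapT => iN; apply: sN => b bs; apply: contrapT => /negP b1; apply: iN.
  have ib : (index b s < size s)%N by rewrite index_mem.
  by exists (Ordinal ib); rewrite /= nth_index.
by rewrite (bigD1 i) //= (negbTE iN) mul0r.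
Qed.

End Level.

(* Expanding the condition on [k] by averaging over [j] gives the number of [j]
   with [sum_i j_i s_i - l] in [M L]. *)
Lemma torsion_sum (mu : {measure set (borel V') -> \bar R}) s M l :
    is_lattice_volume L mu -> (0 < M)%N -> basis_of {:V'} s ->
    (forall b, b \in s -> L b) -> (forall x, L x -> Zspan s (x *+ M)) -> L l ->
  \sum_(k : {ffun 'I_(size g) -> 'I_M} | all (fun b => tchar k b == 1) s) (tchar k l)^-1 =
  `[< Zspan s l >]%:R * (vol mu s)%:C.
Proof.
move=> mu_vol M0 s_basis sL Ms lL.
have MR0 : M%:R != 0 :> R by rewrite pnatr_eq0 -lt0n.
have MC0 : M%:R != 0 :> C by rewrite pnatr_eq0 -lt0n.
have [e eL] := dual_Zbasis.
have sg : size s = size g.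
  rewrite -[LHS](size_basis (X := in_tuple s) s_basis).
  by rewrite -[RHS](size_basis (X := in_tuple g) g_basis) dim_dual.
pose y (j : {ffun 'I_(size s) -> 'I_M}) := \sum_(i < size s) s`_i *+ j i.
have yL j : L (y j).
  by apply: dual_lattice_sum => i; apply/dual_latticeMn/sL/mem_nth.
have sumE u : L u -> \sum_(k : {ffun 'I_(size g) -> 'I_M} | all (fun b => tchar k b == 1) s)
    (tchar k u)^-1 = \sum_j `[< L (M%:R^-1 *: (y j - u)) >]%:R.
  move=> uL; apply: (mulfI (expf_neq0 (size s) MC0)).
  transitivity (\sum_(k : {ffun 'I_(size g) -> 'I_M}) \sum_j tchar k (y j - u)).
    rewrite mulr_sumr big_mkcond; apply: eq_bigr => k _.
    rewrite (eq_bigr (fun j => tchar k (y j) * (tchar k u)^-1)); last first.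
      by move=> j _; rewrite /tchar pcharD pcharN.
    rewrite -mulr_suml tchar_average //.
    by case: all; rewrite ?mulr1 // mulr0 mul0r.
  rewrite exchange_big /= mulr_sumr; apply: eq_bigr => j _.
  rewrite sum_tchar ?sg //; apply: dual_latticeD => //; exact: dual_latticeN.
case: asboolP => [l_s|lN]; last first.
  rewrite mul0r sumE // big1 // => j _; case: asboolP => // jL; case: lN.
  have := Ms _ jL; rewrite -scaler_nat scalerA divff // scale1r => yl.
  rewrite -(subKr (y j) l); apply: ZspanB => //; apply: Zspan_sum => i _.
  by apply: (ZspanMz (j i : nat)); apply/Zspan_mem/mem_nth.
(* Characters trivial on [s] are trivial on [l], so the sum is the one at 0, which counts the same j
   as [vol_index]. *)
rewrite mul1r (eq_bigr (fun k => (tchar k 0)^-1)) => [|k /allP k1]; last first.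
  by rewrite tchar0 /tchar (pchar_Zspan _ l_s) // => b /k1/eqP.
rewrite sumE ?(vol_index eL mu_vol M0 s_basis sL Ms); last exact: dual_lattice0.
rewrite -natr_sum rmorph_nat; congr _%:R; rewrite -sum1_card [RHS]big_mkcond.
apply: eq_bigr => j _; rewrite subr0 inE /=.
rewrite (_ : M%:R^-1 *: y j = \sum_(i < size s) ((j i)%:R / M%:R : R) *: s`_i).
  by case: asboolP.
rewrite /y scaler_sumr; apply: eq_bigr => i _.
by rewrite -[s`_i *+ _]scaler_nat scalerA mulrC.
Qed.

End Torsion.

(** * The counting formula *)

Lemma nuniq_rem (T : eqType) (s : seq T) : ~~ uniq s -> exists2 b, b \in s & b \in rem b s.
Proof.
elim: s => //= a s IH; rewrite negb_and negbK; have [as_ _|as_ /= /IH[b bs bs']] := boolP (a \in s).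
  by exists a; rewrite ?mem_head // eqxx.
by exists b; rewrite ?inE ?bs ?orbT //; case: eqP => // _; rewrite inE bs' orbT.
Qed.

Section SolutionsOfFree.
Variables (R : realType) (W : vectType R).
Implicit Types (s : seq W) (l : W).

Lemma count_free s l : free s -> (exists z : 'I_(size s) -> nat, l = \sum_(i < size s) s`_i *+ z i) ->
  count_solutions s l = 1%N.
Proof.
move=> s_free [z lE]; rewrite /count_solutions.
suff -> : @solutions W s l = [set [ffun i => z i]] by rewrite fset_set1 cardfs1.
apply/seteqP; split=> [y /= yl|_ ->]; last first.
  by rewrite /solutions /= lE; apply: eq_bigr => i _; rewrite ffunE.
apply/ffunP => i; rewrite ffunE; apply/eqP; rewrite -(eqr_nat R); apply/eqP.
move: yl; rewrite lE => yz.
have := congr1 (coord (in_tuple s) i) yz.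
have toR (f : 'I_(size s) -> nat) :
    \sum_(k < size s) s`_k *+ f k = \sum_(k < size s) (f k)%:R *: (in_tuple s)`_k.
  by apply: eq_bigr => k _; rewrite scaler_nat.
by rewrite !toR !(coord_sum_free (X := in_tuple s)).
Qed.

Lemma count_none s l : (forall z : 'I_(size s) -> nat, l <> \sum_(i < size s) s`_i *+ z i) ->
  count_solutions s l = 0%N.
Proof.
move=> lN; rewrite /count_solutions.
suff -> : @solutions W s l = set0 by rewrite fset_set0 cardfs0.
by apply/seteqP; split=> // y /= yl; case: (lN y).
Qed.

End SolutionsOfFree.

Section CountingTheorem.
Variables (R : realType) (V : vectType R).
Local Notation V' := 'Hom(V, R^o).
Local Notation n := (\dim {:V}).
Variables (K : numFieldType) (iota : {rmorphism R -> K}) (A : comAlgType K).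
Variables (lin : V' -> A) (at0 : {linear A -> K^o}).
Variables (euler : {linear A -> A}) (ddir : V -> {linear A -> A}).
Variables (ok : V' -> Prop) (w : seq V' -> K).
Hypotheses (pc : polynomial_calculus iota lin at0 euler ddir) (cw : circuit_weight iota ok w).
Hypothesis at01 : at0 1 = 1.
Implicit Types (s : seq V') (l b y : V') (v : V) (P : A).

Definition LamL s : {linear A -> K^o} := Lam at0 ddir w s.

Lemma Lam_residue : residue_functional iota lin ddir ok LamL.
Proof.
split.
- by move=> s a sn; rewrite [LHS]/(Lam _ _ _ _ _) /Lam leqNgt sn.
- move=> b s a bo so; exact: (Lam_cons pc cw).
- move=> s s' a so ss'; exact: (Lam_perm pc cw).
- move=> s v a so; exact: (Lam_ddir pc cw).
Qed.

Variables (L : set V') (v0 : V) (x : V').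
Hypotheses (LD : forall l y, L l -> L y -> L (l + y)) (LN : forall l, L l -> L (- l)).
Hypotheses (ok_L : forall b, ok b -> L b) (ok_gt0 : forall b, ok b -> 0 < (b v0 : R))
  (okD : forall b y, ok b -> ok y -> ok (b + y)).
Hypothesis x_generic : forall s, (forall b, b \in s -> ok b) ->
  (size s < n)%N -> x \notin span s.
Hypothesis L_relation : forall s, uniq s -> (forall b, b \in s -> ok b) ->
  ~~ free s -> exists2 c : V' -> int,
    \sum_(b <- s) b *~ c b = 0 & exists2 b, b \in s & c b != 0.
Hypothesis L_multiple : forall s, basis_of {:V'} s -> (forall b, b \in s -> L b) ->
  exists2 M, (0 < M)%N & forall y, L y -> Zspan s (y *+ M).
Variables (I : nat -> finType) (chi : forall M, I M -> V' -> K).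
Hypotheses (chiD : forall M (k : I M), {morph chi k : l y / l + y >-> l * y})
  (chi0 : forall M (k : I M), chi k 0 = 1).
Hypothesis w_cone : forall s, ~ (basis_of {:V'} s /\ cone s x) -> w s = 0.
Hypothesis torsion : forall M s l, (0 < M)%N -> basis_of {:V'} s ->
    (forall b, b \in s -> ok b) -> (forall y, L y -> Zspan s (y *+ M)) -> L l -> cone s x ->
  (\sum_(k : I M | all (fun b => chi k b == 1) s) (chi k l)^-1) * w s =
    `[< Zspan s l >]%:R.

Local Notation ht := (fun b : V' => b v0 : R).

Lemma eval_is_additive : additive ht.
Proof. by move=> a b; rewrite !lfunE /= lfunE. Qed.

Definition evalA : {additive V' -> R} := HB.pack ht
  (GRing.isZmodMorphism.Build V' R ht eval_is_additive).

Definition discrepancy M l s : K := (count_solutions s l)%:R -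
  \sum_(k : I M) Psi lin LamL (chi k) l s.

Lemma ok_positive s : (forall b, b \in s -> ok b) -> positive evalA s.
Proof. by move=> so b /so/ok_gt0. Qed.

Lemma ok_consP b s : ok b -> (forall b', b' \in s -> ok b') ->
  forall b', b' \in b :: s -> ok b'.
Proof. by move=> bo so b'; rewrite inE => /predU1P[->|/so]. Qed.

Lemma discrepancy_perm M l s s' : (forall b, b \in s -> ok b) -> perm_eq s s' ->
  discrepancy M l s = discrepancy M l s'.
Proof.
move=> so ss'; rewrite /discrepancy (count_perm _ _ (ok_positive so) ss').
congr (_ - _); apply: eq_bigr => k _; exact: (Psi_perm Lam_residue).
Qed.

Let linD : {morph lin : l y / l + y}. Proof. by case: pc => -[]. Qed.

Let ddirM t P Q : ddir t (P * Q) = ddir t P * Q + P * ddir t Q.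
Proof. by case: pc => _ [h _ _ _]; exact: h. Qed.

Let ddir_lin t y : ddir t (lin y) = (iota (y t))%:A.
Proof. by case: pc => _ [_ h _ _]; exact: h. Qed.

Lemma discrepancy_cons M l b s : ok b -> (forall b', b' \in s -> ok b') ->
  discrepancy M l (b :: s) - discrepancy M (l - b) (b :: s) = discrepancy M l s.
Proof.
move=> bo so; rewrite /discrepancy -(count_cons _ _ (ok_positive (ok_consP bo so))).
rewrite opprD addrACA -opprD; congr (_ - _); rewrite -sumrB; apply: eq_bigr => k _.
exact: (Psi_cons linD Lam_residue (chiD k) (chi0 k)).
Qed.

Lemma discrepancy_euler M (l : V') v s : (forall b, b \in s -> ok b) ->
  iota (l v) * discrepancy M l s =
  \sum_(b <- s) iota ((b : V') v) * discrepancy M (l - b) (b :: s).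
Proof.
move=> so; rewrite /discrepancy mulrBr.
have fD : {morph (fun y : V' => iota (y v)) : y z / y + z}.
  by move=> y z; rewrite lfunE -rmorphD.
rewrite (count_euler l fD (ok_positive so)) mulr_sumr.
under [RHS]eq_bigr do rewrite mulrBr mulr_sumr.
rewrite sumrB; congr (_ - _); rewrite exchange_big; apply: eq_bigr => k _.
exact: (Psi_euler linD ddirM ddir_lin Lam_residue (chiD k) (chi0 k)).
Qed.

Lemma fps0M (P Q : fps A) : (P * Q) 0%N = P 0%N * Q 0%N.
Proof. by rewrite fpsME big_ord1. Qed.

Lemma units0 (c : V' -> K) s : (forall b, b \in s -> c b = 1) ->
  units lin c s 0%N = 1.
Proof.
move=> s1; rewrite /units big_seq.
apply: (big_ind (fun P : fps A => P 0%N = 1)) => [|P Q P1 Q1|b bs] //.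
  by rewrite fps0M P1 Q1 mulr1.
have u1 : factor_unit lin (c b) b 0%N = 1.
  by rewrite s1 // /factor_unit eqxx /fps_expm1 expr0 factS fact0 invr1 scale1r.
have := congr1 (fun P : fps A => P 0%N) (divrr (factor_unit_unit lin (c b) b)).
by rewrite fps0M u1 mul1r => ->.
Qed.

(** With n factors the residue can be nonzero only if all of them are poles, and then only constant
    terms survive. *)
Lemma Psi_basis (c : V' -> K) l s : span s = fullv -> size s = n ->
  Psi lin LamL c l s = if all (fun b => c b == 1) s then (c l)^-1 * w s else 0.
Proof.
move=> sT sn; rewrite /Psi /Lgen /Lfps; case: ifPn => [/allP s1|sN].
  have -> : poles c s = s by apply/all_filterP/allP.
  rewrite sn subnn fps0M units0 => [|b bs]; last exact/eqP/s1.
  rewrite [LamL s _]Lam_basis // mulr1 /fps_exp expr0 fact0 invr1 scale1r.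
  by rewrite at01 mulr1.
have [h _ _ _] := Lam_residue.
rewrite h ?mulr0 // -sn size_filter ltn_neqAle count_size andbT.
by rewrite -all_count.
Qed.

Lemma Psi_eq0 (c : V' -> K) l s :
    (forall s', {subset s' <= s} -> size s' = n -> w s' = 0) ->
  Psi lin LamL c l s = 0.
Proof.
move=> w0; rewrite /Psi /Lgen /Lfps [LamL _ _]Lam_eq0 ?mulr0 // => s' s's.
by apply: w0 => b /s's; rewrite mem_filter => /andP[].
Qed.

Section Base.
Variables (sigma : seq V') (t : V' -> V).
Hypotheses (sigma_free : free sigma) (sigma_ok : forall b, b \in sigma -> ok b).
Hypothesis sigma_span : span sigma = fullv.
Hypothesis tE : forall y, y = \sum_(b <- sigma) (y (t b) : R) *: b.

Let sigma_uniq : uniq sigma. Proof. exact: free_uniq. Qed.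

Let t_delta b d : b \in sigma -> d \in sigma -> (d (t b) : R) = (d == b)%:R.
Proof.
move=> bs ds; apply: (@free_sum_inj _ _ sigma (fun b => d (t b)) (fun b => (d == b)%:R)) => //.
rewrite -tE (bigD1_seq d) //= eqxx scale1r big1 ?addr0 // => a ad.
by rewrite eq_sym (negbTE ad) scale0r.
Qed.

Let sigma_size : size sigma = n.
Proof. by rewrite -dim_dual -sigma_span; move/eqP: sigma_free. Qed.

Let sigma_basis : basis_of {:V'} sigma.
Proof. by rewrite /basis_of sigma_span eqxx. Qed.

Let coord_count (s : seq V') b (y : 'I_(size s) -> R) : b \in sigma -> s =i sigma ->
  ((\sum_(i < size s) y i *: s`_i) (t b) : R) = \sum_(i < size s) y i * (s`_i == b)%:R.
Proof.
move=> bs ss; rewrite sum_lfunE; apply: eq_bigr => i _.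
by rewrite lfunE /= t_delta // -ss mem_nth.
Qed.

Lemma base_uniq M l : (0 < M)%N -> (forall y, L y -> Zspan sigma (y *+ M)) ->
    (forall b, b \in sigma -> 0 < (x (t b) : R)) -> L l ->
    (forall b, b \in sigma -> -1 < (l (t b) : R)) ->
  discrepancy M l sigma = 0.
Proof.
move=> M0 Ms x0 lL l0.
have x_cone : cone sigma x.
  by rewrite (tE x); apply: cone_sum => b /x0/ltW.
rewrite /discrepancy; under eq_bigr => k _ do rewrite Psi_basis //.
rewrite -big_mkcond -mulr_suml torsion //.
case: asboolP => [[z lE]|lN].
  rewrite count_free ?subrr //.
  exists (fun i => `|z i|%N); rewrite [LHS]lE; apply: eq_bigr => i _.
  have si : sigma`_i \in sigma by exact: mem_nth.
  have : -1 < (z i)%:~R :> R.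
    have -> : (z i)%:~R = (l (t sigma`_i) : R); last exact: l0.
    rewrite lE; under [in RHS]eq_bigr do rewrite -scaler_int.
    rewrite coord_count // (bigD1 i) //= eqxx mulr1 big1 ?addr0 // => j ji.
    by rewrite nth_uniq // [_ == _](negbTE _) ?mulr0.
  rewrite -(intrN R 1) ltr_int => zi; have {}zi : 0 <= z i by lia.
  by rewrite -[in LHS](gez0_abs zi).
rewrite count_none ?subrr // => z lE; apply: lN; exists (fun i => z i).
by rewrite lE.
Qed.

(** Let [s'] be [s] without one copy of a repeated [b]. In the Euler equation for [s'] at [l + b],
    the dual direction [t b] retains only the copies of [b], and all of them give the same term, the
    discrepancy of [s] at [l]. The bound passes to [s']: the coordinate along [b] and the opposite
    of its multiplicity both increase by one. *)
Lemma base_pos M : (0 < M)%N -> (forall y, L y -> Zspan sigma (y *+ M)) ->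
    (forall b, b \in sigma -> 0 < (x (t b) : R)) ->
  forall m (s : seq V') (l : V'), size s = m -> s =i sigma -> L l ->
    (forall b, b \in sigma -> - (count_mem b s)%:R < (l (t b) : R)) ->
  discrepancy M l s = 0.
Proof.
move=> M0 Ms x0; elim=> [|m IH] s l sm ss lL l0.
  case: s sm ss l0 => // _ ss l0; have s0 : sigma = [::].
    by case E: sigma => [//|a s']; have := ss a; rewrite E mem_head.
  by rewrite -s0; apply: base_uniq => // b; rewrite s0.
have s_ok b : b \in s -> ok b by rewrite ss; exact: sigma_ok.
have [us|us] := boolP (uniq s).
  rewrite (discrepancy_perm _ _ s_ok (uniq_perm us sigma_uniq ss)).
  apply: base_uniq => // b bs; have := l0 b bs.
  by rewrite count_uniq_mem // ss bs.
have [b bs bs'] := nuniq_rem us.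
have pb := perm_to_rem bs; set s' := rem b s in pb.
have cs a : count_mem a s = ((b == a) + count_mem a s')%N.
  by rewrite (permP pb) /=.
have cb' : (0 < count_mem b s')%N by rewrite -has_count has_pred1.
have ss' : s' =i sigma.
  move=> a; rewrite -ss (perm_mem pb) inE; case: eqP => [->|//].
  by rewrite bs'.
have s'_ok a : a \in s' -> ok a by rewrite ss'; exact: sigma_ok.
have bs0 : b \in sigma by rewrite -ss.
have h0 : discrepancy M (l + b) s' = 0.
  apply: IH => //; first by rewrite size_rem // sm.
    by apply: LD => //; exact/ok_L/s_ok.
  move=> a as_; rewrite lfunE /= (t_delta as_ bs0); have := l0 a as_; rewrite cs natrD.
  have key (u v r : R) : - (v + r) < u -> - r < u + v by move=> ?; lra.
  exact: key.
have := discrepancy_euler M (l + b) (t b) s'_ok; rewrite h0 mulr0.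
rewrite (eq_big_seq (fun a => (a == b)%:R * discrepancy M l (b :: s'))); last first.
  move=> a; rewrite ss' => as_; rewrite t_delta //.
  case: eqP => [->|_]; last by rewrite rmorph0 !mul0r.
  by rewrite rmorph1 addrK.
rewrite -mulr_suml -(discrepancy_perm _ _ s_ok pb) => /esym/eqP.
rewrite mulf_eq0 => /orP[|/eqP //].
rewrite (bigID (pred1 b)) /= (eq_bigr (fun=> 1)) => [|a ->] //.
rewrite [X in _ + X]big1 ?addr0 => [|a /negbTE -> //].
rewrite big_const_seq iter_addr addr0 pnatr_eq0 => /eqP cb0.
by rewrite cb0 in cb'.
Qed.

(** Both sides vanish: no basis drawn from [s] has [x] in its cone, and a solution would make the
    coordinate of [l] along [b] nonnegative. *)
Lemma base_neg M b s l : b \in sigma -> s =i sigma -> (x (t b) : R) < 0 ->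
  (l (t b) : R) < 0 -> discrepancy M l s = 0.
Proof.
move=> bs ss xb lb; rewrite /discrepancy big1 => [|k _]; last first.
  apply: Psi_eq0 => s' s's sn; apply: w_cone => -[s'b].
  have us' := free_uniq (basis_free s'b).
  have ps' : perm_eq s' sigma.
    have s's0 : {subset s' <= sigma} by move=> a /s's; rewrite ss.
    by apply: uniq_perm => //; apply: (uniq_min_size us' s's0 _).2; rewrite sn sigma_size.
  move=> /(cone_perm us' ps'); rewrite (tE x) => /(cone_free _ sigma_free).
  by move=> /(_ b bs); rewrite leNgt xb.
rewrite subr0 count_none // => z lE; move: lb; rewrite lE.
have -> : \sum_(i < size s) s`_i *+ z i = \sum_(i < size s) (z i)%:R *: s`_i.
  by apply: eq_bigr => i _; rewrite scaler_nat.
by rewrite coord_count // ltNge sumr_ge0 // => i _; rewrite mulr_ge0.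
Qed.

(** On [x - box s], a coordinate of [l] is at most that of [x], and at least that of [x] minus the
    multiplicity. Genericity makes the coordinates of [x] nonzero, which gives the strict bounds of
    [base_neg] or of [base_pos]. *)
Lemma base_vanishing s : s =i sigma -> vanishing L x discrepancy s.
Proof.
move=> ss; have [M0 M0_gt0 M0s] := L_multiple sigma_basis (fun b bs => ok_L (sigma_ok bs)).
exists M0 => // M l /dvdnP[q ->] M_gt0 lL [y y01 xl].
have xlE b : b \in sigma -> (x (t b) : R) - (l (t b) : R) =
    \sum_(i < size s) y i * (s`_i == b)%:R.
  by move=> bs; rewrite -coord_count // -xl !lfunE /= lfunE.
have y_ge0 b : 0 <= \sum_(i < size s) y i * (s`_i == b)%:R.
  by apply: sumr_ge0 => i _; rewrite mulr_ge0 //; case/andP: (y01 i).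
have x_neq0 b : b \in sigma -> (x (t b) : R) != 0.
  move=> bs; apply/eqP => xb; have /negP[] : x \notin span (rem b sigma).
    apply: x_generic => [a /mem_rem/sigma_ok//|].
    rewrite size_rem // sigma_size prednK // -sigma_size.
    by case: sigma bs.
  rewrite (tE x) (big_rem b) //= xb scale0r add0r big_seq memv_suml // => a as_.
  by rewrite memvZ // memv_span.
have [x_pos|] := pselect (forall b, b \in sigma -> 0 < (x (t b) : R)); last first.
  move=> xN; have [b bs xb] : exists2 b, b \in sigma & (x (t b) : R) < 0.
    apply: contrapT => xN'; apply: xN => b bs; rewrite lt0r x_neq0 //= leNgt.
    by apply/negP => xb; apply: xN'; exists b.
  apply: (base_neg _ bs ss xb); have := xlE b bs; have := y_ge0 b; lra.
apply: (base_pos M_gt0 _ x_pos erefl ss lL) => [u uL|b bs].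
  by rewrite mulnC mulrnA; apply: (ZspanMz q); exact: M0s.
have := xlE b bs; have := x_pos b bs.
suff : \sum_(i < size s) y i * (s`_i == b)%:R <= (count_mem b s)%:R by lra.
rewrite -sum1_count natr_sum (big_nth 0) big_mkord [leRHS]big_mkcond.
apply: ler_sum => i _; have /andP[y0 y1] := y01 i; rewrite /=.
by case: eqP => _; rewrite ?mulr0 ?mulr1.
Qed.

End Base.

Theorem counting_theorem s : (forall b, b \in s -> ok b) -> span s = fullv ->
  exists2 M0, (0 < M0)%N & forall M l, (M0 %| M)%N -> (0 < M)%N -> L l -> box s (x - l) ->
    (count_solutions s l)%:R = \sum_(k : I M) Psi lin LamL (chi k) l s.
Proof.
move=> s_ok sT.
have htD : {morph ht : a b / a + b} by move=> a b; rewrite lfunE.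
have hbase s' : spanning_ok ok s' -> free (undup s') -> vanishing L x discrepancy s'.
  move=> [s'_ok s'T] s'_free; have [t tE] := dual_system s'T.
  have s'u : s' =i undup s' by move=> a; rewrite mem_undup.
  apply: (base_vanishing s'_free _ _ tE s'u) => [b|]; first by rewrite mem_undup => /s'_ok.
  by rewrite -s'T; apply: eq_span => b; rewrite mem_undup.
have [M0 M0_gt0 h] := @vanishing_reduction R V' K L ok ht x discrepancy LD LN ok_L htD
  ok_gt0 okD discrepancy_perm discrepancy_cons L_relation hbase s (conj s_ok sT).
exists M0 => // M l M0M M_gt0 lL xl; apply/eqP.
by rewrite -subr_eq0; apply/eqP; exact: h.
Qed.


End CountingTheorem.

(** * Generic points of a chamber *)

Section GenericPoint.
Variables (R : realType).

Lemma finite_roots (p : {poly R}) : p != 0 -> exists rs : seq R, forall t, root p t -> t \in rs.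
Proof.
have [m] := ubnP (size p); elim: m p => // m IH p pm p0.
have [[t pt]|none] := pselect (exists t, root p t); last first.
  by exists [::] => t pt; case: none; exists t.
have [q pE] := factor_theorem p t pt.
have q0 : q != 0 by apply: contraNneq p0 => q0; rewrite pE q0 mul0r.
have [|//|rs rsE] := IH q.
  have := pm; rewrite pE size_Mmonic ?monicXsubC // size_XsubC addn2 /=.
  by rewrite ltnS.
exists (t :: rs) => u; rewrite pE rootM root_XsubC inE orbC => /orP[->//|/rsE ->].
by rewrite orbT.
Qed.

Lemma positive_gap (rs : seq R) : exists2 d : R, 0 < d <= 1 & forall t, t \in rs -> 0 < t -> d <= t.
Proof.
elim: rs => [|r rs [d /andP[d0 d1] dP]]; first by exists 1; rewrite ?ltr01 ?lexx.
have [r0|r0] := ltP 0 r; last first.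
  exists d; rewrite ?d0 // => t; rewrite inE => /predU1P[->|]; last exact: dP.
  by rewrite ltNge r0.
exists (Num.min d r); rewrite ?lt_min ?ge_min ?d0 ?d1 ?r0 // => t.
by rewrite inE ge_min => /predU1P[->|/dP dt /dt ->//]; rewrite lexx orbT.
Qed.

Lemma uncountable_interval (d : R) (A : set R) : 0 < d -> countable A ->
  exists2 t, 0 < t < d & ~ A t.
Proof.
move=> d0 /countable_lebesgue_measure0 A0; apply: contrapT => none.
have sub : `]0, d[%classic `<=` A.
  move=> t /=; rewrite in_itv /= => td; apply: contrapT => At; apply: none.
  by exists t.
have := lebesgue_measure_itv `]0, d[; rewrite /= lte_fin d0 sube0 => dE.
have : (lebesgue_measure (`]0%R, d[%classic : set R) <= lebesgue_measure A)%E.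
  by apply: le_outer_measure.
by rewrite A0 dE lee_fin leNgt d0.
Qed.

End GenericPoint.

Section Chamber.
Import VectorInternalTheory.
Variables (R : realType) (V : vectType R).
Local Notation V' := 'Hom(V, R^o).
Local Notation n := (\dim {:V}).
Variables (N : nat) (Phi : N.-tuple V') (c : set V').
Hypotheses (Phi_span : span Phi = fullv) (c_chamber : big_chamber Phi c).
Implicit Types (s : seq V') (b x y l : V').

Let walls : set V' := \bigcup_(nu in [set nu : seq V' |
  {subset nu <= Phi} /\ (size nu < n)%N]) cone nu.

Lemma chamber_connected x (B : set V') : c x -> B x -> B `<=` ~` walls ->
  connected (B : set (vtop V')) -> B `<=` c.
Proof.
case: c_chamber => x0 _ ->; rewrite -/walls => cx Bx Bw Bc y By.
by apply: (connected_component_trans cx); exists B.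
Qed.

Lemma chamber_sub : c `<=` ~` walls.
Proof.
by case: c_chamber => x0 _ -> y cy; exact: (@connected_component_sub (vtop V') _ x0).
Qed.

Lemma cone_span s x : cone s x -> x \in span s.
Proof.
move=> [t _ ->]; apply: memv_suml => i _; apply: memvZ.
exact/memv_span/mem_nth.
Qed.

(** The cone meets the connected set [c] in a part that is closed, as the cone is, and open, because
    a chamber avoids the facets of the cone, which are walls. *)
Lemma cone_chamber s x : {subset s <= Phi} -> free s -> size s = n -> c x ->
  (c `<=` cone s <-> cone s x) /\ (c `&` cone s = set0 <-> ~ cone s x).
Proof.
move=> s_Phi s_free sn cx.
have sT : span s = fullv by exact: free_spanning.
have crdE0 y : y = \sum_(i < size s) coord (in_tuple s) i y *: s`_i.
  by rewrite [LHS](@coord_span _ _ _ (in_tuple s)) // sT memvf.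
have coneE y : cone s y <-> forall i, 0 <= coord (in_tuple s) i y.
  split=> [[t t0 ->] i|y0]; first by rewrite (coord_sum_free (X := in_tuple s)).
  by exists (fun i => coord (in_tuple s) i y).
have posE y : c y -> cone s y -> forall i, 0 < coord (in_tuple s) i y.
  move=> /chamber_sub yw /coneE y0 i; rewrite lt0r y0 andbT; apply/eqP => yi.
  have si : s`_i \in s by exact: mem_nth.
  apply: yw; exists (rem s`_i s).
    split=> [b /mem_rem/s_Phi//|]; rewrite size_rem // sn prednK // -sn.
    exact: leq_ltn_trans (leq0n i) (ltn_ord i).
  pose f b := if insub (index b s) is Some j then coord (in_tuple s) j y else 0.
  have us := free_uniq s_free.
  have fE (j : 'I_(size s)) : f s`_j = coord (in_tuple s) j y.
    by rewrite /f index_uniq // valK.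
  have -> : y = \sum_(b <- rem s`_i s) f b *: b.
    rewrite {1}(crdE0 y); transitivity (\sum_(b <- s) f b *: b).
      by rewrite [RHS](big_nth 0) big_mkord; apply: eq_bigr => j _; rewrite fE.
    by rewrite (big_rem s`_i) //= fE yi scale0r add0r.
  apply: cone_sum => b _; rewrite /f; case: insub => // j; exact: y0.
pose B : set (vtop V') := c `&` cone s.
have key z : c z -> cone s z -> B = c.
  move=> cz sz; have : connected (c : set (vtop V')).
    by case: c_chamber => x0 _ ->; exact: component_connected.
  apply.
  - by exists z.
  - exists [set y | forall i, 0 < coord (in_tuple s) i y].
      rewrite openE => y y0;
      apply: (@filter_forall _ _ (fun i y => 0 < coord (in_tuple s) i y)
        (nbhs (y : vtop V'))) => i.
      have /continuousP cont := @linear_functional_continuous _ _ (coord (in_tuple s) i).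
      apply: open_nbhs_nbhs; split; last exact: y0.
      by apply: (cont [set r | 0 < r]); exact: open_gt.
    apply/seteqP; split=> y [cy]; first by move=> /(posE y cy).
    by move=> y0; split=> //; apply/coneE => i; apply/ltW/y0.
  - exists (\bigcap_(i in [set: 'I_(size s)]) [set y | 0 <= coord (in_tuple s) i y]).
      apply: closed_bigI => i _.
      apply: (@preimage_closed _ _ (coord (in_tuple s) i : vtop V' -> R) [set r | 0 <= r]).
        by move=> y _; exact: linear_functional_continuous.
      exact: closed_ge.
    apply/seteqP; split=> y [cy].
      by move=> /coneE y0; split=> // i _; exact: y0.
    by move=> y0; split=> //; apply/coneE => i; exact: y0.
split.
  split=> [/(_ x cx)//|/(key x cx) cE y cy].
  by have [] : B y by rewrite cE.
split=> [c0 sx|sx]; first by have : (c `&` cone s) x by []; rewrite c0.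
apply/seteqP; split=> // y [cy sy]; case: sx.
by have [] : B x by rewrite (key y cy sy).
Qed.

Lemma curve_continuous (X : R -> V') :
  (forall j, continuous (fun t => v2r (X t) 0 j : R)) -> continuous (X : R -> vtop V').
Proof.
move=> Xj; have : continuous (fun t => v2r (X t)).
  move=> t A' /nbhs_ballP[e e0 eA'].
  have tX : \forall u \near t, forall j, ball (v2r (X t) 0 j) e (v2r (X u) 0 j).
    apply: (@filter_forall _ _ (fun j u => ball (v2r (X t) 0 j) e (v2r (X u) 0 j)) (nbhs t)) => j.
    by have := Xj j t => /cvg_ballP/(_ e e0).
  by apply: filterS tX => u tu; apply: eA'; split=> // i j; rewrite !ord1; exact: tu.
move=> /continuousP Xc; apply/continuousP => A [B oB <-].
exact: (Xc B oB).
Qed.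

Section Curve.
Variables (x0 : V') (tau : 'I_(size Phi) -> R).
Hypotheses (cx0 : c x0) (tau01 : forall i, 0 <= tau i <= 1).
Local Notation P i := ((tval Phi)`_i).

Let eps (i : 'I_(size Phi)) : R := if tau i <= 2^-1 then 2^-1 else - 2^-1.

(* Distinct powers of [t] keep this curve out of any given hyperplane except at
   finitely many [t]; the signs keep [curve t - lambda] in [box Phi]. *)
Definition curve (t : R) : V' := x0 + \sum_(i < size Phi) (eps i * t ^+ i.+1) *: P i.

Let curve_poly (phi : V' -> R) : {poly R} :=
  (phi x0)%:P + \sum_(i < size Phi) (eps i * phi (P i)) *: 'X^(i.+1).

Let eps_neq0 i : eps i != 0.
Proof. by rewrite /eps; case: ifP; rewrite ?oppr_eq0 invr_eq0 pnatr_eq0. Qed.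

Let curve_polyE (phi : {linear V' -> R^o}) t : phi (curve t) = (curve_poly phi).[t].
Proof.
rewrite /curve /curve_poly linearD linear_sum hornerD hornerC horner_sum.
congr (_ + _); apply: eq_bigr => i _; rewrite linearZ hornerZ hornerXn.
by rewrite [LHS]mulrAC.
Qed.

Let curve_poly_neq0 (phi : V' -> R) (i : 'I_(size Phi)) : phi (P i) != 0 -> curve_poly phi != 0.
Proof.
move=> phi_i; apply/eqP => p0; have /eqP[] := mulf_neq0 (eps_neq0 i) phi_i.
have := congr1 (fun p : {poly R} => p`_(val i).+1) p0.
rewrite coefD coefC /= add0r coef_sum (bigD1 i) //= coefZ coefXn eqxx mulr1.
rewrite big1 => [|j ji]; first by rewrite addr0 coef0.
by rewrite coefZ coefXn eqSS eq_sym [_ == _](negbTE _) ?mulr0.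
Qed.

(** A nonzero functional that kills [s] is nonzero on some element of the spanning list [Phi]; along
    the curve it becomes a nonzero polynomial in t. *)
Lemma curve_avoids s : span s <> fullv ->
  exists rs : seq R, forall t, curve t \in span s -> t \in rs.
Proof.
move=> /nonspanning_annihilator[v v0 sv].
have phi_lin : linear (fun b : V' => b v : R^o).
  by move=> a l l'; rewrite !lfunE /= lfunE.
pose phi : {linear V' -> R^o} := HB.pack (fun b : V' => b v : R^o)
  (GRing.isLinear.Build R V' R^o _ _ phi_lin).
have [i Pi] : exists i : 'I_(size Phi), phi (P i) != 0.
  apply: contrapT => none; case: (annihilator_nonspanning (s := Phi) v0) => // b bP.
  have ib : (index b Phi < size Phi)%N by rewrite index_mem.
  apply: contrapT => /eqP bv; apply: none; exists (Ordinal ib).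
  by rewrite /= nth_index.
have [rs rsP] := finite_roots (curve_poly_neq0 Pi).
exists rs => t ts; apply: rsP; rewrite /root -curve_polyE; apply/eqP.
have /span_subvP sub : (span s <= lker (linfun phi))%VS.
  by apply/span_subvP => b bs; rewrite memv_ker lfunE /= sv.
have : curve t \in lker (linfun phi).
  by move: ts; apply/subvP/span_subvP.
by rewrite memv_ker lfunE => /eqP.
Qed.

Lemma curve_cont : continuous (curve : R -> vtop V').
Proof.
apply: curve_continuous => j.
have phi_lin : linear (fun b : V' => v2r b 0 j : R^o).
  by move=> a l l'; rewrite linearP !mxE.
pose phi : {linear V' -> R^o} := HB.pack (fun b : V' => v2r b 0 j : R^o)
  (GRing.isLinear.Build R V' R^o _ _ phi_lin).
have -> : (fun t => v2r (curve t) 0 j : R) = horner (curve_poly phi).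
  by apply/funext => t; rewrite -curve_polyE.
exact: continuous_horner.
Qed.

Lemma curve_box t : 0 <= t <= 1 ->
  box Phi (curve t - (x0 - \sum_(i < size Phi) tau i *: P i)).
Proof.
move=> /andP[t0 t1]; exists (fun i => tau i + eps i * t ^+ i.+1) => [i|].
  have t0' : 0 <= t ^+ i.+1 by exact: exprn_ge0.
  have t1' : t ^+ i.+1 <= 1 by exact: exprn_ile1.
  have /andP[tau0 tau1] := tau01 i; set T := t ^+ _ in t0' t1' *.
  by rewrite /eps; have [h|h] := lerP (tau i) 2^-1; apply/andP; split; lra.
rewrite /curve opprB [x0 + _]addrC addrACA subrr addr0 addrC -big_split /=.
by apply: eq_bigr => i _; rewrite scalerDl.
Qed.

(** The walls lie in finitely many proper subspaces, spanned by sublists (masks) of [Phi], so they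
    are not met before some positive time; until then the arc is a connected set through [x0]. *)
Lemma curve_chamber : exists2 d : R, 0 < d <= 1 & forall t, 0 < t < d -> c (curve t).
Proof.
have /choice[rsOf rsOfP] s : exists rs : seq R, span s <> fullv ->
    forall t, curve t \in span s -> t \in rs.
  have [sT|sN] := pselect (span s = fullv); first by exists [::].
  by have [rs rsP] := curve_avoids sN; exists rs.
pose rs := flatten [seq rsOf (mask (m : (size Phi).-tuple bool) Phi) | m <- enum {: (size Phi).-tuple bool}].
have [d d01 dP] := positive_gap rs; exists d => // t1 /andP[t1_gt0 t1d].
pose B : set V' := [set curve t | t in `[0, t1]%classic].
apply: (@chamber_connected x0 B) => //.
- by exists 0; rewrite /= ?in_itv /= ?lexx ?ltW // /curve big1 ?addr0 // => i _; rewrite expr0n mulr0 scale0r.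
- move=> _ [t /= t_itv <-] tw; move: t_itv; rewrite in_itv /= => /andP[t_ge0 tt1].
  have [t0|t0] := eqVneq t 0.
    apply: (chamber_sub cx0); move: tw; rewrite t0 /curve big1 ?addr0 // => i _.
    by rewrite expr0n mulr0 scale0r.
  have {t0 t_ge0}t_gt0 : 0 < t by rewrite lt0r t0.
  case: tw => nu [nuP nun] /cone_span tnu.
  have eq_nu : span nu = span (mask (map_tuple (mem nu) (in_tuple Phi)) Phi).
    apply: eq_span => b; rewrite -filter_mask mem_filter /=.
    by case: (boolP (b \in nu)) => // /nuP ->.
  have trs : t \in rs.
    apply/flattenP; exists (rsOf (mask (map_tuple (mem nu) (in_tuple Phi)) Phi)).
      by apply/mapP; exists (map_tuple (mem nu) (in_tuple Phi)); rewrite ?mem_enum.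
    apply: rsOfP; rewrite -eq_nu // => nuT.
    by have := spanning_size nuT; rewrite leqNgt nun.
  by have := dP t trs t_gt0; rewrite leNgt (le_lt_trans tt1).
- apply: connected_continuous_connected; first exact: segment_connected.
  exact/continuous_subspaceT/curve_cont.
- by exists t1; rewrite //= in_itv /= lexx ltW.
Qed.

End Curve.

(** Lists of lattice vectors are coded by a countable type, and each span that is not full excludes
    finitely many times; an interval is uncountable. *)
Theorem generic_point (ok : V' -> Prop) (e : seq V') x0 y :
    (forall b, ok b -> Zspan e b) -> c x0 -> box Phi y ->
  exists x, [/\ c x, box Phi (x - (x0 - y)) &
    forall s, (forall b, b \in s -> ok b) -> (size s < n)%N -> x \notin span s].
Proof.
move=> ok_e cx0 [tau tau01 ->]; have [d /andP[d0 d1] dc] := @curve_chamber x0 tau cx0.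
pose code (q : seq {ffun 'I_(size e) -> int}) : seq V' :=
  [seq \sum_(i < size e) e`_i *~ (z : {ffun 'I_(size e) -> int}) i | z <- q].
have /choice[rsOf rsOfP] q : exists rs : seq R, span (code q) <> fullv ->
    forall t, curve x0 tau t \in span (code q) -> t \in rs.
  have [sT|sN] := pselect (span (code q) = fullv); first by exists [::].
  by have [rs rsP] := curve_avoids x0 tau sN; exists rs.
have [|t /andP[t0 td] tN] := @uncountable_interval R d
  (\bigcup_(q in [set: seq {ffun 'I_(size e) -> int}]) [set` rsOf q]) d0.
  apply: bigcup_countable => // q _; exact/finite_set_countable/finite_seq.
exists (curve x0 tau t); split.
- by apply: dc; rewrite t0.
- by apply: curve_box => //; rewrite ltW //= (le_trans (ltW td)).
move=> s s_ok sn; apply/negP => ts; apply: tN.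
have [q sE] : exists q, s = code q.
  elim: s s_ok {sn ts} => [|b s IH] s_ok; first by exists [::].
  have [|q ->] := IH; first by move=> a as_; apply: s_ok; rewrite inE as_ orbT.
  have [z bE] := ok_e b (s_ok b (mem_head _ _)).
  by exists ([ffun i => z i] :: q); rewrite /= bE; congr (_ :: _); apply: eq_bigr => i _; rewrite ffunE.
exists q => //=; apply: rsOfP; rewrite -sE // => sT.
by have := spanning_size sT; rewrite leqNgt sn.
Qed.

End Chamber.

(** * Total residues *)

Lemma frac_repr (A : idomainType) (f : {fraction A}) :
  f = @FracField.tofrac _ (frac (repr f)).1 / @FracField.tofrac _ (frac (repr f)).2.
Proof.
have q0 := denom_ratioP (repr f).
apply: (canRL (mulfK _)); first by rewrite tofrac_eq0.
rewrite -{1}[f]reprK; move: (repr f) q0 => r q0.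
rewrite /FracField.tofrac; unlock; rewrite !piE; apply/eqmodP.
by rewrite /= FracField.equivfE /FracField.mulf !numden_Ratio ?mulf_neq0 ?oner_neq0 ?mulr1 ?mul1r // mulrC.
Qed.

(** The first equation says that p0/q0 = p/s, the second is its derivative. This allows [dirder],
    defined on a chosen representative, to be computed on any other. *)
Lemma quotient_rule_invariant (A : comNzRingType) (p0 q0 p s dp0 dq0 dp ds : A) :
    p0 * s = p * q0 -> dp0 * s + p0 * ds = dp * q0 + p * dq0 ->
  (dp0 * q0 - p0 * dq0) * s ^+ 2 = (dp * s - p * ds) * q0 ^+ 2.
Proof.
move=> e1 e2; have -> : (dp0 * q0 - p0 * dq0) * s ^+ 2 = (dp * s - p * ds) * q0 ^+ 2 +
    s * q0 * ((dp0 * s + p0 * ds) - (dp * q0 + p * dq0)) -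
    (s * dq0 + q0 * ds) * (p0 * s - p * q0) by ring.
by rewrite e1 e2 !subrr !mulr0 addr0 subr0.
Qed.

Lemma tofrac_div_eq (A : idomainType) (x q y s : A) : q != 0 -> s != 0 ->
  @FracField.tofrac _ x / @FracField.tofrac _ q = @FracField.tofrac _ y / @FracField.tofrac _ s <->
  x * s = y * q.
Proof.
move=> q0 s0; split=> [/eqP|e]; last apply/eqP.
  by rewrite eqr_div ?tofrac_eq0 // -!tofracM tofrac_eq => /eqP.
by rewrite eqr_div ?tofrac_eq0 // -!tofracM e.
Qed.

Section FractionFunctional.
Local Open Scope complex_scope.
Variables (R : realType) (V : vectType R).
Local Notation V' := 'Hom(V, R^o).
Local Notation C := R[i].
Local Notation n := (\dim {:V}).
Local Notation Poly := (mpoly.mpoly n C).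
Local Notation RatFun := {fraction Poly}.
Local Notation "p %:F" := (@FracField.tofrac _ p).
Variables (N : nat) (Phi : N.-tuple V').
Hypothesis Phi_neq0 : forall b, b \in Phi -> b != 0.
Implicit Types (s : seq V') (P Q : Poly) (f g h : RatFun).

Definition fracE P s : RatFun := P%:F / (linforms s)%:F.

Lemma linforms_neq0 s : {subset s <= Phi} -> linforms s != 0.
Proof.
move=> sP; rewrite /linforms prodf_seq_neq0; apply/allP => b bs.
exact/linform_neq0/Phi_neq0/sP.
Qed.

Lemma linforms_cat s s' : linforms (s ++ s') = linforms s * linforms s' :> Poly.
Proof. exact: big_cat. Qed.

Lemma linforms_cons b s : linforms (b :: s) = linform b * linforms s :> Poly.
Proof. exact: big_cons. Qed.

Lemma fracE_eq P Q s s' : {subset s <= Phi} -> {subset s' <= Phi} ->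
  fracE P s = fracE Q s' <-> P * linforms s' = Q * linforms s.
Proof.
move=> /linforms_neq0 s0 /linforms_neq0 s'0; split=> [/eqP|e].
  by rewrite eqr_div ?tofrac_eq0 // -!tofracM tofrac_eq => /eqP.
by apply/eqP; rewrite eqr_div ?tofrac_eq0 // -!tofracM e.
Qed.

Lemma constFM a f P s : f = fracE P s -> constF V a * f = fracE (a *: P) s.
Proof. by move=> ->; rewrite /constF /fracE mulrA -tofracM mpoly.mul_mpolyC. Qed.

Lemma subset_cat s s' : {subset s <= Phi} -> {subset s' <= Phi} -> {subset s ++ s' <= Phi}.
Proof. by move=> sP s'P b; rewrite mem_cat => /orP[/sP|/s'P]. Qed.

Lemma fracE_add P Q s s' : {subset s <= Phi} -> {subset s' <= Phi} ->
  fracE P s + fracE Q s' = fracE (P * linforms s' + Q * linforms s) (s ++ s').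
Proof.
move=> /linforms_neq0 s0 /linforms_neq0 s'0.
by rewrite /fracE addf_div ?tofrac_eq0 // -!tofracM -tofracD linforms_cat.
Qed.

Lemma dirder_polyM v P Q :
  dirder_poly v (P * Q) = dirder_poly v P * Q + P * dirder_poly v Q.
Proof.
rewrite !dirder_polyE !ddirM scalerDr scalerAl scalerAr mulrDl mulrDr.
by rewrite addrACA.
Qed.

Lemma dirder_fracE v P s : {subset s <= Phi} -> dirder v (fracE P s) =
  fracE (dirder_poly v P * linforms s - P * dirder_poly v (linforms s)) (s ++ s).
Proof.
move=> sP; have s0 := linforms_neq0 sP; rewrite /dirder.
have q0 := denom_ratioP (repr (fracE P s)); have := frac_repr (fracE P s).
move: (frac (repr _)).1 (frac (repr _)).2 q0 => p q q0 /(tofrac_div_eq _ _ s0 q0) e1.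
apply/tofrac_div_eq; [by rewrite expf_neq0 | by rewrite linforms_cat mulf_neq0 |].
rewrite linforms_cat; apply: quotient_rule_invariant; first exact/esym.
by rewrite -!dirder_polyM e1.
Qed.

Lemma Cspan_mem (S : set RatFun) f : S f -> Cspan S f.
Proof.
by move=> Sf; exists 1%N, (fun=> 1), (fun=> f); rewrite big_ord1 /constF mpoly.mpolyC1 tofrac1 mul1r.
Qed.

Lemma Cspan_lin (S : set RatFun) a f g :
  Cspan S f -> Cspan S g -> Cspan S (constF V a * f + g).
Proof.
move=> [r [b [h [hS ->]]]] [r' [b' [h' [h'S ->]]]].
exists (r + r')%N, (fun i => match fintype.split i with inl j => a * b j | inr j => b' j end),
  (fun i => match fintype.split i with inl j => h j | inr j => h' j end).
split=> [i|]; first by case: fintype.split.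
rewrite big_split_ord mulr_sumr /=; congr (_ + _); apply: eq_bigr => i _.
  rewrite -[lshift _ _]/(unsplit (inl i)) unsplitK mulrA.
  by rewrite /constF -tofracM -mpoly.mpolyCM.
by rewrite -[rshift _ _]/(unsplit (inr i)) unsplitK.
Qed.

Local Notation hom d P := (P \is mpoly.ishomog1 d mpoly.mdeg).

Lemma hom_mderiv d (j : 'I_n) P : hom d P ->
  if d is d'.+1 then hom d' (mpoly.mderiv j P) else mpoly.mderiv j P = 0.
Proof.
move=> Pd; rewrite [P]mpoly.mpolyE raddf_sum /= big_seq.
have mono m : m \in mpoly.msupp P -> if d is d'.+1
    then hom d' (mpoly.mderiv j (mpoly.mcoeff m P *: mpoly.mpolyX C m))
    else mpoly.mderiv j (mpoly.mcoeff m P *: mpoly.mpolyX C m) = 0.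
  move=> mP; have md : mpoly.mdeg m = d := mpoly.dhomog_mf Pd mP.
  rewrite mpoly.mderivZ mpoly.mderivX; have [m0|mj] := eqVneq (m j) 0%N.
    by rewrite m0 scale0r scaler0; case: (d) => // d'; exact: mpoly.dhomog0.
  have mE : m = mpoly.mnm_add (mpoly.mnm_sub m (mpoly.mnm1 j)) (mpoly.mnm1 j).
    rewrite mpoly.submK //; apply/mpoly.mnm_lepP => i; rewrite mpoly.mnm1E.
    by case: eqP => [<-|//]; rewrite lt0n.
  move: md; rewrite {1}mE mpoly.mdegD mpoly.mdeg1 addn1 => <-.
  by apply: mpoly.dhomogZ; apply: mpoly.dhomogZ; rewrite mpoly.dhomogX.
case: d Pd mono => [|d] Pd mono.
  by rewrite big1 // => m; exact: mono.
by apply: (big_ind (fun Q : Poly => hom d Q)) => [|x y|m];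
  [exact: mpoly.dhomog0 | exact: mpoly.dhomogD | exact: mono].
Qed.

Lemma hom_ddir d t P : hom d P -> if d is d'.+1 then hom d' (ddir t P) else ddir t P = 0.
Proof.
move=> Pd; have h j := hom_mderiv j Pd; rewrite /ddir; case: d {Pd} h => [|d] h.
  by rewrite big1 // => j _; rewrite h scaler0.
apply: (big_ind (fun Q : Poly => hom d Q)) => [|x y|j _]; [exact: mpoly.dhomog0 | exact: mpoly.dhomogD |].
by apply: mpoly.dhomogZ; exact: h.
Qed.

Lemma hom0_const P : hom 0 P -> P = mpoly.mpolyC n (mpoly.mcoeff mpoly.mnm0 P).
Proof.
move=> P0; apply/mpoly.mpolyP => m; rewrite mpoly.mcoeffC.
have [->|m0] := eqVneq m mpoly.mnm0; first by rewrite mulr1.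
rewrite mulr0; apply: (mpoly.dhomog_nemf_coeff P0).
by rewrite mpoly.mdeg_eq0.
Qed.

Lemma ddir_linforms0 s v : (forall b, b \in s -> b v = 0) -> ddir v (linforms s) = 0.
Proof.
elim: s => [|b s IH] sv; first by rewrite /linforms big_nil -mpoly.mpolyC1 ddirC.
rewrite linforms_cons ddirM ddir_linform sv ?mem_head // IH.
  rewrite [X in X * _ + _](_ : _ = 0) ?mul0r ?mulr0 ?addr0 //; exact: mpoly.mpolyC0.
by move=> a as_; apply: sv; rewrite inE as_ orbT.
Qed.

Lemma fracE_lin a P Q s : constF V a * fracE P s + fracE Q s = fracE (a *: P + Q) s.
Proof. by rewrite (constFM a (erefl (fracE P s))) /fracE -mulrDl -tofracD. Qed.

Lemma fracE0 s : fracE 0 s = 0.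
Proof. by rewrite /fracE tofrac0 mul0r. Qed.

Lemma Cspan0 (S : set RatFun) : Cspan S 0.
Proof. by exists 0%N, (fun=> 0), (fun=> 0); split=> [[]//|]; rewrite big_ord0. Qed.

Lemma dirder_real v P : dirder_poly ((v, 0) : complexified V) P = ddir v P.
Proof.
rewrite dirder_polyE /= [ddir 0 P]big1 ?scaler0 ?addr0 // => j _.
by rewrite linear0 scale0r.
Qed.

Lemma ddir_linformX v (l : V') k : (l v : R) = 1 ->
  ddir v (linform l ^+ k.+1) = k.+1%:R *: linform l ^+ k.
Proof.
move=> lv; have dl : ddir v (linform l) = 1.
  by rewrite ddir_linform lv mpoly.mpolyC1.
elim: k => [|k IH]; first by rewrite expr1 dl scale1r.
rewrite exprS ddirM IH dl mul1r -scalerAr -exprS -[k.+2]/(1 + k.+1)%N natrD.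
by rewrite scalerDl scale1r.
Qed.

(* Repeated integration by parts against [l^k / k!] along [v]. *)
Lemma derivR_killed d P s v (l : V') k : hom d P -> {subset s <= Phi} ->
    (forall b, b \in s -> b v = 0) -> (l v : R) = 1 ->
  derivR Phi (fracE (linform l ^+ k * P) s).
Proof.
move=> + sP sv lv; elim: d P k => [|d IH] P k Pd; have := hom_ddir v Pd => dP.
all: have IH' j : derivR Phi (fracE (linform l ^+ j * ddir v P) s)
  by [rewrite dP mulr0 fracE0; exact: Cspan0 | exact: IH].
all: have DE Q : dirder ((v, 0) : complexified V) (fracE Q s) = fracE (ddir v Q) s
  by rewrite dirder_fracE // !dirder_real ddir_linforms0 // mulr0 subr0;
     apply/fracE_eq => //; [exact: subset_cat | rewrite linforms_cat mulrA].
all: have k0 : k.+1%:R != 0 :> C by rewrite pnatr_eq0.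
all: have -> : linform l ^+ k * P = (k.+1%:R)^-1 *: ddir v (linform l ^+ k.+1 * P) +
    ((- (k.+1%:R)^-1) *: (linform l ^+ k.+1 * ddir v P) + 0)
  by rewrite ddirM ddir_linformX // scalerDr -scalerAl scalerA mulVf // scale1r addr0
    scaleNr addrK.
all: rewrite -fracE_lin -fracE_lin fracE0 -DE; apply: Cspan_lin.
all: try by apply: Cspan_lin; [exact: IH' | exact: Cspan0].
all: apply: Cspan_mem; exists ((v, 0) : complexified V), (fracE (linform l ^+ k.+1 * P) s).
all: by split=> //; exists (linform l ^+ k.+1 * P), s.
Qed.

Definition reducible f := exists2 g, spaceS Phi g & derivR Phi (f - g).

Lemma reducible_lin a f g : reducible f -> reducible g -> reducible (constF V a * f + g).
Proof.
move=> [f' f'S fD] [g' g'S gD]; exists (constF V a * f' + g'); first exact: Cspan_lin.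
have -> : constF V a * f + g - (constF V a * f' + g') = constF V a * (f - f') + (g - g').
  by rewrite mulrBr opprD addrACA.
exact: Cspan_lin.
Qed.

Lemma reducible_derivR f : derivR Phi f -> reducible f.
Proof. by move=> fD; exists 0; rewrite ?subr0 //; exact: Cspan0. Qed.

Lemma reducible_spaceS f : spaceS Phi f -> reducible f.
Proof. by move=> fS; exists f; rewrite ?subrr //; exact: Cspan0. Qed.

Lemma fracE_rem b P s : {subset s <= Phi} -> b \in s ->
  fracE (linform b * P) s = fracE P (rem b s).
Proof.
move=> sP bs; have rP : {subset rem b s <= Phi} by move=> a /mem_rem/sP.
apply/fracE_eq => //; rewrite {2}/linforms (perm_big _ (perm_to_rem bs)) big_cons.
by rewrite -/(linforms _) mulrAC mulrC.
Qed.

(* On a spanning [s], Euler's identity lowers the degree of [P] and the number of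
   poles; otherwise [P / prod s] has an antiderivative along a vector killed by [s]. *)
Lemma reducible_fracE d P s : hom d P -> size s = (n + d)%N -> {subset s <= Phi} ->
  reducible (fracE P s).
Proof.
have [m] := ubnP d; elim: m d P s => // m IH d P s dm Pd sn sP.
have [sT|] := pselect (span s = fullv); last first.
  move=> /nonspanning_annihilator[v v0 sv].
  have [j vj] : exists j, coord (vbasis {:V}) j v != 0.
    apply: contrapT => none; move/eqP: v0; apply; rewrite (coord_vbasis (memvf v)).
    apply: big1 => j _; suff -> : coord (vbasis {:V}) j v = 0 by rewrite scale0r.
    by apply: contrapT => /eqP ?; apply: none; exists j.
  have := @derivR_killed d P s v ((coord (vbasis {:V}) j v)^-1 *: cov j) 0 Pd sP sv.
  rewrite expr0 mul1r => h; apply/reducible_derivR/h.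
  rewrite lfunE /= covE; exact: mulVf.
case: d dm Pd sn => [|d] dm Pd sn.
  rewrite addn0 in sn; apply: reducible_spaceS.
  rewrite (hom0_const Pd) -[mpoly.mpolyC n _]mulr1 mpoly.mul_mpolyC.
  rewrite -(@constFM _ (fracE 1 s)) // -[_ * _]addr0.
  have sz : size s == n by rewrite sn.
  apply: Cspan_lin; [apply: Cspan_mem | exact: Cspan0].
  exists (Tuple sz); last by rewrite /fracE tofrac1 mul1r.
  by split=> //; exact: spanning_free.
have [t tE] := dual_system sT.
have d0 : d.+1%:R != 0 :> C by rewrite pnatr_eq0.
have PE : P = (d.+1%:R)^-1 *: (\sum_(b <- undup s) linform b * ddir (t b) P) + 0.
  by rewrite -(eulerE P tE) (euler_homog Pd) scalerA mulVf // scale1r addr0.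
have red0 : reducible (fracE 0 s).
  by rewrite fracE0; apply: reducible_spaceS; exact: Cspan0.
rewrite PE -fracE_lin; apply: reducible_lin => //.
rewrite big_seq; apply: (big_ind (fun Q : Poly => reducible (fracE Q s))) => // [Q Q' hQ hQ'|b].
  by rewrite -[Q]scale1r -fracE_lin; exact: reducible_lin.
rewrite mem_undup => bs; rewrite fracE_rem //; apply: (IH d) => //.
- exact: (hom_ddir (t b) Pd).
- by rewrite size_rem // sn addnS.
- by move=> a /mem_rem/sP.
Qed.

Section Functional.
Variable LL : seq V' -> Poly -> C.
Hypothesis LL_lin : forall s a P Q, LL s (a *: P + Q) = a * LL s P + LL s Q.
Hypothesis LL_cat : forall s s' P, {subset s ++ s' <= Phi} ->
  LL (s ++ s') (linforms s * P) = LL s' P.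
Hypothesis LL_perm : forall s s' P, {subset s <= Phi} -> perm_eq s s' -> LL s P = LL s' P.
Hypothesis LL_ddir : forall s (v : V) P, {subset s <= Phi} ->
  LL s (ddir v P) = \sum_(b <- s) ((b : V') v : R)%:C * LL (b :: s) P.

(* [P / prod s |-> LL s P], well defined by [LL_fracE]. *)
Definition LLfrac f : C := xget 0 [set z | exists P s,
  [/\ {subset s <= Phi}, f = fracE P s & z = LL s P]].

Lemma LL_fracE P Q s s' : {subset s <= Phi} -> {subset s' <= Phi} ->
  fracE P s = fracE Q s' -> LL s P = LL s' Q.
Proof.
move=> sP s'P /(fracE_eq _ _ sP s'P) e.
rewrite -(@LL_cat s' s P (subset_cat s'P sP)) mulrC e mulrC.
rewrite (LL_perm _ (subset_cat s'P sP) (permEl (perm_catC s' s))).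
exact/LL_cat/subset_cat.
Qed.

Lemma LLfracE P s : {subset s <= Phi} -> LLfrac (fracE P s) = LL s P.
Proof.
move=> sP; rewrite /LLfrac; case: xgetP => [z _ [Q [s' [s'P e ->]]]|/(_ (LL s P)) none].
  by apply: LL_fracE.
by case: none; exists P, s.
Qed.

Lemma LL0 s : LL s 0 = 0.
Proof. by have := LL_lin s (-1) 0 0; rewrite scaler0 addr0 mulN1r addNr. Qed.

Lemma LLD s P Q : LL s (P + Q) = LL s P + LL s Q.
Proof. by rewrite -[P]scale1r LL_lin mul1r scale1r. Qed.

Lemma LLZ s a P : LL s (a *: P) = a * LL s P.
Proof. by rewrite -[a *: P]addr0 LL_lin LL0 addr0. Qed.

Lemma LLB s P Q : LL s (P - Q) = LL s P - LL s Q.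
Proof. by rewrite LLD -scaleN1r LLZ mulN1r. Qed.

Lemma LL_catl s s' Q : {subset s <= Phi} -> {subset s' <= Phi} ->
  LL (s ++ s') (Q * linforms s) = LL s' Q.
Proof. by move=> sP s'P; rewrite mulrC LL_cat //; exact: subset_cat. Qed.

Lemma LL_catr s s' P : {subset s <= Phi} -> {subset s' <= Phi} ->
  LL (s ++ s') (P * linforms s') = LL s P.
Proof.
move=> sP s'P; rewrite (LL_perm _ (subset_cat sP s'P) (permEl (perm_catC s s'))).
exact: LL_catl.
Qed.

Lemma LLfrac_lin a f g : ringR Phi f -> ringR Phi g ->
  LLfrac (constF V a * f + g) = a * LLfrac f + LLfrac g.
Proof.
move=> [P [s [sP fE]]] [Q [s' [s'P gE]]].
rewrite (constFM a fE) gE fE -/(fracE P s) -/(fracE Q s') fracE_add //.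
rewrite !LLfracE //; last exact: subset_cat.
by rewrite LLD LL_catl // LL_catr // LLZ.
Qed.

Lemma ringR_lin a f g : ringR Phi f -> ringR Phi g -> ringR Phi (constF V a * f + g).
Proof.
move=> [P [s [sP fE]]] [Q [s' [s'P gE]]]; rewrite (constFM a fE) gE fracE_add //.
by exists (a *: P * linforms s' + Q * linforms s), (s ++ s'); split; first exact: subset_cat.
Qed.

Lemma ringR_dirder v f : ringR Phi f -> ringR Phi (dirder v f).
Proof.
move=> [P [s [sP ->]]]; rewrite -/(fracE P s) dirder_fracE //.
by eexists; exists (s ++ s); split; first exact: subset_cat.
Qed.

(** By the Leibniz rule, each term of the derivative of [prod s1] lacks one factor [b], which
    therefore survives in the denominator. *)
Lemma LL_cat_ddir s1 s t P : {subset s1 <= Phi} -> {subset s <= Phi} ->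
  LL (s1 ++ s) (P * ddir t (linforms s1)) =
  \sum_(b <- s1) ((b : V') t : R)%:C * LL (b :: s) P.
Proof.
elim: s1 s P => [|a s1 IH] s P s1P sP.
  by rewrite /linforms big_nil -mpoly.mpolyC1 ddirC mulr0 LL0 big_nil.
have aP : a \in Phi by apply: s1P; exact: mem_head.
have s1P' : {subset s1 <= Phi} by move=> b bs; apply: s1P; rewrite inE bs orbT.
have asP : {subset a :: s <= Phi} by move=> b; rewrite inE => /predU1P[->|/sP].
have s1sP : {subset s1 ++ s <= Phi} by exact: subset_cat.
have as1P : {subset [:: a] <= Phi} by move=> b; rewrite inE => /eqP ->.
rewrite linforms_cons ddirM ddir_linform big_cons mulrDr LLD; congr (_ + _).
  rewrite mpoly.mul_mpolyC -scalerAr LLZ; congr (_ * _).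
  rewrite (@LL_perm _ (s1 ++ (a :: s))); last first.
  - by rewrite -[(a :: s1) ++ s]/([:: a] ++ s1 ++ s) -[a :: s]/([:: a] ++ s) perm_catCA.
  - exact: subset_cat.
  - exact: LL_catl.
rewrite mulrCA; have := @LL_cat [:: a] (s1 ++ s) (P * ddir t (linforms s1)).
rewrite /linforms big_seq1 -/(linforms s1) => ->; first exact: IH.
exact: subset_cat.
Qed.

(** This is [LL_ddir] through the quotient rule; a complex direction is split into its real and
    imaginary parts. *)
Lemma LLfrac_dirder v f : ringR Phi f -> LLfrac (dirder v f) = 0.
Proof.
move=> [P [s [sP ->]]]; rewrite -/(fracE P s) dirder_fracE // LLfracE; last exact: subset_cat.
have key t : LL (s ++ s) (ddir t P * linforms s - P * ddir t (linforms s)) = 0.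
  by rewrite LLB LL_catl // LL_cat_ddir // LL_ddir // subrr.
have -> : dirder_poly v P * linforms s - P * dirder_poly v (linforms s) =
    (ddir v.1 P * linforms s - P * ddir v.1 (linforms s)) +
    'i *: (ddir v.2 P * linforms s - P * ddir v.2 (linforms s)).
  rewrite !dirder_polyE mulrDl mulrDr opprD addrACA; congr (_ + _).
  by rewrite scalerBr scalerAl scalerAr.
rewrite LLD (key v.1) add0r LLZ (key v.2); exact: mulr0.
Qed.

Lemma LLfrac0 : LLfrac 0 = 0.
Proof.
have -> : 0 = fracE 0 [::] by rewrite /fracE tofrac0 mul0r.
by rewrite LLfracE // LL0.
Qed.

Lemma ringR0 : ringR Phi 0.
Proof. by exists 0, [::]; split=> //; rewrite tofrac0 mul0r. Qed.

Lemma LLfrac_sum r (a : 'I_r -> C) (g : 'I_r -> RatFun) : (forall i, ringR Phi (g i)) ->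
  ringR Phi (\sum_(i < r) constF V (a i) * g i) /\
  LLfrac (\sum_(i < r) constF V (a i) * g i) = \sum_(i < r) a i * LLfrac (g i).
Proof.
move=> gR; apply: (big_rec2 (fun x z => ringR Phi x /\ LLfrac x = z)).
  by split; [exact: ringR0 | exact: LLfrac0].
by move=> i x z _ [xR <-]; split; [exact: ringR_lin | exact: LLfrac_lin].
Qed.

Lemma ringR_fsigma (s : n.-tuple V') : bases Phi s -> ringR Phi (fsigma s).
Proof. by move=> [sP _]; exists 1, s; split=> //; rewrite tofrac1 mul1r. Qed.

Lemma LLfrac_fsigma (s : n.-tuple V') : bases Phi s -> LLfrac (fsigma s) = LL s 1.
Proof.
move=> [sP _]; rewrite -LLfracE //; congr (LLfrac _).
by rewrite /fracE tofrac1 mul1r.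
Qed.

Lemma spaceS_ringR f : spaceS Phi f -> ringR Phi f.
Proof.
move=> [r [a [g [gS ->]]]]; apply: (LLfrac_sum a _).1 => i.
by have [s sb <-] := gS i; exact: ringR_fsigma.
Qed.

Lemma LLfrac_derivR f : derivR Phi f -> ringR Phi f /\ LLfrac f = 0.
Proof.
move=> [r [a [g [gS ->]]]]; have [|h1 h2] := @LLfrac_sum r a g.
  by move=> i; have [v [h [hR ->]]] := gS i; exact: ringR_dirder.
split=> //; rewrite h2 big1 // => i _; have [v [h [hR ->]]] := gS i.
by rewrite LLfrac_dirder // mulr0.
Qed.

Lemma constF1 : constF V 1 = 1.
Proof. by rewrite /constF mpoly.mpolyC1 tofrac1. Qed.

(** Since [LLfrac] kills derivatives, it gives [f] and the [T] selected in [Tres] the same value,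
    whichever [T] that is. *)
Lemma LLfrac_Tres f T : spaceS Phi T -> derivR Phi (f - T) -> LLfrac T = LLfrac f.
Proof.
move=> /spaceS_ringR TR /LLfrac_derivR[fTR fT0].
by rewrite -[in RHS](subrK T f) -[f - T]mul1r -constF1 LLfrac_lin // fT0 mulr0 add0r.
Qed.

Lemma LLfrac_Tres_fracE P s : {subset s <= Phi} -> (n <= size s)%N -> hom (size s - n) P ->
  spaceS Phi (Tres Phi (fracE P s)) /\ LLfrac (Tres Phi (fracE P s)) = LL s P.
Proof.
move=> sP ns Pd; have [|g gS gD] := reducible_fracE Pd _ sP; first by rewrite subnKC.
rewrite /Tres; case: xgetP => [T _ [TS TD]|/(_ g) []//].
by split=> //; rewrite (LLfrac_Tres TS TD) LLfracE.
Qed.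

Section JeffreyKirwan.
Variables (mu : {measure set (borel V') -> \bar R}) (c : set V').
Hypothesis LL_weight : forall s : n.-tuple V', bases Phi s ->
  (c `<=` cone s -> LL s 1 = ((fine (mu (box s)))^-1)%:C) /\
  (c `&` cone s = set0 -> LL s 1 = 0).
Hypothesis chamber_cone : forall s : n.-tuple V', bases Phi s ->
  c `<=` cone s \/ c `&` cone s = set0.

Lemma LLfrac_JK : is_JK Phi mu c LLfrac.
Proof.
split=> [a f g /spaceS_ringR fR /spaceS_ringR gR|s sb]; first exact: LLfrac_lin.
by rewrite LLfrac_fsigma //; exact: LL_weight.
Qed.

(** [LLfrac] shows that the choice in [JK] is made from a nonempty set; the functional chosen agrees
    with it on the f_sigma, which span [spaceS]. *)
Lemma JK_LLfrac f : spaceS Phi f -> JK Phi mu c f = LLfrac f.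
Proof.
rewrite /JK; case: xgetP => [J _ [J_lin J_w]|/(_ LLfrac) []]; last exact: LLfrac_JK.
have S0 : spaceS Phi 0.
  by exists 0%N, (fun=> 0), (fun=> 0); split=> [[]//|]; rewrite big_ord0.
have J0 : J 0 = 0.
  have := J_lin 1 0 0 S0 S0; rewrite mulr0 addr0 mul1r => /eqP.
  by rewrite -subr_eq0 opprD addrA subrr sub0r oppr_eq0 => /eqP.
move=> [r [a [g [gS ->]]]].
have gR i : ringR Phi (g i) by have [s sb <-] := gS i; exact: ringR_fsigma.
rewrite (LLfrac_sum a gR).2.
have Jg i : J (g i) = LLfrac (g i).
  have [s sb <-] := gS i; rewrite LLfrac_fsigma //.
  have [w1 w2] := LL_weight sb; have [j1 j2] := J_w s sb.
  by case: (chamber_cone sb) => cs; [rewrite w1 // j1 | rewrite w2 // j2].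
suff : spaceS Phi (\sum_(i < r) constF V (a i) * g i) /\
  J (\sum_(i < r) constF V (a i) * g i) = \sum_(i < r) a i * LLfrac (g i) by case.
apply: (big_rec2 (fun x z => spaceS Phi x /\ J x = z)) => // i x z _ [xS <-]; split.
  apply: Cspan_lin => //; apply: Cspan_mem; exact: gS.
by rewrite J_lin ?Jg //; apply: Cspan_mem; exact: gS.
Qed.

End JeffreyKirwan.

End Functional.
End FractionFunctional.

(** * Total residues of quotients of power series *)

Section AbstractSeries.
Variables (R : realType) (V : vectType R).
Local Notation V' := 'Hom(V, R^o).
Local Notation n := (\dim {:V}).
Variables (K : numFieldType) (iota : {rmorphism R -> K}) (A : comAlgType K).
Variables (lin : V' -> A) (ddir : V -> {linear A -> A}).
Variables (ok : V' -> Prop) (LL : seq V' -> {linear A -> K^o}).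
Hypothesis rf : residue_functional iota lin ddir ok LL.
Implicit Types (s : seq V') (b : V') (u : V' -> K).

Lemma residue_small s (a : A) : (size s < n)%N -> LL s a = 0.
Proof. by case: rf => h _ _ _; exact: h. Qed.

Lemma residue_cons b s (a : A) : ok b -> (forall b', b' \in s -> ok b') ->
  LL (b :: s) (lin b * a) = LL s a.
Proof. by case: rf => _ h _ _; exact: h. Qed.

Lemma residue_perm s s' (a : A) : (forall b, b \in s -> ok b) -> perm_eq s s' ->
  LL s a = LL s' a.
Proof. by case: rf => _ _ h _; exact: h. Qed.

Lemma residue_ddir s v (a : A) : (forall b, b \in s -> ok b) ->
  LL s (ddir v a) = \sum_(b <- s) iota (b v) * LL (b :: s) a.
Proof. by case: rf => _ _ _ h; exact: h. Qed.

Lemma factor_units_unit u s : \prod_(b <- s) factor_unit lin (u b) b \is a GRing.unit.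
Proof.
apply: (big_ind (fun P : fps A => P \is a GRing.unit)) => [|P Q|b _].
- exact: unitr1.
- by move=> hP hQ; rewrite unitrMl.
- exact: factor_unit_unit.
Qed.

Lemma unitsE u s : units lin u s = (\prod_(b <- s) factor_unit lin (u b) b)^-1.
Proof.
rewrite /units; elim: s => [|b s IH]; first by rewrite !big_nil invr1.
rewrite !big_cons IH invrM ?factor_unit_unit ?factor_units_unit //.
by rewrite mulrC.
Qed.

Lemma Lfps_cat s s' (P : fps A) : (forall b, b \in s -> ok b) -> (forall b, b \in s' -> ok b) ->
  Lfps LL (s ++ s') (\prod_(b <- s) tlin lin b * P) = Lfps LL s' P.
Proof.
move=> + s'P; elim: s => [|b s IH] sP; first by rewrite big_nil mul1r.
have sP' a : a \in s -> ok a by move=> as_; apply: sP; rewrite inE as_ orbT.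
rewrite big_cons -mulrA /= (Lfps_cons rf); first exact: IH.
  by apply: sP; exact: mem_head.
by move=> a; rewrite mem_cat => /orP[/sP'|/s'P].
Qed.

(** Independence of the presentation: both quotients are brought to the common denominator
    [s0 ++ s], after division by the invertible factors. *)
Lemma Lfps_quotient u s s0 r (E P : fps A) : (forall b, b \in s -> ok b) ->
    (forall b, b \in s0 -> ok b) ->
    E * \prod_(b <- s) tlin lin b =
      P * (\prod_(b <- s0) tlin lin b * \prod_(b <- r) factor_unit lin (u b) b) ->
  Lfps LL s P = Lfps LL s0 (E * units lin u r).
Proof.
move=> sP s0P e; rewrite -(Lfps_cat P s0P sP).
have U_unit := factor_units_unit u r.
have -> : \prod_(b <- s0) tlin lin b * P = \prod_(b <- s) tlin lin b * (E * units lin u r).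
  rewrite unitsE; move: e U_unit; set S0 := \prod_(b <- s0) _; set S := \prod_(b <- s) _.
  set U := \prod_(b <- r) _ => e U_unit; apply: (mulIr U_unit).
  rewrite [LHS](_ : _ = P * (S0 * U)); last by rewrite mulrAC mulrC.
  by rewrite -e -!mulrA mulVr // mulr1 mulrC.
rewrite (Lfps_perm rf _ _ (permEl (perm_catC s0 s))); first exact: Lfps_cat.
by move=> a; rewrite mem_cat => /orP[/s0P|/sP].
Qed.

Lemma unit_factorization u r s0 (E : fps A) :
  E * \prod_(b <- s0) tlin lin b =
  E * units lin u r * (\prod_(b <- s0) tlin lin b * \prod_(b <- r) factor_unit lin (u b) b).
Proof.
have U_unit := factor_units_unit u r; rewrite unitsE.
by rewrite mulrACA mulVr // mulr1.
Qed.

End AbstractSeries.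

Section SeriesResidue.
Local Open Scope complex_scope.
Variables (R : realType) (V : vectType R).
Local Notation V' := 'Hom(V, R^o).
Local Notation C := R[i].
Local Notation n := (\dim {:V}).
Local Notation Poly := (mpoly.mpoly n C).
Local Notation lin := (@linform R V).
Local Notation hom d P := (P \is mpoly.ishomog1 d mpoly.mdeg).
Implicit Types (s : seq V') (l b : V') (P Q : fps Poly).

Definition ddirL (t : V) : {linear Poly -> Poly} := ddir t.

Lemma hom_linformX l k : hom k (linform l ^+ k).
Proof.
have l1 : hom 1 (linform l).
  apply: (big_ind (fun q : Poly => hom 1 q)) => [|x y|j _]; [exact: mpoly.dhomog0 | exact: mpoly.dhomogD |].
  by apply: mpoly.dhomogZ; rewrite mpoly.dhomogX; apply/eqP; exact: mpoly.mdeg1.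
by have := mpoly.dhomogMn k l1; rewrite mul1n.
Qed.

Lemma is_series_mul P Q : is_series P -> is_series Q -> is_series (P * Q : fps Poly).
Proof.
move=> hP hQ k; rewrite fpsME.
apply: (big_ind (fun q : Poly => hom k q)) => [|x y|i _]; [exact: mpoly.dhomog0 | exact: mpoly.dhomogD |].
have := mpoly.dhomogM (hP i) (hQ (k - i)%N).
by rewrite subnKC // -ltnS.
Qed.

Lemma is_series_opp P : is_series P -> is_series (- P : fps Poly).
Proof. by move=> hP k; rewrite fpsNE mpoly.dhomogN; exact: hP. Qed.

Lemma is_series_add P Q : is_series P -> is_series Q -> is_series (P + Q : fps Poly).
Proof. by move=> hP hQ k; rewrite fpsDE; apply: mpoly.dhomogD; [exact: hP | exact: hQ]. Qed.

Lemma is_series1 : is_series (1 : fps Poly).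
Proof. by case=> [|k]; rewrite fps1E; [exact: mpoly.dhomog1 | exact: mpoly.dhomog0]. Qed.

Lemma is_series_scale (a : C) P : is_series P -> is_series (fpsC (a%:A : Poly) * P : fps Poly).
Proof. by move=> hP k; rewrite fpsCM mulr_algl; apply: mpoly.dhomogZ; exact: hP. Qed.

Lemma is_series_exp l : is_series (fps_exp lin l : fps Poly).
Proof. by move=> k; apply: mpoly.dhomogZ; exact: hom_linformX. Qed.

Lemma is_series_inv P (a : C) : a != 0 -> P 0%N = a%:A -> is_series P -> is_series (GRing.inv P : fps Poly).
Proof.
move=> a0 P0 hP.
have Pu : P \is a GRing.unit.
  apply: (@fps_unit_const _ _ (a^-1)%:A).
  by rewrite P0 mulr_algl scalerA divff // scale1r.
have VE k : (GRing.inv P) k = a^-1 *: ((1 : fps Poly) k - \sum_(i < k) P i.+1 * (GRing.inv P) (k - i.+1)%N).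
  have := congr1 (fun q : fps Poly => q k) (divrr Pu).
  rewrite fpsME big_ord_recl /= P0 mulr_algl subn0 => <-.
  by rewrite addrK scalerA mulVf // scale1r.
move=> k; have [m] := ubnP k; elim: m k => // m IH k km.
rewrite VE; apply: mpoly.dhomogZ; apply: mpoly.dhomogD; first exact: is_series1.
rewrite mpoly.dhomogN.
apply: (big_ind (fun q : Poly => hom k q)) => [|x y|i _]; [exact: mpoly.dhomog0 | exact: mpoly.dhomogD |].
have ik : (k - i.+1 < m)%N.
  by rewrite -ltnS (leq_trans _ km) // ltnS ltn_subLR ?ltn_ord // addSn ltnS leq_addl.
by have := mpoly.dhomogM (hP i.+1) (IH _ ik); rewrite subnKC // ltn_ord.
Qed.

(** Homogeneity of the components makes [fps_exp l * units] an admissible numerator in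
    [Tres_quotient]. *)
Lemma is_series_units (chi : V' -> C) s : is_series (units lin chi s : fps Poly).
Proof.
apply: (big_ind (fun P : fps Poly => is_series P)) => [|P Q|b _].
- exact: is_series1.
- exact: is_series_mul.
rewrite /factor_unit; case: eqP => [_|/eqP u1].
  apply: (@is_series_inv _ 1); first exact: oner_neq0.
    by rewrite /fps_expm1 expr0 factS fact0 invr1 scale1r.
  by move=> k; apply: mpoly.dhomogZ; exact: hom_linformX.
apply: (@is_series_inv _ (1 - chi b)); first by rewrite subr_eq0 eq_sym.
  rewrite fpsDE fpsNE fps1E fpsCM mulr_algl /fps_exp expr0 fact0 invr1 scale1r.
  by rewrite scalerBl scale1r.
apply: is_series_add; first exact: is_series1.
by apply/is_series_opp/is_series_scale/is_series_exp.
Qed.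

Lemma series_linformsE s : series_linforms s = \prod_(b <- s) tlin lin b :> fps Poly.
Proof.
elim: s => [|b s IH].
  apply/funext => k; rewrite big_nil fps1E /series_linforms /linforms big_nil.
  by case: k.
rewrite big_cons -IH; apply/funext => k; rewrite tlinM /series_linforms /=.
by case: k => [//|k]; rewrite eqSS; case: ifP => _; rewrite ?mulr0 // /linforms big_cons.
Qed.

Lemma series_factorE (u : C) b : series_factor u b =
  1 - fpsC (u%:A : Poly) * fps_exp lin (- b) :> fps Poly.
Proof.
apply/funext => k; rewrite fpsDE fpsNE fpsCM mulr_algl fps1E.
by rewrite /series_factor /series1; case: k.
Qed.

Lemma series_prodE (u : V' -> C) s :
  \big[@series_mul R V/@series1 R V]_(b <- s) series_factor (u b) b =
  \prod_(b <- poles u s) tlin lin b * \prod_(b <- s) factor_unit lin (u b) b :> fps Poly.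
Proof.
rewrite /poles big_filter big_mkcond -big_split /=.
elim: s => [|b s IH]; first by rewrite !big_nil.
rewrite [LHS]big_cons [RHS]big_cons IH series_factorE (factor_unitE (@linformD R V)).
by [].
Qed.

Section Quotient.
Variables (N : nat) (Phi : N.-tuple V').
Hypothesis Phi_neq0 : forall b, b \in Phi -> b != 0.
Variables (ok : V' -> Prop) (LL : seq V' -> {linear Poly -> C^o}).
Hypothesis rf : residue_functional (real_complex R) lin ddirL ok LL.
Hypothesis Phi_ok : forall b, b \in Phi -> ok b.
Let LLf s (P : Poly) : C := LL s P.

Let sub_ok s : {subset s <= Phi} -> forall b, b \in s -> ok b.
Proof. by move=> sP b /sP/Phi_ok. Qed.

Let LL_lin s a (P Q : Poly) : LLf s (a *: P + Q) = a * LLf s P + LLf s Q.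
Proof. by rewrite /LLf linearP. Qed.

Let LL_cat s s' (P : Poly) : {subset s ++ s' <= Phi} -> LLf (s ++ s') (linforms s * P) = LLf s' P.
Proof.
elim: s => [|b s IH] sP; first by rewrite /linforms big_nil mul1r.
have sP' : {subset s ++ s' <= Phi} by move=> a as_; apply: sP; rewrite inE as_ orbT.
have bP : ok b by apply/Phi_ok/sP; exact: mem_head.
rewrite linforms_cons -mulrA -(IH sP').
exact (residue_cons rf (linforms s * P) bP (sub_ok sP')).
Qed.

Let LL_perm s s' (P : Poly) : {subset s <= Phi} -> perm_eq s s' -> LLf s P = LLf s' P.
Proof. move=> sP ss'; exact (residue_perm rf P (sub_ok sP) ss'). Qed.

Let LL_ddir s (v : V) (P : Poly) : {subset s <= Phi} ->
  LLf s (ddir v P) = \sum_(b <- s) ((b : V') v : R)%:C * LLf (b :: s) P.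
Proof.
move=> sP; have h1 := residue_ddir rf v P (sub_ok sP).
rewrite /LLf; etransitivity; [exact h1|]; apply: eq_bigr => b _; reflexivity.
Qed.

Lemma Tres_series_LL P s : is_series P -> {subset s <= Phi} ->
  spaceS Phi (Tres_series Phi P s) /\ LLfrac Phi LLf (Tres_series Phi P s) = Lfps LL s P.
Proof.
move=> hP sP; rewrite /Tres_series /Lfps; case: ifPn => [ns|].
  exact: (LLfrac_Tres_fracE Phi_neq0 LL_lin LL_cat LL_perm LL_ddir sP ns (hP _)).
rewrite -ltnNge => sn; split; first exact: Cspan0.
rewrite (residue_small rf _ sn); exact: (LLfrac0 Phi_neq0 LL_lin LL_cat LL_perm).
Qed.

(** Every admissible presentation gives the same value, by [Lfps_quotient], and the poles together
    with the inverse units provide one. *)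
Lemma Tres_quotient_LL (u : V' -> C) l :
  let f := Tres_quotient Phi (series_exp l)
    (\big[@series_mul R V/@series1 R V]_(b <- Phi) series_factor (u b) b) in
  spaceS Phi f /\ LLfrac Phi LLf f = Lgen lin LL u Phi (fps_exp lin l).
Proof.
move=> f; pose s0 := poles u Phi; pose P0 : fps Poly := fps_exp lin l * units lin u Phi.
have s0P : {subset s0 <= Phi} by move=> b; rewrite mem_filter => /andP[].
have P0_series : is_series P0.
  exact (is_series_mul (is_series_exp l) (is_series_units u Phi)).
rewrite /f /Tres_quotient.
case: xgetP => [g _ [P [s [hP sP e ->]]]|none].
  have [h1 h2] := Tres_series_LL hP sP; split=> //; rewrite h2.
  apply: (Lfps_quotient rf (sub_ok sP) (sub_ok s0P)).
  rewrite -series_linformsE -series_prodE; exact e.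
case: (none (Tres_series Phi P0 s0)); exists P0, s0; split=> //.
rewrite series_prodE series_linformsE.
exact (unit_factorization lin u Phi s0 (fps_exp lin l)).
Qed.

Lemma JK_Tres_quotient (mu : {measure set (borel V') -> \bar R}) (c : set V') (u : V' -> C) l :
    (forall s : n.-tuple V', bases Phi s ->
      (c `<=` cone s -> LL s 1 = ((fine (mu (box s)))^-1)%:C :> C) /\
      (c `&` cone s = set0 -> LL s 1 = 0 :> C)) ->
    (forall s : n.-tuple V', bases Phi s -> c `<=` cone s \/ c `&` cone s = set0) ->
  JK Phi mu c (Tres_quotient Phi (series_exp l)
    (\big[@series_mul R V/@series1 R V]_(b <- Phi) series_factor (u b) b)) =
  Lgen lin LL u Phi (fps_exp lin l).
Proof.
move=> LLw cc; have [fS <-] := Tres_quotient_LL u l.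
exact: (JK_LLfrac Phi_neq0 LL_lin LL_cat LL_perm LLw cc fS).
Qed.

(** Expand one factor [linform l] at a time: its coefficients, which are linear in [l], become the
    variables of [Q]. This is the source of the polynomial dependence on [l]. *)
Lemma eval_linformX (F : {linear Poly -> C^o}) k (W : Poly) :
  exists Q : Poly, forall l, F (linform l ^+ k * W) = eval_poly Q l.
Proof.
elim: k W => [|k IH] W.
  by exists (mpoly.mpolyC n (F W)) => l; rewrite expr0 mul1r /eval_poly mpoly.mevalC.
have /choice[Q QE] j := IH (mpoly.mpolyX C (mpoly.mnm1 (j : 'I_n)) * W).
exists (\sum_(j < n) mpoly.mpolyX C (mpoly.mnm1 j) * Q j) => l.
rewrite exprSr -mulrA {2}/linform mulr_suml mulr_sumr linear_sum /eval_poly rmorph_sum.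
apply: eq_bigr => j _; rewrite rmorphM /= mpoly.mevalXU -/(eval_poly (Q j) l) -QE.
by rewrite -scalerAl -scalerAr linearZ.
Qed.

Lemma Lgen_polynomial (u : V' -> C) :
  exists Q : Poly, forall l, Lgen lin LL u Phi (fps_exp lin l) = eval_poly Q l.
Proof.
rewrite /Lgen /Lfps; set s0 := poles u Phi; set d := (size s0 - n)%N.
have /choice[Q QE] (i : 'I_d.+1) := eval_linformX (LL s0) i (units lin u Phi (d - i)%N).
exists (\sum_(i < d.+1) (i`!%:R)^-1 *: Q i) => l.
rewrite fpsME linear_sum /eval_poly rmorph_sum; apply: eq_bigr => i _.
by rewrite /= mpoly.mevalZ -/(eval_poly (Q i) l) -QE -scalerAl linearZ.
Qed.

End Quotient.
End SeriesResidue.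

(** * The partition function *)

(** Points congruent modulo 2 i pi [Gamma] have characters that agree on the dual lattice, but not
    on the whole dual space; only the values on [s] and at [l] count. *)
Lemma Psi_ext (R : realType) (V : vectType R) (K : numFieldType) (A : comAlgType K)
    (lin : 'Hom(V, R^o) -> A) (LL : seq 'Hom(V, R^o) -> {linear A -> K^o})
    (u u' : 'Hom(V, R^o) -> K) l s :
  {in s, u =1 u'} -> u l = u' l -> Psi lin LL u l s = Psi lin LL u' l s.
Proof.
move=> uu' ul; rewrite /Psi ul /Lgen; congr (_ * _).
have -> : poles u s = poles u' s by apply: eq_in_filter => b bs; rewrite uu'.
have -> // : units lin u s = units lin u' s.
by apply: eq_big_seq => b bs; rewrite uu'.
Qed.

Lemma Psi_poles_eq0 (R : realType) (V : vectType R) (K : numFieldType) (A : comAlgType K)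
    (lin : 'Hom(V, R^o) -> A) (at0 : {linear A -> K^o}) (ddir : V -> {linear A -> A})
    (w : seq 'Hom(V, R^o) -> K) (u : 'Hom(V, R^o) -> K) l s :
    (forall s', {subset s' <= poles u s} -> size s' = \dim {:V} -> w s' = 0) ->
  Psi lin (LamL at0 ddir w) u l s = 0.
Proof.
by move=> w0; rewrite /Psi /Lgen /Lfps [LamL _ _ _ _ _]Lam_eq0 ?mulr0.
Qed.

(** * Polynomials, the weight of a generic point, and torsion points put together *)

Section Concrete.
Local Open Scope complex_scope.
Variables (R : realType) (V : vectType R).
Local Notation V' := 'Hom(V, R^o).
Local Notation C := R[i].
Local Notation n := (\dim {:V}).
Local Notation Poly := (mpoly.mpoly n C).

Lemma iota_countE N (Phi : N.-tuple V') l : iota_count Phi l = count_solutions Phi l.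
Proof.
case: Phi => s sN; have E := eqP sN; subst N.
rewrite /iota_count /count_solutions; congr (#|` fset_set _|)%fset.
apply/seteqP; split=> y /= yl; rewrite -yl; apply: eq_bigr => k _;
  by rewrite (tnth_nth 0).
Qed.

Definition const_coef (P : Poly) : C^o := at0 P.

Lemma const_coef_linear : linear const_coef.
Proof. by move=> a P Q; rewrite /const_coef /at0 mpoly.mcoeffD mpoly.mcoeffZ. Qed.

HB.instance Definition _ :=
  GRing.isLinear.Build C Poly C^o _ const_coef const_coef_linear.

Definition eulerL : {linear Poly -> Poly} := @euler R V.

Definition const_coefL : {linear Poly -> C^o} := const_coef.

Lemma ddirL_linform t (y : V') : ddirL t (linform y) = ((y t : R)%:C)%:A.
Proof. by rewrite [LHS]ddir_linform mpoly.alg_mpolyC. Qed.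

Lemma concrete_calculus :
  polynomial_calculus (real_complex R) (@linform R V) const_coefL eulerL (@ddirL R V).
Proof.
split; split.
- exact: linformD.
- exact: linformZ.
- by split; [exact: at0_linform | exact: at0_euler].
- exact: ddirM.
- exact: ddirL_linform.
- exact: ddir_euler.
- exact: eulerE.
Qed.

Section Functional.
Variables (Gamma : set V) (g : seq V) (gG : Zbasis Gamma g).
Variable mu : {measure set (borel V') -> \bar R}.
Hypothesis mu_vol : is_lattice_volume (dual_lattice Gamma) mu.
Variables (v0 : V) (x : V').
Local Notation L := (dual_lattice Gamma).

(** Closed under sums, so it contains all the vectors that the reduction builds from [Phi]. *)
Definition ok b := L b /\ 0 < (b v0 : R).

Hypothesis x_generic : forall s, (forall b, b \in s -> ok b) ->
  (size s < n)%N -> x \notin span s.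

Definition ht (b : V') : R := b v0.

Lemma ht_is_additive : additive ht.
Proof. by move=> a b; rewrite /ht !lfunE /= lfunE. Qed.

HB.instance Definition _ := GRing.isZmodMorphism.Build V' R ht ht_is_additive.

Definition weightC s : C := (weight mu x s)%:C.

Lemma concrete_circuit : circuit_weight (real_complex R) ok weightC.
Proof.
have [e eL] := dual_Zbasis gG; split=> [s sN|s s' ss'|s c s_ok sn c0].
- by rewrite /weightC weight_nonspanning.
- by rewrite /weightC (weight_perm _ _ ss').
have := @weight_circuit _ _ _ _ _ eL mu_vol ok ht x _ _ _ s c s_ok _ c0.
rewrite dim_dual => h.
have {}h : \sum_(b <- undup s) c b * weight mu x (rem b s) = 0.
  by apply: h => // b [].
rewrite -[RHS](rmorph0 (real_complex R)) -[in RHS]h rmorph_sum.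
by apply: eq_bigr => b _; rewrite rmorphM.
Qed.

Definition LamC : seq V' -> {linear Poly -> C^o} := LamL const_coefL (@ddirL R V) weightC.

Lemma LamC_residue : residue_functional (real_complex R) (@linform R V) (@ddirL R V) ok LamC.
Proof. exact (Lam_residue concrete_calculus concrete_circuit). Qed.

Lemma const_coefL1 : const_coefL 1 = 1.
Proof. by rewrite /= /const_coef /at0 mpoly.mcoeff1 eqxx. Qed.

Lemma LamC_basis s : size s = n -> LamC s 1 = weightC s :> C.
Proof.
move=> sn; transitivity (weightC s * const_coefL 1); last by rewrite const_coefL1 mulr1.
exact (Lam_basis const_coefL (@ddirL R V) weightC 1 sn).
Qed.

Lemma weightC_vol s : basis_of {:V'} s -> (forall b, b \in s -> L b) -> cone s x ->
  weightC s = ((vol mu s)^-1)%:C.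
Proof. by move=> sb sL sx; rewrite /weightC /weight sb asboolT. Qed.

Lemma weightC_eq0 s : ~ (basis_of {:V'} s /\ cone s x) -> weightC s = 0.
Proof.
move=> sN; rewrite /weightC /weight; case: ifP => // /andP[sb /asboolP sx].
by case: sN.
Qed.

Lemma concrete_torsion M s l : (0 < M)%N -> basis_of {:V'} s ->
    (forall b, b \in s -> ok b) -> (forall y, L y -> Zspan s (y *+ M)) -> L l -> cone s x ->
  (\sum_(k : {ffun 'I_(size g) -> 'I_M} | all (fun b => tchar k b == 1) s) (tchar k l)^-1) *
    weightC s = `[< Zspan s l >]%:R.
Proof.
move=> M0 sb s_ok Ms lL sx; have [e eL] := dual_Zbasis gG.
have sL b : b \in s -> L b by move=> /s_ok[].
rewrite (torsion_sum gG mu_vol M0 sb sL Ms lL) weightC_vol // -mulrA.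
rewrite -(rmorphM (real_complex R)) divff; first by rewrite rmorph1 mulr1.
by rewrite gt_eqF // (vol_gt0 eL mu_vol).
Qed.

Lemma ok_relation s : uniq s -> (forall b, b \in s -> ok b) -> ~~ free s ->
  exists2 c : V' -> int, \sum_(b <- s) b *~ c b = 0 & exists2 b, b \in s & c b != 0.
Proof.
move=> us s_ok sN; have [e [e_basis LE]] := dual_Zbasis gG.
apply: (integral_relation (basis_free e_basis) us _ sN) => b bs.
have : L b by case: (s_ok b bs).
by rewrite LE.
Qed.

Lemma counting_formula s : (forall b, b \in s -> ok b) -> span s = fullv ->
  exists2 M0, (0 < M0)%N & forall M l, (M0 %| M)%N -> (0 < M)%N -> L l -> box s (x - l) ->
    (count_solutions s l)%:R =
    \sum_(k : {ffun 'I_(size g) -> 'I_M}) Psi (@linform R V) LamC (tchar k) l s :> C.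
Proof.
have [e eL] := dual_Zbasis gG.
have okD b y : ok b -> ok y -> ok (b + y).
  move=> [bL b0] [yL y0]; split; first exact: dual_latticeD.
  by rewrite lfunE /=; exact: addr_gt0.
have ok_L b : ok b -> L b by case.
have ok_gt0 b : ok b -> 0 < (b v0 : R) by case.
exact (@counting_theorem R V C (real_complex R) Poly (@linform R V) const_coefL eulerL
  (@ddirL R V) ok weightC concrete_calculus concrete_circuit const_coefL1 L v0 x
  (fun l y => @dual_latticeD R V Gamma l y) (fun l => @dual_latticeN R V Gamma l)
  ok_L ok_gt0 okD x_generic ok_relation (lattice_multiple eL)
  (fun M => {ffun 'I_(size g) -> 'I_M}) (fun M k => tchar k)
  (fun M k => tcharD k) (fun M k => tchar0 k) weightC_eq0 concrete_torsion s).
Qed.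

Section Chamber.
Variables (N : nat) (Phi : N.-tuple V') (c : set V').
Hypotheses (Phi_span : span Phi = fullv) (c_chamber : big_chamber Phi c) (cx : c x).
Hypothesis Phi_ok : forall b, b \in Phi -> ok b.

Lemma ok_neq0 b : ok b -> b != 0.
Proof. by move=> [_ b0]; apply: contraTneq b0 => ->; rewrite lfunE /= ltxx. Qed.

Lemma LamC_chamber (s : n.-tuple V') : bases Phi s ->
  (c `<=` cone s -> LamC s 1 = ((fine (mu (box s)))^-1)%:C :> C) /\
  (c `&` cone s = set0 -> LamC s 1 = 0 :> C).
Proof.
move=> [sP s_free]; have sn := size_tuple s.
have sb : basis_of {:V'} s by rewrite /basis_of (free_spanning s_free sn) eqxx.
rewrite LamC_basis //; split=> cs.
  by rewrite weightC_vol // => [b /sP/Phi_ok[]//|]; exact: cs.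
by apply: weightC_eq0 => -[_ sx]; have : (c `&` cone s) x by []; rewrite cs.
Qed.

Lemma chamber_dichotomy (s : n.-tuple V') : bases Phi s ->
  c `<=` cone s \/ c `&` cone s = set0.
Proof.
move=> [sP s_free]; have [h1 h2] := cone_chamber c_chamber sP s_free (size_tuple s) cx.
have [sx|sx] := pselect (cone s x); [left; exact/h1 | right; exact/h2].
Qed.

Lemma iota_chamberE RG l : iota_chamber Phi mu c RG l =
  \sum_(p <- RG) Psi (@linform R V) LamC (fun b => cexp (pairing b p)) l Phi.
Proof.
apply: eq_bigr => p _; rewrite cexpN /Psi; congr (_ * _).
have Phi_neq0 b : b \in Phi -> b != 0 by move=> /Phi_ok/ok_neq0.
exact (JK_Tres_quotient Phi_neq0 LamC_residue Phi_ok (fun b => cexp (pairing b p)) l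
  LamC_chamber chamber_dichotomy).
Qed.

(** A nonzero term requires, among the poles of [p], a basis whose cone contains [x]; by
    [cone_chamber] this cone contains [c]. *)
Lemma Psi_outside (p : complexified V) l : ~ Gchamber Phi c p ->
  Psi (@linform R V) LamC (fun b => cexp (pairing b p)) l Phi = 0.
Proof.
move=> pN; apply: Psi_poles_eq0 => s sP sn; apply: weightC_eq0 => -[sb sx]; apply: pN.
have s_Phi : {subset s <= Phi} by move=> b /sP; rewrite mem_filter => /andP[].
have sz : size s == n by rewrite sn.
have s_free := basis_free sb.
exists (Tuple sz); last first.
  by move=> b /sP; rewrite mem_filter => /andP[/eqP].
split=> //=; apply: (cone_chamber c_chamber s_Phi s_free sn cx).1.2.
exact: sx.
Qed.

End Chamber.

End Functional.
Section Characters.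
Variables (Gamma : set V) (g : seq V) (gG : Zbasis Gamma g).
Local Notation L := (dual_lattice Gamma).
Implicit Types (a b l : V') (p q : complexified V).

Lemma Gsigma_torsion s p : basis_of {:V'} s -> (forall b, b \in s -> L b) -> Gsigma s p ->
  p.1 = 0 /\ exists2 M, (0 < M)%N & forall a, L a -> pchar p a ^+ M = 1.
Proof.
move=> sb sL ps; split.
  apply: contrapT => /eqP p0; apply: (annihilator_nonspanning p0) (span_basis sb) => b bs.
  by have [] := cexp_eq1 (ps b bs).
have [e eL] := dual_Zbasis gG; have [M M0 Ms] := lattice_multiple eL sb sL.
by exists M => // a aL; rewrite -pcharMn; apply: (pchar_Zspan ps); exact: Ms.
Qed.

Lemma pchar_congr p q a : lattice_2ipi Gamma (p - q) -> L a -> pchar p a = pchar q a.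
Proof.
move=> [v vG pq] aL; have av : (a v : R) \is a Num.int by exact: aL.
have p1 : p.1 = q.1.
  by have /(congr1 fst)/= := pq => /esym/eqP; rewrite subr_eq0 => /eqP.
have p2 : p.2 = q.2 + (2 * pi) *: v.
  by have /(congr1 snd)/= := pq => ->; rewrite addrC subrK.
rewrite -[RHS]mulr1 -((zeta_eq1 (a v)).2 av) /pchar /zeta -cexpD; congr cexp.
apply/eqP; rewrite eq_complex /= p1 p2 addr0 eqxx linearD linearZ /=.
by rewrite eqxx.
Qed.

(** Tested on the dual basis of [g], the hypothesis says that the coordinates of q / (2 i pi) are
    multiples of 1/M; [k] is given by the numerators modulo M. *)
Lemma tpoint_exists q M : (0 < M)%N -> q.1 = 0 -> (forall a, L a -> pchar q a ^+ M = 1) ->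
  exists k : {ffun 'I_(size g) -> 'I_M}, lattice_2ipi Gamma (tpoint k - q).
Proof.
move=> M0 q1 qM; have [g_basis GE] := gG.
have MR0 : M%:R != 0 :> R by rewrite pnatr_eq0 -lt0n.
have pi0 : 2 * pi != 0 :> R by rewrite mulf_neq0 ?pnatr_eq0 // gt_eqF // pi_gt0.
pose r (i : 'I_(size g)) : R := crd i q.2 / (2 * pi).
have rM i : r i * M%:R \is a Num.int.
  pose l : V' := linfun (fun v : V => coord (in_tuple g) i v : R^o).
  have lL : L l.
    apply/(dual_latticeP gG) => j.
    by rewrite lfunE /= (coord_free j i (basis_free g_basis : free (in_tuple g))) rpred_nat.
  apply/zeta_eq1; rewrite mulr_natr zetaMn -[RHS](qM l lL); congr (_ ^+ _).
  congr cexp; apply/eqP; rewrite eq_complex /= q1 linear0 eqxx /=.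
  by rewrite lfunE /= /r mulrC divfK.
pose z i := Num.floor (r i * M%:R).
have zE i : (z i)%:~R = r i * M%:R by rewrite /z (floorK (rM i)).
have zM i : (`|(z i %% M)%Z| < M)%N.
  by rewrite -ltz_nat gez0_abs ?modz_ge0 ?ltz_pmod // -lt0n.
exists [ffun i => Ordinal (zM i)].
exists (\sum_(i < size g) g`_i *~ (- (z i %/ M)%Z)); first by rewrite GE; exists (fun i => - (z i %/ M)%Z).
rewrite /tpoint; apply/eqP; rewrite -pair_eqE /= q1 subrr eqxx /=; apply/eqP.
have q2E : q.2 = (2 * pi) *: \sum_(i < size g) r i *: g`_i.
  rewrite {1}(crdE g_basis q.2) scaler_sumr; apply: eq_bigr => i _.
  by rewrite scalerA mulrC /r divfK.
rewrite [in RHS]q2E -scalerBr -sumrB; congr (_ *: _); apply: eq_bigr => i _.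
rewrite -scalerBl -scaler_int ffunE /=; congr (_ *: _).
apply: (mulIf MR0); rewrite mulrBl divfK // -zE.
rewrite -[X in _ = X - _]/(`|(z i %% M)%Z|%:Z%:~R) gez0_abs; last first.
  by rewrite modz_ge0 // -[M%:Z != 0]/(M != 0%N) -lt0n.
rewrite -[M%:R]/(M%:Z%:~R) -intrM -intrB; congr (_%:~R).
by rewrite [X in _ = _ - X](divz_eq (z i) M) opprD addrCA subrr addr0 mulNr.
Qed.

Lemma tpoint_inj q M (k k' : {ffun 'I_(size g) -> 'I_M}) :
  lattice_2ipi Gamma (tpoint k - q) -> lattice_2ipi Gamma (tpoint k' - q) -> k = k'.
Proof.
move=> [v + kv] [v' + k'v']; have [g_basis GE] := gG; rewrite GE => -[z vE] [z' v'E].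
have pi0 : 2 * pi != 0 :> R by rewrite mulf_neq0 ?pnatr_eq0 // gt_eqF // pi_gt0.
have : (2 * pi : R) *: (v - v') = (2 * pi) *: \sum_(i < size g)
    ((k i)%:R / M%:R - (k' i)%:R / M%:R : R) *: g`_i.
  rewrite scalerBr; have /(congr1 snd)/= -> := kv; have /(congr1 snd)/= -> := k'v'.
  rewrite opprB addrA subrK -scalerBr -sumrB; congr (_ *: _).
  by apply: eq_bigr => i _; rewrite scalerBl.
move/(scalerI pi0) => vv'; apply/ffunP => i.
have M0 : (0 < M)%N by exact: leq_ltn_trans (leq0n _) (ltn_ord (k i)).
have MR0 : M%:R != 0 :> R by rewrite pnatr_eq0 -lt0n.
have := congr1 (crd (s := g) i) vv'; rewrite (crd_sum g_basis).
have -> : v - v' = \sum_(j < size g) ((z j - z' j)%:~R : R) *: g`_j.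
  by rewrite vE v'E -sumrB; apply: eq_bigr => j _; rewrite scaler_int mulrzBr.
rewrite (crd_sum g_basis) -mulrBl => /(congr1 ( *%R^~ M%:R)); rewrite divfK //.
rewrite -[(k i)%:R]/((k i)%:Z%:~R) -[(k' i)%:R]/((k' i)%:Z%:~R) -[M%:R]/(M%:Z%:~R).
rewrite -intrB -intrM => /(@intr_inj R) /esym/eqP; rewrite subr_eq => /eqP kE.
apply: val_inj => /=.
have : ((k i)%:Z %% M)%Z = ((k' i)%:Z %% M)%Z by rewrite kE modzMDl.
by rewrite !modz_small ?lez_nat ?ltz_nat ?leq0n ?ltn_ord // => -[].
Qed.

End Characters.
End Concrete.

Section Sums.
Variables (R : realType) (V : vectType R) (Gamma : set V) (g : seq V).
Hypothesis gG : Zbasis Gamma g.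
Local Notation V' := 'Hom(V, R^o).
Local Notation C := R[i].
Local Notation L := (dual_lattice Gamma).
Variables (N : nat) (Phi : N.-tuple V') (c : set V') (RG : {fset complexified V}).
Hypotheses (Phi_L : forall b, b \in Phi -> L b) (Phi_span : span Phi = fullv).
Hypothesis RG_rep : is_representatives Phi Gamma c RG.

Lemma Gchamber_torsion (p : complexified V) : Gchamber Phi c p ->
  p.1 = 0 /\ exists2 M, (0 < M)%N & forall a, L a -> pchar p a ^+ M = 1.
Proof.
move=> [s [[sP s_free] cs] ps]; apply: (Gsigma_torsion gG _ _ ps).
  by rewrite /basis_of (free_spanning s_free (size_tuple s)) eqxx.
by move=> b /sP/Phi_L.
Qed.

(** [M] is [M0] times a multiple of the order of each representative. The [tpoint k] outside
    [Gchamber] contribute 0; the others correspond one to one to [RG] through [near]. *)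
Lemma sum_representatives (F : complexified V -> C) (M0 : nat) : (0 < M0)%N ->
    (forall p, ~ Gchamber Phi c p -> F p = 0) ->
    (forall p q, lattice_2ipi Gamma (p - q) -> F p = F q) ->
  exists2 M, (0 < M)%N /\ (M0 %| M)%N &
    \sum_(k : {ffun 'I_(size g) -> 'I_M}) F (tpoint k) = \sum_(p <- RG) F p.
Proof.
move=> M0_gt0 F0 Fcongr; have [RG_in RG_ex] := RG_rep.
have /choice[Mq MqP] (q : complexified V) : exists M, (0 < M)%N /\
    (q \in RG -> forall a, L a -> pchar q a ^+ M = 1).
  have [qRG|qN] := boolP (q \in RG); last by exists 1%N.
  have [_ [M M_gt0 qM]] := Gchamber_torsion (RG_in q qRG).
  by exists M.
pose M := (M0 * \prod_(q <- RG) Mq q)%N.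
have Mprod_gt0 : (0 < \prod_(q <- RG) Mq q)%N by apply: prodn_gt0 => q; case: (MqP q).
have M_gt0 : (0 < M)%N by rewrite muln_gt0 M0_gt0.
exists M; first by split=> //; exact: dvdn_mulr.
have qM q a : q \in RG -> L a -> pchar q a ^+ M = 1.
  move=> qRG aL; have [_ /(_ qRG a aL) q1] := MqP q.
  have /dvdnP[d ->] : (Mq q %| M)%N.
    by rewrite /M (big_rem q) //= dvdn_mull // dvdn_mulr.
  by rewrite mulnC exprM q1 expr1n.
pose near (k : {ffun 'I_(size g) -> 'I_M}) q := `[< lattice_2ipi Gamma (tpoint k - q) >].
transitivity (\sum_(k : {ffun 'I_(size g) -> 'I_M}) \sum_(q <- RG) if near k q then F (tpoint k) else 0).
  apply: eq_bigr => k _; have [kG|kN] := pselect (Gchamber Phi c (tpoint k)); last first.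
    by rewrite F0 // big1 // => q _; case: ifP.
  have [q [[qRG kq] q_uniq]] := RG_ex _ kG.
  rewrite (bigD1_seq q) ?fset_uniq //= {1}/near asboolT // big_seq_cond big1 ?addr0 //.
  move=> p /andP[pRG pq]; case: ifP => // /asboolP kp.
  by case/eqP: pq; apply/esym/q_uniq.
rewrite exchange_big /=; apply: eq_big_seq => q qRG.
have [q1 _] := Gchamber_torsion (RG_in q qRG).
have [k kq] := tpoint_exists gG M_gt0 q1 (fun a => qM q a qRG).
rewrite (bigD1 k) //= {1}/near asboolT // big1 ?addr0; first exact: Fcongr.
move=> k' k'k; case: ifP => // /asboolP k'q.
by case/eqP: k'k; exact: (tpoint_inj gG k'q kq).
Qed.

End Sums.

Theorem theorem3p1 (R : realType) (V : vectType R) (Gamma : set V)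
    (N : nat) (Phi : N.-tuple 'Hom(V, R^o))
    (mu : {measure set (borel 'Hom(V, R^o)) -> \bar R})
    (c : set 'Hom(V, R^o)) (RG : {fset complexified V}) :
  is_lattice Gamma ->
  (forall b, b \in Phi -> dual_lattice Gamma b) ->
  <<Phi>>%VS = fullv ->
  (exists v : V, forall b, b \in Phi -> 0 < (b v : R)) ->
  is_lattice_volume (dual_lattice Gamma) mu ->
  big_chamber Phi c ->
  is_representatives Phi Gamma c RG ->
  periodic_polynomial (dual_lattice Gamma) (iota_chamber Phi mu c RG) /\
  (forall lambda : 'Hom(V, R^o), dual_lattice Gamma lambda ->
     [set x - y | x in c & y in box Phi] lambda ->
     (iota_count Phi lambda)%:R = iota_chamber Phi mu c RG lambda).
Proof.
move=> [g gG] Phi_L Phi_span [v0 v0P] mu_vol c_chamber RG_rep.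
have [e eL] := dual_Zbasis gG.
have Phi_ok b : b \in Phi -> ok Gamma v0 b by move=> bP; split; [exact: Phi_L | exact: v0P].
have ok_e b : ok Gamma v0 b -> Zspan e b.
  by move=> [bL _]; have [_ LE] := eL; rewrite LE in bL.
have [x0 cx0] : exists x0, c x0.
  have [x1 x1w cE] := c_chamber; exists x1; rewrite cE.
  exact: (@connected_component_refl (vtop 'Hom(V, R^o))).
split.
  have box0 : box Phi 0.
    by exists (fun=> 0) => [i|]; rewrite ?lexx ?ler01 // big1 // => i _; rewrite scale0r.
  (* Periodic polynomiality concerns all [lambda] at once, and any generic point of the chamber
     computes [iota_chamber]. *)
  have [x [cx _ x_generic]] := generic_point Phi_span c_chamber ok_e cx0 box0.
  have /choice[Q QE] (p : complexified V) := Lgen_polynomial Phi (LamC mu x) (pchar p).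
  exists (size RG), (fun i l => pchar RG`_i (- l)), (fun i => Q RG`_i); split=> [i|l lL].
    have iRG : RG`_i \in RG by exact: mem_nth.
    have [_ [M M_gt0 pM]] := Gchamber_torsion gG Phi_L (RG_rep.1 _ iRG).
    split=> [a b _ _|a aL]; first by rewrite opprD pcharD.
    by exists M => //; rewrite pM //; exact: dual_latticeN.
  rewrite (iota_chamberE gG mu_vol x_generic c_chamber cx Phi_ok).
  rewrite (big_nth 0) big_mkord; apply: eq_bigr => i _.
  by rewrite -QE /Psi pcharN.
move=> l lL [x1 cx1 [y yB x1y]].
(* Here [x] depends on [lambda]: it is a generic point of the chamber for which x - lambda still
   lies in [box Phi]. *)
have [x [cx xB x_generic]] := generic_point Phi_span c_chamber ok_e cx1 yB.
rewrite x1y in xB.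
have [M0 M0_gt0 count_eq] := counting_formula gG mu_vol x_generic Phi_ok Phi_span.
pose F (p : complexified V) : R[i] :=
  Psi (@linform R V) (LamC mu x) (fun b => cexp (pairing b p)) l Phi.
have F0 p : ~ Gchamber Phi c p -> F p = 0.
  exact: (Psi_outside mu c_chamber cx).
have Fcongr p q : lattice_2ipi Gamma (p - q) -> F p = F q.
  move=> pq; apply: Psi_ext; last exact: (pchar_congr pq lL).
  by move=> b bP; exact: (pchar_congr pq (Phi_L b bP)).
have [M [M_gt0 M0M] sumM] := sum_representatives gG Phi_L RG_rep M0_gt0 F0 Fcongr.
rewrite iota_countE (iota_chamberE gG mu_vol x_generic c_chamber cx Phi_ok).
by rewrite -/F -sumM (count_eq M l M0M M_gt0 lL xB).
Qed.
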